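(* Fix $p\in[0,1]$. The distribution of $A$ does not depend on the distribution $m$ of interdistances. Furthermore, its generating series $f:x\mapsto f(x)=\mathbb E[x^A\mathbf 1_{\{A<\infty\}}]$ satisfies, for all $x\in[-1,1]$, $$p\,x\,f(x)^4-(1+2p)\,x\,f(x)^2+2f(x)-(1-p)\,x=0.$$
   Context: Model (half-line three-speed ballistic annihilation). Let $p\in[0,1]$ and let $m$ be a probability measure on $(0,\infty)$. Let $(x_n)_{n\ge1}$ be such that $x_1,x_2-x_1,x_3-x_2,\dots$ are i.i.d. with law $m$; let $(v_n)_{n\ge1}$ be i.i.d. with $\mathbb P(v_n=0)=p$, $\mathbb P(v_n=-1)=\mathbb P(v_n=+1)=\frac{1-p}2$; let $(s_n)_{n\ge1}$ (spins) be i.i.d. uniform on $\{-1,+1\}$; the three sequences are independent. Particle $\bullet_n$ starts at time $0$ at $x_n$ and moves at constant velocity $v_n$ until it is annihilated. When exactly two particles meet, both are annihilated and removed. When three particles meet (necessarily a static particle $\bullet_i$, a right-moving one and a left-moving one), the static particle and one of the two moving particles are annihilated, and the other moving particle continues unperturbed: the right-moving one survives if $s_i=+1$ and the left-moving one survives if $s_i=-1$. Since velocities are bounded and starting points have no accumulation point, this almost surely defines the evolution. $\{0\leftarrow\bullet_k\}$ is the event that $\bullet_k$ crosses location $0$ from the right, i.e. $v_k=-1$ and $\bullet_k$ is not annihilated when or before it reaches $0$. The random variable $A$ is $A=\min\{k\ge1: 0\leftarrow\bullet_k\}$, with $A=\infty$ if no particle reaches $0$. *)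

(* Defs.v *)
(* MathComp-Analysis *)
From mathcomp Require Import all_boot all_order all_algebra.
From mathcomp Require Import all_classical all_reals all_analysis.

Set Implicit Arguments.
Unset Strict Implicit.
Unset Printing Implicit Defensive.

Import Order.TTheory GRing.Theory Num.Theory.
Import numFieldNormedType.Exports.

Local Open Scope classical_set_scope.
Local Open Scope ring_scope.

(* Particles are numbered from 0: index [n : nat] stands for the particle
   bullet_{n+1}; [first_arrival] undoes this shift.

   A configuration is given by the starting points [x], the velocities [v] and
   the spins [s].  Its evolution is encoded by the annihilation times
   [D : nat -> \bar R], with [D n = +oo] if particle [n] is never annihilated;
   particle [n] is at [x n + v n * t] at every time [t <= D n]. *)
Section Dynamics.
Context {R : realType}.
Implicit Types (x v s : nat -> R) (D : nat -> \bar R) (t : R).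

(* The inequalities on [D] are not strict: a particle annihilated at time [t]
   takes part in the collision that annihilates it. *)
Definition meet x v D t (i j : nat) : Prop :=
  [/\ i != j, (t%:E <= D i)%E, (t%:E <= D j)%E
    & x i + v i * t = x j + v j * t].

Definition double_collision x v D t (i j : nat) : Prop :=
  meet x v D t i j /\ forall k, k != j -> ~ meet x v D t i k.

Definition triple_collision x v D t (r c l : nat) : Prop :=
  [/\ v r = 1, v c = 0, v l = -1, meet x v D t r c & meet x v D t c l].

(* In a triple collision, the right-moving particle [r] survives if the spin of
   the static particle [c] is +1, the left-moving particle [l] if it is -1. *)
Definition dies_at x v s D t (i : nat) : Prop :=
  (exists j, double_collision x v D t i j) \/
  (exists r c l, triple_collision x v D t r c l /\
     [\/ i = c, i = r /\ s c = -1 | i = l /\ s c = 1]).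

Definition evolution x v s D : Prop :=
  forall i, (0 < D i)%E /\
    forall t, 0 < t -> (D i = t%:E <-> dies_at x v s D t i).

(* The almost sure properties under which there is exactly one evolution. *)
Definition well_posed x v s : Prop :=
  [/\ 0 < x 0%N /\ forall n, x n < x n.+1,
      x n @[n --> \oo] --> +oo,
      forall n, [\/ v n = -1, v n = 0 | v n = 1]
    & forall n, s n = -1 \/ s n = 1].

(* The particle [k] would be at location 0 at time [x k].  No particle reaches 0
   in a configuration which is not well-posed: this convention only concerns a
   null event, on which the evolution is left undefined. *)
Definition reaches0 x v s (k : nat) : Prop :=
  well_posed x v s /\
  exists D, [/\ evolution x v s D, v k = -1 & ((x k)%:E < D k)%E].

(* The random variable A, with values in {1, 2, ...} and [None] for infinity. *)
Definition first_arrival x v s : option nat :=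
  if pselect (exists k, `[< reaches0 x v s k >]) is left ex
  then Some (ex_minn ex).+1 else None.

End Dynamics.

Section Model.
Context {d : measure_display} {T : measurableType d} {R : realType}.
Implicit Types (P : probability T R) (m : probability (measurableTypeR R) R).

Definition mutually_independent P (I : eqType) (Y : I -> T -> R) : Prop :=
  forall (J : seq I) (B : I -> set R), uniq J ->
    (forall i, measurable (B i)) ->
    P (\bigcap_(i in [set` J]) (Y i @^-1` B i)) =
    (\prod_(i <- J) P (Y i @^-1` B i))%E.

Definition interdistance (x : nat -> T -> R) (n : nat) (w : T) : R :=
  if n is n'.+1 then x n w - x n' w else x 0%N w.

(* Three independent i.i.d. sequences amount to a single mutually independent
   family with identically distributed subfamilies. *)
Definition ballistic_model (p : R) m P (x v s : nat -> {RV P >-> R}) : Prop :=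
  [/\ m [set r | 0 < r] = 1%E,
      forall n (B : set R), measurable B ->
        P (interdistance x n @^-1` B) = m B,
      forall n, [/\ P (v n @^-1` [set 0]) = p%:E,
                    P (v n @^-1` [set -1]) = ((1 - p) / 2)%:E
                  & P (v n @^-1` [set 1]) = ((1 - p) / 2)%:E],
      forall n, P (s n @^-1` [set -1]) = (1 / 2)%:E /\
                P (s n @^-1` [set 1]) = (1 / 2)%:E
    & mutually_independent P (fun i : nat + (nat + nat) =>
        match i with
        | inl n => interdistance x n
        | inr (inl n) => v n
        | inr (inr n) => s n
        end)].

Definition arrival_index (x v s : nat -> T -> R) (w : T) : option nat :=
  first_arrival (x ^~ w) (v ^~ w) (s ^~ w).

(* z |-> E[z^A 1_{A < oo}] *)
Definition generating_series P (A : T -> option nat) (z : R) : R :=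
  fine ('E_P[fun w => if A w is Some k then z ^+ k else 0]).

End Model.

(* Main.v *)
(* Call a_n = P(A = n) and g_n the probability that the particles 1 and n
   annihilate each other in a double collision.  Consider the first particle.
   If it is static, it has to be hit from the right, and then a fresh half-line
   has to produce an arrival: this contributes p a*a (convolution).  If it moves
   to the right and annihilates with particle k, a fresh half-line starts after
   k: this contributes g*a.  If it moves to the right and annihilates with a static
   particle, the latter must be reached later (or at the same time, with spin -1)
   from the right; reflecting the whole block, with reversed spins, exchanges the
   two sides, so this contributes (p/2) a*a.

   To compute g, put a right-moving particle in front of a half-line whose first
   arrival is particle n.  Either the two annihilate each other, or the new one has
   annihilated with a static particle, so that the particle which otherwise would
   have hit the latter arrives first and n arrives second:
   ((1-p)/2) a_(n-1) = g_n + (p/2) (a*a*a)_(n-1).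

   These relations determine (a_n), whatever the law of the interdistances, and
   eliminating g between the generating series gives the equation. *)

(* All events are read on a finite block of particles. No particle is faster than a left-moving one,
   so what starts to the right of an arriving particle k never catches up with it: the arrival is
   decided by the block that ends at k, and the half-line after k is fresh. The dynamics is
   therefore defined for an arbitrary set of particles, and evolutions are compared, cut and glued.

   The law m may have atoms, so that triple collisions and ties can have positive probability.
   Reversing the spins together with space preserves the collision rule and exchanges the two
   outcomes of a tie; hence the exact factor 1/2.

   Measurability of the events is not visible on the dynamics, which quantifies over a continuum of
   times; it follows from the same decompositions, by induction on the length of the block.

   The coefficient 1 + 2p of the equation is 3p + (1 - p): twice the p + p/2 due to static
   particles, and twice the (1 - p)/2 that occurs in g. The endpoints -1 and 1 are included, so the
   series are multiplied by means of absolute convergence only. *)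
Require Import Defs.
From mathcomp Require Import all_boot all_order all_algebra.
From mathcomp Require Import all_classical all_reals all_analysis.
From mathcomp Require Import measurable_realfun.
From mathcomp Require Import lra zify ring.

Set Implicit Arguments.
Unset Strict Implicit.
Unset Printing Implicit Defensive.

Import Order.TTheory GRing.Theory Num.Theory.
Import numFieldNormedType.Exports.
Local Open Scope classical_set_scope.
Local Open Scope ring_scope.

(** * Evolution of a set of particles *)

Section Evolution.
Context {R : realType}.
Implicit Types (x v s : nat -> R) (al : nat -> R -> Prop) (I : pred nat).

(** Local finiteness is kept apart: it is asked of each set of particles separately, and is
    automatic for a finite block. *)
Record good x v s : Prop := Good {
  good_incr : forall i j, (i < j)%N -> x i < x j;
  good_vel : forall i, [\/ v i = -1, v i = 0 | v i = 1];
  good_spin : forall i, s i = -1 \/ s i = 1 }.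

Definition position x v i t := x i + v i * t.

Definition collide x v al t i j :=
  [/\ i != j, al i t, al j t & position x v i t = position x v j t].

(* [al i t] means that particle [i] is present at time [t], the time of its
   annihilation included.  A particle survives a collision only if it is triple
   and its velocity is the spin of the static particle. *)
Definition dying x v s al t i :=
  (exists j, collide x v al t i j) /\
  ~ (exists c j, [/\ collide x v al t i c, collide x v al t i j, c != j, v c = 0
                   & s c = v i]).

Definition evolves x v s I al := forall i t,
  al i t <-> I i /\ forall t', 0 < t' < t -> ~ dying x v s al t' i.

Definition locally_finite x I := forall X : R, exists N, forall i, I i -> x i <= X -> (i < N)%N.

Section Fixed.
Context (x v s : nat -> R) (G : good x v s).

Local Notation pos := (position x v).
Local Notation coll := (collide x v).
Local Notation dies := (dying x v s).
Local Notation ev := (evolves x v s).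
Local Notation locfin := (locally_finite x).

Lemma x_lt i j : (i < j)%N -> x i < x j.
Proof. exact: (good_incr G). Qed.

Lemma x_le i j : (i <= j)%N -> x i <= x j.
Proof. by rewrite leq_eqVlt => /orP[/eqP->//|/x_lt/ltW]. Qed.

Lemma posL i t : v i = -1 -> pos i t = x i - t.
Proof. by rewrite /position => ->; lra. Qed.

Lemma pos0 i t : v i = 0 -> pos i t = x i.
Proof. by rewrite /position => ->; lra. Qed.

Lemma posR i t : v i = 1 -> pos i t = x i + t.
Proof. by rewrite /position => ->; lra. Qed.

Lemma pos_ge i t : 0 <= t -> x i - t <= pos i t.
Proof. by rewrite /position; case: (good_vel G i) => -> ?; lra. Qed.

Lemma posNL i t : 0 <= t -> v i != -1 -> x i <= pos i t.
Proof.
by rewrite /position; case: (good_vel G i) => ->; rewrite ?eqxx// => ? _; lra.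
Qed.

Lemma posNR i t : 0 <= t -> v i != 1 -> pos i t <= x i.
Proof.
by rewrite /position; case: (good_vel G i) => ->; rewrite ?eqxx// => ? _; lra.
Qed.

Lemma same_vel i j t : pos i t = pos j t -> v i = v j -> i = j.
Proof.
rewrite /position => + e; rewrite e => h.
by case: (ltngtP i j) => // /x_lt ?; exfalso; lra.
Qed.

Lemma coll_vel al t i j : coll al t i j -> v i <> v j.
Proof. by case=> /eqP ne _ _ e ev'; apply: ne; exact: same_vel e ev'. Qed.

Lemma coll_sym al t i j : coll al t i j -> coll al t j i.
Proof. by case=> ne ai aj e; split=> //; rewrite eq_sym. Qed.

Lemma coll_trans al t i j k : j != k -> coll al t i j -> coll al t i k -> coll al t j k.
Proof. by move=> njk [_ _ aj e] [_ _ ak e']; split=> //; rewrite -e -e'. Qed.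

(** Pigeonhole: distinct particles at one place and time have distinct velocities, and there are
    three of these. *)
Lemma no_four i j k l t : uniq [:: i; j; k; l] ->
  pos j t = pos i t -> pos k t = pos i t -> pos l t = pos i t -> False.
Proof.
rewrite /= !inE !negb_or => /and4P[/and3P[/eqP ij /eqP ik /eqP il] /andP[/eqP jk /eqP jl]].
move=> /eqP kl _ ej ek el.
have h a b : a <> b -> pos a t = pos b t -> v a <> v b.
  by move=> ab e /(same_vel e).
move: (h _ _ ij (esym ej)) (h _ _ ik (esym ek)) (h _ _ il (esym el)).
move: (h _ _ jk) (h _ _ jl) (h _ _ kl); rewrite ej ek el.
move=> /(_ erefl) + /(_ erefl) + /(_ erefl).
by case: (good_vel G i) => ->; case: (good_vel G j) => ->;
   case: (good_vel G k) => ->; case: (good_vel G l) => ->; lra.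
Qed.

Lemma spin0 c : s c <> 0.
Proof. by case: (good_spin G c) => ->; lra. Qed.

Lemma static_dies al t i j : v i = 0 -> coll al t i j -> dies al t i.
Proof.
move=> vi c; split; first by exists j.
by case=> k [l [_ _ _ _]]; rewrite vi => /spin0.
Qed.

(** A particle is saved only by the spin of the static particle present, which is unique and names
    one velocity. Particles of distinct velocities cannot both be saved, and the static one never
    is. *)
Lemma coll_dies al t i j : coll al t i j -> dies al t i \/ dies al t j.
Proof.
move=> c; have [|nd] := pselect (dies al t i); [by left|right].
have [k [l [ik il kl vk sk]]] :
    exists k l, [/\ coll al t i k, coll al t i l, k != l, v k = 0 & s k = v i].
  by apply: contrapT => h; apply: nd; split=> //; exists j.
have [e|jk] := eqVneq j k; first by subst k; exact: static_dies vk (coll_sym c).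
have vi : v i <> 0 by rewrite -sk; exact: spin0.
split; first by exists i; exact: coll_sym.
case=> k' [l' [jk' _ _ vk' sk']].
have ek : k' = k.
  apply: (@same_vel _ _ t); last by rewrite vk vk'.
  by case: jk' ik c => _ _ _ <- [_ _ _ <-] [_ _ _ ->].
by apply: (coll_vel c); rewrite -sk' -sk ek.
Qed.

(** The second particle [k] at the same point serves the inductions on [rank]: it certifies that a
    meeting takes place at time [t], so the rank of [t] is strictly below that of the later time
    under study. *)
Lemma dies_congr al al' t i :
  (forall j k, j != k -> pos j t = pos i t -> pos k t = pos i t ->
     al k t \/ al' k t -> al i t \/ al' i t -> (al j t <-> al' j t)) ->
  dies al t i <-> dies al' t i.
Proof.
move=> h; have hc j : coll al t i j <-> coll al' t i j.
  split=> -[ne ai aj e]; (split=> //; [apply/(h i j)|apply/(h j i)]) => //;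
    by rewrite 1?eq_sym //; auto.
split=> -[[j cj] ne]; (split; first by exists j; apply/hc).
- by case=> c [k [/hc? /hc ? ? ? ?]]; apply: ne; exists c, k; split.
- by case=> c [k [/hc? /hc ? ? ? ?]]; apply: ne; exists c, k; split.
Qed.

Section Ev.
Context (I : pred nat) (al : nat -> R -> Prop) (E : ev I al).

Lemma ev_sub i t : al i t -> I i. Proof. by case/E. Qed.

Lemma ev_mono i t t' : t' <= t -> al i t -> al i t'.
Proof.
by move=> le /E[Ii h]; apply/E; split=> // u /andP[u0 ut]; apply: h; rewrite u0 /=; lra.
Qed.

Lemma dies_al t i : dies al t i -> al i t.
Proof. by case=> -[j [? ? ? ?]]. Qed.

Lemma ev_dies t t' i : 0 < t -> dies al t i -> al i t' -> t' <= t.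
Proof. by move=> t0 d /E[_ h]; rewrite leNgt; apply/negP => lt; apply: (h t) => //; rewrite t0. Qed.

Lemma ev_dead i t : I i -> ~ al i t -> exists2 t', 0 < t' < t & dies al t' i.
Proof.
move=> Ii n; apply: contrapT => h; apply: n; apply/E; split=> // t' ht d.
by apply: h; exists t'.
Qed.

Lemma dies_uniq t t' i : 0 < t -> 0 < t' -> dies al t i -> dies al t' i -> t = t'.
Proof.
move=> t0 t0' d d'; apply/eqP; rewrite eq_le.
by rewrite (ev_dies t0' d' (dies_al d)) (ev_dies t0 d (dies_al d')).
Qed.

(** Recovers a death from the times of presence alone, so that it passes between evolutions that
    agree on the presence of [i], without a comparison of their collisions. *)
Lemma diesP t i : 0 < t -> dies al t i <-> (forall t', al i t' <-> t' <= t).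
Proof.
move=> t0; split=> [d t'|h].
  by split=> [|le]; [exact: ev_dies|exact: ev_mono le (dies_al d)].
have ai : al i t by apply/h.
have [|t' /andP[t'0 t'1] d] := @ev_dead i (t + 1) (ev_sub ai).
  by move/h; lra.
suff -> : t = t' by [].
apply/eqP; rewrite eq_le; apply/andP; split; last by apply/h; exact: dies_al.
exact: ev_dies d ai.
Qed.

Lemma no_crossing i j t : (i < j)%N -> 0 <= t -> al i t -> al j t -> pos i t <= pos j t.
Proof.
move=> ij t0 ai aj; rewrite leNgt; apply/negP => lt.
have xij := x_lt ij.
(* To exchange their order the particles must meet before [t], where one of them dies. Three pairs
   of velocities approach each other; each gives its meeting time. *)
have [u /andP[u0 ut] e] : exists2 u, 0 < u < t & pos i u = pos j u.
  move: lt; rewrite /position; case: (good_vel G i) => ->; case: (good_vel G j) => -> h;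
    try lra.
  - by exists (x j - x i); lra.
  - by exists ((x j - x i) / 2); lra.
  - by exists (x j - x i); lra.
have c : coll al u i j.
  by split=> //; [rewrite ltn_eqF|apply: ev_mono ai; exact: ltW|apply: ev_mono aj; exact: ltW].
by case: (coll_dies c) => /(ev_dies u0) h; [have := h _ ai|have := h _ aj]; lra.
Qed.

(** A particle that does not move left never goes below its starting point, and two left-movers
    never meet: beyond all starting points, a left-mover has nobody to meet. *)
Lemma escape_left a k t0 : (forall i, I i -> (a <= i)%N) -> v k = -1 -> 0 <= t0 ->
  x k - t0 < x a -> al k t0 -> forall t, al k t.
Proof.
move=> Ia vk t00 ka ak t; apply: contrapT => n.
have [t' /andP[t'0 t't] d] := ev_dead (ev_sub ak) n.
have le : t0 <= t' by apply: ev_dies d ak.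
case: d => -[j cj] _; have := coll_vel cj; case: cj => _ _ aj + nv.
have := x_le (Ia _ (ev_sub aj)).
rewrite (posL _ vk); have := @posNL j t' (ltW t'0) _.
have -> : v j != -1 by apply/eqP => e; apply: nv; rewrite vk.
by move=> /(_ isT); lra.
Qed.

Lemma escape_right b k t0 : (forall i, I i -> (i <= b)%N) -> v k = 1 -> 0 <= t0 ->
  x b < x k + t0 -> al k t0 -> forall t, al k t.
Proof.
move=> Ib vk t00 ka ak t; apply: contrapT => n.
have [t' /andP[t'0 t't] d] := ev_dead (ev_sub ak) n.
have le : t0 <= t' by apply: ev_dies d ak.
case: d => -[j cj] _; have := coll_vel cj; case: cj => _ _ aj + nv.
have := x_le (Ib _ (ev_sub aj)).
rewrite (posR _ vk); have := @posNR j t' (ltW t'0) _.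
have -> : v j != 1 by apply/eqP => e; apply: nv; rewrite vk.
by move=> /(_ isT); lra.
Qed.

End Ev.

(* Whether [i] is alive at time [t] depends only on the collisions in a backward
   light cone, which contains finitely many possible meeting times: existence and
   uniqueness of the evolution, and comparisons between evolutions, go by
   induction on their number. *)
Definition meeting_times N : seq R :=
  [seq (x j - x i) / (v i - v j) | i <- iota 0 N, j <- iota 0 N].

Definition rank N t := count (fun u : R => u < t) (meeting_times N).

Lemma rank_lt N i j t t' : (i < N)%N -> (j < N)%N -> i != j ->
  pos i t' = pos j t' -> t' < t -> (rank N t' < rank N t)%N.
Proof.
move=> iN jN ij e lt.
have mt : t' \in meeting_times N.
  apply/allpairsP; exists (i, j); rewrite !mem_iota /= !add0n iN jN; split=> //.
  have nv : v i - v j != 0.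
    by rewrite subr_eq0; apply: contraNneq ij => ev'; rewrite (same_vel e ev').
  apply: (mulIf nv); rewrite divfK//; move: e; rewrite /position; lra.
rewrite /rank.
have -> : count (fun u : R => u < t) (meeting_times N) =
   (count (fun u : R => (u < t')%R) (meeting_times N) +
    count (fun u : R => (t' <= u < t)%R) (meeting_times N))%N.
  elim: (meeting_times N) => //= u l ->.
  case: (ltP u t') => h /=; last by rewrite addnCA.
  by rewrite (lt_trans h lt) /= !addnA.
rewrite -addn1 leq_add2l -has_count; apply/hasP; exists t' => //.
by rewrite lexx lt.
Qed.

(** [X] bounds the light cone on the right: position plus time never decreases along a trajectory,
    so every particle met before [t] starts at or below [X], and there are finitely many of
    these. *)
Lemma cone_coll N X i j t t' I :
  (forall k, I k -> x k <= X -> (k < N)%N) -> 0 < t' < t ->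
  pos i t + t <= X -> I i -> I j -> i != j -> pos i t' = pos j t' ->
  (rank N t' < rank N t)%N /\ (forall k, pos k t' = pos i t' -> pos k t' + t' <= X).
Proof.
move=> IN /andP[t'0 t't] iX Ii Ij ij e.
have t0 : 0 < t by lra.
have iX' : pos i t' + t' <= X.
  by move: iX; rewrite /position; case: (good_vel G i) => ->; lra.
split; last by move=> k ->.
apply: (@rank_lt N i j) => //; apply: IN => //.
  by have := pos_ge i (ltW t0); lra.
by have := pos_ge j (ltW t'0); lra.
Qed.

(** [Z] is a zone, closed towards the past, where the evolutions should coincide. The last
    hypothesis is local: agreement of the particles of the zone at a collision point must imply the
    same fate, even if particles outside the zone take part. *)
Lemma evolves_compare I I' al al' (Z : nat -> R -> Prop) :
  locfin I -> locfin I' -> ev I al -> ev I' al' ->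
  (forall i t, Z i t -> (I i <-> I' i)) ->
  (forall i t t', Z i t -> t' < t -> Z i t') ->
  (forall i t t', Z i t -> 0 < t' < t -> al i t' -> al' i t' ->
     (forall j, Z j t' -> pos j t' = pos i t' -> (al j t' <-> al' j t')) ->
     (dies al t' i <-> dies al' t' i)) ->
  forall i t, Z i t -> (al i t <-> al' i t).
Proof.
move=> fI fI' E E' ZI Zd H i t; have [X hX] : exists X, pos i t + t <= X by exists (pos i t + t).
have [N1 hN1] := fI X; have [N2 hN2] := fI' X.
pose N := maxn N1 N2; pose J k := I k || I' k.
have JN k : J k -> x k <= X -> (k < N)%N.
  by rewrite leq_max => /orP[/hN1 h /h ->//|/hN2 h /h ->]; rewrite orbT.
have [n] : exists n, (rank N t < n)%N by exists (rank N t).+1.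
elim: n i t hX => // n IH i t hX hn Zi.
have step t' j : 0 < t' < t -> J i -> J j -> i != j -> pos i t' = pos j t' ->
    al i t' -> al' i t' -> (dies al t' i <-> dies al' t' i).
  move=> ht Ji Jj ij e ai ai'; apply: (H i t) => // k Zk ek.
  have [lt /(_ k ek) kX] := cone_coll JN ht hX Ji Jj ij e.
  by apply: IH => //; exact: leq_trans lt _.
have agree t' j : 0 < t' < t -> J i -> J j -> i != j -> pos i t' = pos j t' ->
    (al i t' <-> al' i t').
  move=> ht Ji Jj ij e.
  have [lt /(_ i erefl) kX] := cone_coll JN ht hX Ji Jj ij e.
  apply: IH => //; first exact: leq_trans lt _.
  by apply: Zd Zi _; case/andP: ht.
split=> [/E|/E'] [Ii h]; [apply/E'|apply/E]; split; try by apply/(ZI i t).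
- move=> t' ht d; have Ji : J i by rewrite /J Ii.
  case: (d) => -[j [ij ai' aj e]] _; have Jj : J j by rewrite /J (ev_sub E' aj) orbT.
  apply: (h t' ht); apply/(step t' j) => //.
  exact/(agree t' j).
- move=> t' ht d; have Ji : J i by rewrite /J Ii orbT.
  case: (d) => -[j [ij ai aj e]] _; have Jj : J j by rewrite /J (ev_sub E aj).
  apply: (h t' ht); apply/(step t' j) => //.
  exact/(agree t' j).
Qed.

Lemma ev_unique I al al' : locfin I -> ev I al -> ev I al' ->
  forall i t, al i t <-> al' i t.
Proof.
move=> fI E E' i t; apply: (evolves_compare (Z := fun _ _ => True) fI fI E E') => // {}i {}t t' _ _ _ _ h.
by apply: dies_congr => j k _ ej _ _ _; exact: h.
Qed.

(** Iterates the evolution equation from the state where nobody ever dies. The iterates are not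
    monotone, since removing a particle may save another one, so [alive] takes their eventual value;
    at [(i, t)] they are constant beyond level [rank N t]. *)
Fixpoint approx I n : nat -> R -> Prop := fun i t =>
  if n is m.+1 then I i /\ forall t', 0 < t' < t -> ~ dies (approx I m) t' i
  else I i.

Definition alive I : nat -> R -> Prop := fun i t =>
  exists n, forall m, (n <= m)%N -> approx I m i t.

Lemma approx_sub I n i t : approx I n i t -> I i.
Proof. by case: n => //= n []. Qed.

Lemma alive_ev I : locfin I -> ev I (alive I).
Proof.
move=> fI.
have stable X N n m i t : (forall k, I k -> x k <= X -> (k < N)%N) ->
    pos i t + t <= X -> (rank N t < n)%N -> (rank N t < m)%N ->
    (approx I n i t <-> approx I m i t).
  move=> IN; elim: n m i t => // n IH [//|m] i t hX hn hm /=.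
  suff h t' : I i -> 0 < t' < t ->
      (dies (approx I n) t' i <-> dies (approx I m) t' i).
    by split=> -[Ii d]; split=> // t' ht dt; apply: (d t' ht); apply/h.
  move=> Ii ht.
  apply: dies_congr => j k jk ej ek ak _.
  have [Ij|nIj] := boolP (I j); last first.
    by split=> /approx_sub; rewrite (negbTE nIj).
  have Ik : I k by case: ak => /approx_sub.
  have [l Il [il el]] : exists2 l, I l & i != l /\ pos i t' = pos l t'.
    have [ij|ij] := eqVneq i j; last by exists j.
    by exists k; rewrite // ij ek.
  have [lt /(_ j ej) jX] := cone_coll IN ht hX Ii Il il el.
  by apply: IH => //; exact: leq_trans lt _.
have aliveE X N n i t : (forall k, I k -> x k <= X -> (k < N)%N) ->
    pos i t + t <= X -> (rank N t < n)%N -> (alive I i t <-> approx I n i t).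
  move=> IN hX hn; split=> [[m hm]|a].
    have := hm (maxn m n) (leq_maxl _ _).
    by apply: (proj1 (stable _ _ _ _ _ _ IN hX _ hn)); rewrite leq_max hn orbT.
  exists n => m nm; apply: (proj1 (stable _ _ _ _ _ _ IN hX hn _)) a.
  exact: leq_trans nm.
move=> i t; pose X := pos i t + t; have [N IN] := fI X.
have hX : pos i t + t <= X by [].
(* One level more than stability requires: unfolded once, it leaves level [(rank N t).+1], already
   stable at the earlier collisions of [i]. *)
have -> := aliveE _ _ (rank N t).+2 _ _ IN hX (leqnSn _).
suff h t' : I i -> 0 < t' < t ->
    (dies (approx I (rank N t).+1) t' i <-> dies (alive I) t' i).
  by split=> -[Ii d]; split=> // t' ht dt; apply: (d t' ht); apply/h.
move=> Ii ht.
apply: dies_congr => j k jk ej ek ak _.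
have sub l u : alive I l u -> I l by move=> [n /(_ n (leqnn _))/approx_sub].
have [Ij|nIj] := boolP (I j); last first.
  by split=> [/approx_sub|/sub]; rewrite (negbTE nIj).
have Ik : I k by case: ak => [/approx_sub|/sub].
have [l Il [il el]] : exists2 l, I l & i != l /\ pos i t' = pos l t'.
  have [ij|ij] := eqVneq i j; last by exists j.
  by exists k; rewrite // ij ek.
have [lt /(_ j ej) jX] := cone_coll IN ht hX Ii Il il el.
by symmetry; apply: (aliveE X N) => //; exact: leq_trans lt _.
Qed.

End Fixed.
End Evolution.

(** * Comparing, cutting and gluing evolutions *)

Section Blocks.
Context {R : realType} (x v s : nat -> R) (G : good x v s).
Implicit Types (al : nat -> R -> Prop) (I : pred nat).

Local Notation pos := (position x v).
Local Notation coll := (collide x v).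
Local Notation dies := (dying x v s).
Local Notation ev := (evolves x v s).
Local Notation locfin := (locally_finite x).
Local Notation alive := (alive x v s).

Lemma above_escapes I al b i t : ev I al -> (forall i, I i -> (i <= b)%N) ->
  0 <= t -> al i t -> x b < pos i t -> v i = 1 /\ forall u, al i u.
Proof.
move=> E Ib t0 ai lt; have ib := x_le G (Ib _ (ev_sub E ai)).
have vi : v i = 1.
  by apply/eqP; apply: contraTT lt => /(posNR G t0) ?; rewrite -leNgt; lra.
split=> // u; apply: (escape_right G E Ib vi t0 _ ai).
by rewrite -(posR x t vi).
Qed.

Lemma below_escapes I al a i t : ev I al -> (forall i, I i -> (a <= i)%N) ->
  0 <= t -> al i t -> pos i t < x a -> v i = -1 /\ forall u, al i u.
Proof.
move=> E Ia t0 ai lt; have ia := x_le G (Ia _ (ev_sub E ai)).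
have vi : v i = -1.
  by apply/eqP; apply: contraTT lt => /(posNL G t0) ?; rewrite -leNgt; lra.
split=> // u; apply: (escape_left G E Ia vi t0 _ ai).
by rewrite -(posL x t vi).
Qed.

(* As long as [a] is alive, the only collisions in which it took part are triple
   ones that it survived, where the two other particles die without it as well. *)
Lemma alive_ghost I I' a al al' : locfin I -> locfin I' -> ev I al -> ev I' al' ->
  (forall i, I' i = (i != a) && I i) ->
  forall i t, i != a -> al a t -> (al i t <-> al' i t).
Proof.
move=> fI fI' E E' II i t ia aa.
apply: (evolves_compare G (Z := fun i t => i != a /\ al a t) fI fI' E E') => //.
- by move=> k u [ka _]; rewrite II ka.
- by move=> k u u' [ka au] /ltW uu; split=> //; exact: (ev_mono E uu).
move=> {ia aa} {}i {}t t' [ia aa] /andP[t'0 t't] ai ai' agree.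
have aa' : al a t' by exact: (ev_mono E (ltW t't)).
have nd : ~ dies al t' a by move=> /(ev_dies E t'0)/(_ aa); lra.
have [e|ne] := eqVneq (pos a t') (pos i t'); last first.
  apply: dies_congr => j k _ ej _ _ _; apply: agree => //; split=> //.
  by apply: contraNneq ne => <-; rewrite ej.
have agr j : j != a -> pos j t' = pos i t' -> al j t' <-> al' j t'.
  by move=> ja; apply: agree.
have cai : coll al t' a i by split; rewrite // eq_sym.
have [c [j [ac aj cj vc sc]]] :
    exists c j, [/\ coll al t' a c, coll al t' a j, c != j, v c = 0 & s c = v a].
  by apply: contrapT => h; apply: nd; split=> //; exists i.
have [[nac _ ac' ec] [naj _ aj' ej]] := (ac, aj).
have ca' : al' c t' by apply/agr => //; rewrite -?ec // eq_sym.
have ja' : al' j t' by apply/agr => //; rewrite -?ej // eq_sym.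
have [ic|ic] := eqVneq i c.
  subst i; split=> _; last exact: (static_dies G vc (coll_sym ac)).
  have cj' : coll al' t' c j by split; rewrite // -ec.
  exact: (static_dies G vc cj').
have ij : i = j.
  apply/eqP; apply: contraT => ij; exfalso.
  apply: (@no_four _ _ _ _ G a i c j t') => //=.
  by rewrite !inE !negb_or (eq_sym a i) ia nac naj ic ij cj.
subst j.
have cic : coll al t' i c by split; rewrite // -ec.
have cic' : coll al' t' i c by split; rewrite // -ec.
have eqc k : v k = 0 -> pos k t' = pos i t' -> k = c.
  by move=> vk ek; apply: (same_vel G (t := t')); rewrite ?vk ?vc// ek -e ec.
split=> _; (split; first by exists c).
- case=> k [l [[ik _ ak' ek] [il _ al_' el] kl vk sk]].
  have ekc : k = c by apply: eqc.
  subst k; apply: (@no_four _ _ _ _ G a i c l t') => //=; rewrite -?ek -?el ?e //.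
  rewrite !inE !negb_or (eq_sym a i) ia nac ic il kl !andbT /=.
  by apply/eqP => e'; subst l; have := ev_sub E' al_'; rewrite II eqxx.
- case=> k [l [[ik _ ak' ek] [il _ al_ el] kl vk sk]].
  have ekc : k = c by apply: eqc.
  by subst k; apply: (coll_vel G cai); rewrite -sc sk.
Qed.

(** The absence of contact is read in the large evolution here; in [alive_glue] it is read in the
    two separate ones, whose union is shown to solve the evolution equation. *)
Lemma alive_restrict I I' al al' : locfin I -> locfin I' -> ev I al -> ev I' al' ->
  (forall i, I' i -> I i) ->
  (forall i j t, 0 < t -> I' i -> ~~ I' j -> al i t -> al j t ->
     pos i t <> pos j t) ->
  forall i t, I' i -> (al i t <-> al' i t).
Proof.
move=> fI fI' E E' II' nc i t Ii.
apply: (evolves_compare G (Z := fun i t => I' i) fI fI' E E') => //.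
  by move=> {Ii} {}i {}t Ii; split=> //; exact: II'.
move=> {Ii} {}i {}t t' Ii /andP[t'0 _] ai ai' agree.
apply: dies_congr => j k _ ej _ _ _.
have [Ij|Ij] := boolP (I' j); first exact: agree.
split=> [aj|/(ev_sub E')]; last by rewrite (negbTE Ij).
by exfalso; apply: (nc i j t').
Qed.

Lemma alive_glue I I1 I2 al al1 al2 : locfin I -> ev I al -> ev I1 al1 -> ev I2 al2 ->
  (forall i, I i = I1 i || I2 i) -> (forall i, I1 i -> ~~ I2 i) ->
  (forall i j t, 0 < t -> I1 i -> I2 j -> al1 i t -> al2 j t ->
     pos i t <> pos j t) ->
  forall i t, al i t <-> al1 i t \/ al2 i t.
Proof.
move=> fI E E1 E2 II dis nc.
apply: (ev_unique G fI E).
have h J1 J2 a1 a2 : ev J1 a1 -> ev J2 a2 -> (forall i, J1 i -> ~~ J2 i) ->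
   (forall i j t, 0 < t -> J1 i -> J2 j -> a1 i t -> a2 j t -> pos i t <> pos j t) ->
   forall i t, 0 < t -> J1 i -> (dies (fun i t => a1 i t \/ a2 i t) t i <-> dies a1 t i).
  move=> F1 F2 dJ ncJ i t t0 J1i.
  apply: dies_congr => j k _ ej _ _ ai.
  have {}ai : a1 i t by case: ai => // -[//|/(ev_sub F2)]; rewrite (negbTE (dJ _ J1i)).
  split=> [[//|aj]|]; [|by left].
  by exfalso; apply: (ncJ i j t) => //; exact: (ev_sub F2 aj).
have h1 := h _ _ _ _ E1 E2 dis nc.
have h2 : forall i t, 0 < t -> I2 i ->
    (dies (fun i t => al1 i t \/ al2 i t) t i <-> dies al2 t i).
  move=> i t t0 I2i.
  rewrite -(h _ _ _ _ E2 E1 _ _ i t t0 I2i).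
  - by apply: dies_congr => j k _ _ _ _ _; split=> -[]; [right|left|right|left].
  - by move=> j; apply: contraTN => /dis.
  - by move=> j k u u0 J1 J2 A1 A2 e; apply: (nc k j u).
move=> i t; split.
  case=> a; split.
  - by rewrite II (ev_sub E1 a).
  - move=> t' ht /h1; have /andP[-> _] := ht => /(_ isT (ev_sub E1 a)).
    by move/E1: a => [_ ]; apply.
  - by rewrite II (ev_sub E2 a) orbT.
  - move=> t' ht /h2; have /andP[-> _] := ht => /(_ isT (ev_sub E2 a)).
    by move/E2: a => [_ ]; apply.
case; rewrite II => /orP[Ii|Ii] n; [left; apply/E1|right; apply/E2];
  split=> // t' ht; have /andP[t'0 _] := ht.
  by move/(h1 _ _ t'0 Ii); exact: n.
by move/(h2 _ _ t'0 Ii); exact: n.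
Qed.

Definition seg a b : pred nat := fun i => (a <= i <= b)%N.

Lemma locfin_le I b : (forall i, I i -> (i <= b)%N) -> locfin I.
Proof. by move=> h X; exists b.+1 => i /h; rewrite ltnS. Qed.

Lemma locfin_seg a b : locfin (seg a b).
Proof. by apply: (@locfin_le _ b) => i /andP[]. Qed.

Lemma ev_seg a b : ev (seg a b) (alive (seg a b)).
Proof. exact: (alive_ev G (@locfin_seg a b)). Qed.

Section Front.
Context (a j : nat) (I I2 : pred nat).
Hypotheses (fI : locfin I) (fI2 : locfin I2) (II : forall i, I i = seg a j i || I2 i).
Hypotheses (jI2 : forall i, I2 i -> (j < i)%N).

Lemma front_disjoint i : seg a j i -> ~~ I2 i.
Proof. by move=> /andP[_ ij]; apply/negP => /jI2; rewrite ltnNge ij. Qed.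

(** The line [x j - t] moves left at maximal speed: whatever starts to the right of [x j] stays
    strictly to the right of it. The bound is asked of the block alone here, and of the full
    evolution in [front_restrict]. *)
Lemma front_glue :
  (forall i t, 0 < t -> alive (seg a j) i t -> pos i t <= x j - t) ->
  (forall i t, seg a j i -> (alive I i t <-> alive (seg a j) i t)) /\
  (forall i t, I2 i -> (alive I i t <-> alive I2 i t)).
Proof.
move=> h.
have E2 := alive_ev G fI2; have E1 := @ev_seg a j.
have g := @alive_glue I (seg a j) I2 _ _ _ fI (alive_ev G fI) E1 E2 II front_disjoint.
have {}g i t : alive I i t <-> alive (seg a j) i t \/ alive I2 i t.
  apply: g => {}i k {}t t0 Ii Ik ai ak; have := h _ _ t0 ai.
  by have := x_lt G (jI2 Ik); have := pos_ge G k (ltW t0); lra.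
split=> i t Ii; rewrite g; split; try by [left|right].
  by case=> // /(ev_sub E2); rewrite (negbTE (front_disjoint Ii)).
by case=> // /(ev_sub E1) /front_disjoint; rewrite Ii.
Qed.

Lemma front_restrict :
  (forall i t, 0 < t -> seg a j i -> alive I i t -> pos i t <= x j - t) ->
  (forall i t, seg a j i -> (alive I i t <-> alive (seg a j) i t)) /\
  (forall i t, I2 i -> (alive I i t <-> alive I2 i t)).
Proof.
move=> h; have E := alive_ev G fI.
have nc i k t : 0 < t -> seg a j i -> I2 k -> alive I i t -> alive I k t -> pos i t <> pos k t.
  move=> t0 Ii Ik ai ak; have := h _ _ t0 Ii ai.
  by have := x_lt G (jI2 Ik); have := pos_ge G k (ltW t0); lra.
split.
  apply: (alive_restrict fI (@locfin_seg a j) E (@ev_seg a j)).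
    by move=> i Ii; rewrite II Ii.
  move=> i k t t0 Ii Ik ai ak; apply: nc => //.
  by have := ev_sub E ak; rewrite II (negbTE Ik).
apply: (alive_restrict fI fI2 E (alive_ev G fI2)).
  by move=> i Ii; rewrite II Ii orbT.
move=> i k t t0 Ii Ik ai ak /esym; apply: nc => //.
  by have := ev_sub E ak; rewrite II (negbTE Ik) orbF.
Qed.

End Front.

End Blocks.

(** * Arrivals and their decompositions *)

Section Arrivals.
Context {R : realType}.
Implicit Types (x v s : nat -> R).

(* The four block events refer to the evolution of the particles of the block
   alone: [k] is the first to cross [x a] from the right; [a] is the first to
   cross [x b] from the left; [a] annihilates with the static particle [b.+1],
   and [k] is the first to cross [x a] afterwards; [a] and [j] annihilate each
   other in a double collision. *)
Definition arrival x v s a k : Prop :=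
  [/\ (a <= k)%N, v k = -1, forall t, alive x v s (seg a k) k t
    & forall i t, (a <= i < k)%N -> 0 <= t -> alive x v s (seg a k) i t ->
        x a <= position x v i t].

Definition right_exit x v s a b : Prop :=
  [/\ (a <= b)%N, v a = 1, forall t, alive x v s (seg a b) a t
    & forall i t, (a < i <= b)%N -> 0 <= t -> alive x v s (seg a b) i t ->
        position x v i t <= x b].

Definition static_arrival x v s a b k : Prop :=
  [/\ right_exit x v s a b, v b.+1 = 0, arrival x v s b.+2 k
    & x b.+1 - x a < x k - x b.+1 \/
      x b.+1 - x a = x k - x b.+1 /\ s b.+1 = -1].

Definition annihilation x v s a j : Prop :=
  [/\ (a < j)%N, v a = 1, v j = -1,
      forall t, alive x v s (seg a j) a t <-> t <= (x j - x a) / 2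
    & forall t, alive x v s (seg a j) j t <-> t <= (x j - x a) / 2].

Context (x v s : nat -> R) (G : good x v s).

Local Notation pos := (position x v).
Local Notation coll := (collide x v).
Local Notation dies := (dying x v s).
Local Notation alv a k := (alive x v s (seg a k)).
Local Notation L := (arrival x v s).
Local Notation Q := (right_exit x v s).
Local Notation T := (static_arrival x v s).
Local Notation C := (annihilation x v s).

Let E a k := ev_seg G a k.
Let fs a k := @locfin_seg R x a k.

(** A space-time triangle: such a block dies out without crossing [x a] and without meeting the
    particles that follow, so it is transparent for the next arrival. *)
Definition enclosed a j := (a <= j)%N /\ forall i t, 0 <= t -> alv a j i t -> x a <= pos i t <= x j - t.

Lemma seg_split a j k : (a <= j <= k)%N ->
  forall i, seg a k i = seg a j i || seg j.+1 k i.
Proof. by rewrite /seg => h i; lia. Qed.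

Lemma seg_ge j k i : seg j.+1 k i -> (j < i)%N.
Proof. by case/andP. Qed.

Lemma arrival_front a k : L a k -> forall i t, 0 <= t -> alv a k i t -> pos i t <= x k - t.
Proof.
move=> [ak vk lk _] i t t0 ai.
have /andP[_ ik] := ev_sub (E a k) ai.
rewrite -(posL x t vk); move: ik; rewrite leq_eqVlt => /orP[/eqP->//|ik].
exact: (no_crossing G (E a k)).
Qed.

Lemma seg_front_glue a j k : (a <= j <= k)%N ->
  (forall i t, 0 < t -> alv a j i t -> pos i t <= x j - t) ->
  (forall i t, seg a j i -> (alv a k i t <-> alv a j i t)) /\
  (forall i t, seg j.+1 k i -> (alv a k i t <-> alv j.+1 k i t)).
Proof.
move=> h; apply: (front_glue G) => //; [exact: seg_split|exact: seg_ge].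
Qed.

Lemma seg_front_restrict a j k : (a <= j <= k)%N ->
  (forall i t, 0 < t -> seg a j i -> alv a k i t -> pos i t <= x j - t) ->
  (forall i t, seg a j i -> (alv a k i t <-> alv a j i t)) /\
  (forall i t, seg j.+1 k i -> (alv a k i t <-> alv j.+1 k i t)).
Proof.
move=> h; apply: (front_restrict G) => //; [exact: seg_split|exact: seg_ge].
Qed.

Lemma not_forever_left a i : v i = -1 -> ~ (forall t, 0 <= t -> x a <= pos i t).
Proof.
move=> vi h; have := h (`|x i - x a| + 1) ltac:(by apply: addr_ge0).
rewrite (posL _ _ vi); have := ler_norm (x i - x a); lra.
Qed.

(** The particles behind the earlier arrival cannot reach it, so it also crosses [x a] in the longer
    block, against the minimality of the later one. *)
Lemma arrival_unique a j k : L a j -> L a k -> j = k.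
Proof.
have h j' k' : L a j' -> L a k' -> (j' < k')%N -> False.
  move=> Lj Lk jk; have [aj vj lj _] := Lj.
  have ajk : (a <= j' <= k')%N by rewrite aj ltnW.
  have [h _] := seg_front_glue ajk (fun i t t0 => arrival_front Lj (ltW t0)).
  have [_ _ _ low] := Lk.
  apply: (not_forever_left (a := a) vj) => t t0; apply: low => //; first by rewrite aj.
  by apply/h; rewrite ?lj // /seg aj leqnn.
move=> Lj Lk; case: (ltngtP j k) => // jk; exfalso; [exact: (h _ _ Lj Lk)|exact: (h _ _ Lk Lj)].
Qed.

(** A particle found below [x a] is a left-mover that survives forever, so only such particles have
    to be excluded. *)
Lemma arrival_ofE a k : (a <= k)%N -> v k = -1 -> (forall t, alv a k k t) ->
  (forall i, (a <= i < k)%N -> v i = -1 -> ~ (forall t, alv a k i t)) -> L a k.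
Proof.
move=> ak vk lk h; split=> // i t ik t0 ai; rewrite leNgt; apply/negP => lt.
have [vi li] := below_escapes G (E a k) (fun i => fun h => proj1 (andP h)) t0 ai lt.
exact: h ik vi li.
Qed.

Lemma arrival_minus a k : v a = -1 -> L a k <-> k = a.
Proof.
move=> va; have Laa : L a a.
  apply: arrival_ofE => //; last by move=> i h; exfalso; lia.
  move=> t; apply: contrapT => n.
  have [|t' _ [[j [aj _ aj' _]] _]] := ev_dead (E a a) _ n; first by rewrite /seg leqnn.
  by have := ev_sub (E a a) aj'; move/eqP: aj; rewrite /seg; lia.
by split=> [Lk|->//]; exact: arrival_unique Lk Laa.
Qed.

Lemma enclosed_arrival a j k : (j < k)%N -> enclosed a j -> L a k <-> L j.+1 k.
Proof.
move=> jk [aj N].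
have ajk : (a <= j <= k)%N by rewrite aj ltnW.
have [h1 h2] := seg_front_glue ajk (fun i t t0 ai => proj2 (andP (N i t (ltW t0) ai))).
have kk : seg j.+1 k k by rewrite /seg jk leqnn.
split=> -[ak vk lk low].
- apply: arrival_ofE => //; first by move=> t; apply/h2.
  move=> i ik vi li; apply: (not_forever_left (a := a) vi) => t t0.
  apply: low => //; first lia.
  by apply/h2 => //; rewrite /seg; lia.
- split=> //; [lia|by move=> t; apply/h2|].
  move=> i t ik t0 ai; have [ij|ji] := leqP i j.
    have ii : seg a j i by rewrite /seg; lia.
    by have /(N i t t0)/andP[] : alv a j i t by apply/h1.
  have ii : seg j.+1 k i by rewrite /seg; lia.
  have ai' : alv j.+1 k i t by apply/h2.
  have := x_le G (leq_trans aj (leqnSn j)).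
  by have := low i t ltac:(lia) t0 ai'; lra.
Qed.

Lemma ghost_seg a k i t : i != a -> alv a k a t -> (alv a k i t <-> alv a.+1 k i t).
Proof.
by move=> ia aa; apply: (alive_ghost G (fs a k) (fs a.+1 k) (E a k) (E a.+1 k) _ ia aa) => l;
  rewrite /seg ltn_neqAle eq_sym -andbA.
Qed.

Lemma arrival_enclosed0 a j : v a = 0 -> L a.+1 j -> enclosed a j.
Proof.
move=> va Lj; have [aj vj lj low] := Lj.
set t0 := x j - x a; have xaj := x_lt G aj; have xa1 := x_lt G (ltnSn a).
have t00 : 0 < t0 by rewrite /t0; lra.
have ja : j != a by rewrite gtn_eqF.
have aa : alv a j a t0.
  apply: contrapT => n; have [|t /andP[tp tl] [[i ai] _]] := ev_dead (E a j) _ n.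
    by rewrite /seg leqnn ltnW.
  case: ai => nai ai ii; rewrite pos0 // => e.
  have ia : i != a by rewrite eq_sym.
  have {}ii : alv a.+1 j i t by apply/(ghost_seg ia ai).
  have /andP[ai' ij] := ev_sub (E _ _) ii.
  move: ij; rewrite leq_eqVlt => /orP[/eqP ei|ij]; last first.
    by have := low i t; rewrite ai' ij -e => /(_ isT (ltW tp) ii); lra.
  by move: e; rewrite ei posL // /t0 in tl *; lra.
(* At time [t0] the bounds [x a.+1 <= pos] and [pos <= x j - t0 = x a] leave no room: the collision
   of [a] and [j] is double, and nothing of the block remains. *)
have none i : i != a -> (i < j)%N -> ~ alv a j i t0.
  move=> ia ij /(proj1 (ghost_seg ia aa)) ii.
  have /andP[ai' _] := ev_sub (E _ _) ii.
  have := low i t0; rewrite ai' ij => /(_ isT (ltW t00) ii).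
  by have := arrival_front Lj (ltW t00) ii; rewrite /t0; lra.
have cj : coll (alv a j) t0 a j.
  split; rewrite 1?eq_sym //; first by apply/ghost_seg.
  by rewrite pos0 // posL // /t0; lra.
have da := static_dies G va cj.
have dj : dies (alv a j) t0 j.
  split; first by exists a; exact: coll_sym cj.
  case=> c [l [[jc _ ac ec] [jl _ al_ el] cl vc sc]].
  have ca : c = a.
    by apply: (same_vel G (t := t0)); rewrite ?vc ?va // -ec; case: cj.
  subst c; apply: (none l) => //; first by rewrite eq_sym.
  by have /andP[_ ] := ev_sub (E _ _) al_; rewrite leq_eqVlt eq_sym (negbTE jl).
split; first exact: ltnW.
move=> i t tp ii; have /andP[ai ij] := ev_sub (E _ _) ii.
have tt0 : t <= t0.
  have [ia|ia] := eqVneq i a; first by subst i; exact: (ev_dies (E _ _) t00 da).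
  have [ij'|ij'] := eqVneq i j; first by subst i; exact: (ev_dies (E _ _) t00 dj).
  rewrite leNgt; apply/negP => lt; apply: (none i) => //; last exact: (ev_mono (E _ _) (ltW lt)).
  by rewrite ltn_neqAle ij'.
have [ia|ia] := eqVneq i a; first by rewrite ia pos0 // /t0 in tt0 *; lra.
have [ij'|ij'] := eqVneq i j; first by rewrite ij' posL // /t0 in tt0 *; lra.
have aat : alv a j a t := ev_mono (E a j) tt0 aa.
have ii' : alv a.+1 j i t by apply/(ghost_seg ia aat).
have := low i t; rewrite ltn_neqAle eq_sym ia ai ltn_neqAle ij' ij => /(_ isT tp ii').
by have := arrival_front Lj tp ii'; lra.
Qed.

Lemma arrival0_inv a k : v a = 0 -> L a k -> exists2 j, (j < k)%N & L a.+1 j.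
Proof.
move=> va Lk; have [ak vk lk low] := Lk.
have nka : k != a by apply/eqP => e; move: vk; rewrite e va; lra.
have {}ak : (a < k)%N by rewrite ltn_neqAle eq_sym nka.
have xak := x_lt G ak.
have aseg : seg a k a by rewrite /seg leqnn ltnW.
have kdead t : 0 < t -> ~ dies (alv a k) t k.
  by move=> t0 d; have := ev_dies (E _ _) t0 d (lk (t + 1)); lra.
(* If [a] never died, [k] would hit it at time [x k - x a]. *)
have [t0 t0p [[j caj] na]] : exists2 t, 0 < t & dies (alv a k) t a.
  apply: contrapT => n.
  have aa t : alv a k a t.
    by apply: contrapT => h; have [t' /andP[? _] d] := ev_dead (E _ _) aseg h; apply: n; exists t'.
  apply: n; exists (x k - x a); first lra.
  apply: (static_dies G (j := k)) => //; split=> //; first by rewrite eq_sym.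
  by rewrite pos0 // posL //; lra.
have da := static_dies G va caj.
have [naj aa aj ej] := caj.
have /andP[laj ljk] := ev_sub (E _ _) aj.
have ltaj : (a < j)%N by rewrite ltn_neqAle naj.
have xaj := x_lt G ltaj.
have vj : v j = -1.
  move: ej; rewrite pos0 //; case: (good_vel G j) => // vj; first by rewrite pos0 //; lra.
  by rewrite posR //; lra.
rewrite pos0 // posL // in ej.
(* All others start to the right of [a], so only left-movers reach [x a], and never two at once. The
   collision is double; hence [j] dies and differs from [k]. *)
have nbt i : i != a -> i != j -> ~ (alv a k i t0 /\ pos i t0 = x a).
  move=> ia ij [ai ei]; have /andP[lai _] := ev_sub (E _ _) ai.
  have xai : x a < x i by apply: (x_lt G); rewrite ltn_neqAle eq_sym ia.
  move: ei; case: (good_vel G i) => vi; [|by rewrite pos0 //; lra|by rewrite posR //; lra].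
  by move=> ei; move/eqP: ij; apply; apply: (same_vel G (t := t0)); rewrite ?vi ?vj // ei posL // ej.
have jk : j != k.
  apply/eqP => jk; apply: (kdead t0) => //; subst j; split; first by exists a; exact: coll_sym.
  case=> c [l [[kc _ ac ec] [kl _ al_ el] cl vc sc]].
  have ca : c = a.
    by apply: (same_vel G (t := t0)); rewrite ?vc ?va // -ec; case: caj.
  by subst c; apply: (nbt l); rewrite 1?eq_sym //; split=> //; rewrite -el posL //; lra.
have ltjk : (j < k)%N by rewrite ltn_neqAle jk.
exists j => //.
have ja : j != a by rewrite eq_sym.
have gh i : i != a -> (alv a k i t0 <-> alv a.+1 k i t0) by move=> ia; exact: ghost_seg.
have lj : forall t, alv a.+1 k j t.
  have bj : alv a.+1 k j t0 by apply/gh.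
  have xa1 := x_lt G (ltnSn a).
  apply: (escape_left (a := a.+1) G (E _ _) _ vj (ltW t0p) _ bj); first by move=> i /andP[].
  lra.
have [h1 _] : (forall i t, seg a.+1 j i -> (alv a.+1 k i t <-> alv a.+1 j i t)) /\
  (forall i t, seg j.+1 k i -> (alv a.+1 k i t <-> alv j.+1 k i t)).
  apply: seg_front_restrict; first by rewrite ltaj ltnW.
  move=> i t tp /andP[_]; rewrite leq_eqVlt => /orP[/eqP->|ij ai]; first by rewrite posL.
  rewrite -(posL x t vj); apply: (no_crossing G (E a.+1 k)) => //; exact: ltW.
apply: arrival_ofE => //; first by move=> t; apply/h1; rewrite // /seg ltaj leqnn.
(* A left-mover surviving ahead of [j] would have hit [a] before time [t0]. *)
move=> i /andP[ai ij] vi li.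
have isg : seg a.+1 j i by rewrite /seg ai ltnW.
have ia : i != a by rewrite gtn_eqF.
have ii t : alv a.+1 k i t by apply/h1.
have := x_lt G ij; have := x_lt G ai => xai xij.
have ci : coll (alv a k) (x i - x a) a i.
  have aa' : alv a k a (x i - x a) by apply: (ev_mono (E _ _) _ aa); lra.
  by split; rewrite 1?eq_sym //; [apply/ghost_seg|rewrite pos0 // posL //; lra].
have := ev_dies (E _ _) _ (static_dies G va ci) aa.
by move=> h; have := h ltac:(lra); lra.
Qed.

Lemma arrival0 a k : v a = 0 ->
  L a k <-> exists j, [/\ (j < k)%N, L a.+1 j & L j.+1 k].
Proof.
move=> va; split=> [Lk|[j [jk Lj Lk]]].
  have [j jk Lj] := arrival0_inv va Lk; exists j; split=> //.
  exact/(enclosed_arrival jk (arrival_enclosed0 va Lj)).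
exact/(enclosed_arrival jk (arrival_enclosed0 va Lj)).
Qed.

End Arrivals.

(** * Blocks whose first particle moves to the right *)

Section RightMoverFirst.
Context {R : realType} (x v s : nat -> R) (G : good x v s).

Local Notation pos := (position x v).
Local Notation coll := (collide x v).
Local Notation dies := (dying x v s).
Local Notation alv a k := (alive x v s (seg a k)).
Local Notation L := (arrival x v s).
Local Notation Q := (right_exit x v s).
Local Notation T := (static_arrival x v s).
Local Notation C := (annihilation x v s).
Local Notation encl := (enclosed x v s).

Let E a k := ev_seg G a k.
Let fs a k := @locfin_seg R x a k.

Lemma seg_bounds a k i t : alv a k i t -> (a <= i <= k)%N.
Proof. by move/(ev_sub (E a k)). Qed.

Lemma seg_le a k t' t i : t' <= t -> alv a k i t -> alv a k i t'.
Proof. exact: (ev_mono (E a k)). Qed.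

Lemma seg_noX a k i j t : (i < j)%N -> 0 <= t -> alv a k i t -> alv a k j t ->
  pos i t <= pos j t.
Proof. exact: (no_crossing G (E a k)). Qed.

(** Squeezed between [a] and [j], a third particle would be at the collision point and static, and
    its spin would save [a] or [j]. *)
Lemma annihilation_between a j i : C a j -> (a < i < j)%N ->
  ~ alv a j i ((x j - x a) / 2).
Proof.
move=> [aj va vj da dj] /andP[ai ij]; set h := (x j - x a) / 2 => ii.
have xaj := x_lt G aj; have h0 : 0 < h by rewrite /h; lra.
have aa : alv a j a h by apply/da.
have jj : alv a j j h by apply/dj.
have Da : dies (alv a j) h a by apply/(diesP (E a j)).
have Dj : dies (alv a j) h j by apply/(diesP (E a j)).
have p1 := seg_noX ai (ltW h0) aa ii; have p2 := seg_noX ij (ltW h0) ii jj.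
have ea := posR x h va; have ej := posL x h vj.
have ei : pos i h = pos a h by rewrite ea ej /h in p1 p2 *; lra.
have cai : coll (alv a j) h a i by split=> //; rewrite ltn_eqF.
have caj : coll (alv a j) h a j by split=> //; rewrite ?ltn_eqF // ea ej /h; lra.
have cji : coll (alv a j) h j i.
  by apply: coll_trans caj cai => //; rewrite gtn_eqF.
have vi : v i = 0.
  case: (good_vel G i) => // vi; first by have := coll_vel G cji; rewrite vi vj.
  by have := coll_vel G cai; rewrite vi va.
case: (good_spin G i) => si.
  case: Dj => _; apply; exists i, a; split=> //; [exact: coll_sym|by rewrite gtn_eqF|by rewrite vj].
by case: Da => _; apply; exists i, j; split=> //; [rewrite ltn_eqF|rewrite va].
Qed.

Lemma annihilation_enclosed a j : C a j -> encl a j.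
Proof.
move=> Cj; have [aj va vj da dj] := Cj; split; first exact: ltnW.
move=> i t t0 ii; have /andP[ai ij] := seg_bounds ii.
have th : t <= (x j - x a) / 2.
  have [e|ia] := eqVneq i a; first by subst i; apply/da.
  have [e|nij] := eqVneq i j; first by subst i; apply/dj.
  rewrite leNgt; apply/negP => lt.
  apply: (annihilation_between Cj (i := i)); last exact: (seg_le (ltW lt)).
  by rewrite !ltn_neqAle eq_sym ia nij ai ij.
have aa : alv a j a t by apply/da.
have jj : alv a j j t by apply/dj.
have pa : x a <= pos i t.
  move: ai; rewrite leq_eqVlt => /orP[/eqP <-|ai]; first by rewrite posR //; lra.
  by have := seg_noX ai t0 aa ii; rewrite posR //; lra.
have pj : pos i t <= x j - t.
  move: ij; rewrite leq_eqVlt => /orP[/eqP ->|ij]; first by rewrite posL //; lra.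
  by have := seg_noX ij t0 ii jj; rewrite (posL x t vj); lra.
by rewrite pa pj.
Qed.

(* Until its collision, the first particle leaves the others unaffected. *)
Lemma annihilation_arrival a k : C a k -> L a.+1 k.
Proof.
move=> Ck; have [ak va vk da dk] := Ck.
set h := (x k - x a) / 2 in da dk.
have xak := x_lt G ak; have h0 : 0 < h by rewrite /h; lra.
have ka : k != a by rewrite gtn_eqF.
have gh i t : i != a -> t <= h -> (alv a k i t <-> alv a.+1 k i t).
  by move=> ia th; apply: (ghost_seg G ia); apply/da.
have none i : (a < i < k)%N -> ~ alv a.+1 k i h.
  move=> ik /gh; rewrite gtn_eqF; last by case/andP: ik.
  by move=> /(_ isT (lexx _)); exact: (annihilation_between Ck).
have lk t : alv a.+1 k k t.
  apply: contrapT => n; have [|t' /andP[t'0 _] d] := ev_dead (E a.+1 k) _ n.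
    by rewrite /seg ak leqnn.
  have kh : alv a.+1 k k h by apply/gh; rewrite //; apply/dk.
  have le := ev_dies (E _ _) t'0 d kh.
  case: d => -[j [kj _ aj _]] _; have /andP[aj' jk] := seg_bounds aj.
  apply: (none j); last exact: (seg_le le).
  by rewrite aj' ltn_neqAle eq_sym kj.
apply: arrival_ofE => //.
move=> i /andP[ai ik] vi li; apply: (none i) => //.
by rewrite ai.
Qed.

(** Transfers a collision seen in a larger block to the block [[a, j]]: without a static particle
    the collision is double, and afterwards nothing of [[a, j]] is left to meet the rest. *)
Lemma annihilation_intro a k j t : (a <= j <= k)%N -> 0 < t -> v a = 1 -> v j = -1 ->
  dies (alv a k) t a -> coll (alv a k) t a j ->
  (forall c, v c = 0 -> ~ coll (alv a k) t a c) -> C a j.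
Proof.
move=> ajk t0 va vj da caj nc; have /andP[laj ljk] := ajk.
have [naj aa jj ej] := caj.
have aj : (a < j)%N by rewrite ltn_neqAle naj.
have xaj := x_lt G aj.
have dj : dies (alv a k) t j.
  split; first by exists a; exact: coll_sym.
  case=> c [_ [cj _ _ vc _]]; apply: (nc c) => //.
  apply: (coll_trans _ (coll_sym caj) cj).
  by apply/eqP => e; move: vc; rewrite -e va; lra.
have et : t = (x j - x a) / 2 by move: ej; rewrite posR // posL //; lra.
have da' := proj1 (diesP (E a k) a t0) da.
have dj' := proj1 (diesP (E a k) j t0) dj.
have [h1 _] : (forall i u, seg a j i -> (alv a k i u <-> alv a j i u)) /\
  (forall i u, seg j.+1 k i -> (alv a k i u <-> alv j.+1 k i u)).
  apply: (seg_front_restrict G) => // i u u0 /andP[ai]; rewrite leq_eqVlt => /orP[/eqP->|ij] ii.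
    by rewrite posL.
  have ut : u <= t.
    have [e|ia] := eqVneq i a; first by subst i; apply/da'.
    rewrite leNgt; apply/negP => lt; have {}ii := seg_le (ltW lt) ii.
    have {}ai : (a < i)%N by rewrite ltn_neqAle eq_sym ia.
    have p1 := seg_noX ai (ltW t0) aa ii; have p2 := seg_noX ij (ltW t0) ii jj.
    have cai : coll (alv a k) t a i.
      by split=> //; [rewrite eq_sym|apply/eqP; rewrite eq_le p1 ej p2].
    apply: (nc i) => //.
    have cji : coll (alv a k) t j i by apply: (coll_trans _ caj cai); rewrite gtn_eqF.
    case: (good_vel G i) => // vi; first by have := coll_vel G cji; rewrite vi vj.
    by have := coll_vel G cai; rewrite vi va.
  by rewrite -(posL x u vj); apply: (seg_noX ij (ltW u0) ii); apply/dj'.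
split=> // u; rewrite -et.
- by rewrite -h1 ?da' // /seg leqnn.
- by rewrite -h1 ?dj' // /seg leqnn andbT.
Qed.

(** * A right-moving particle annihilated with a static target *)

Section StaticTarget.
Context (a b k : nat) (t1 : R).
Local Notation c := b.+1.
Hypotheses (abk : (a <= b)%N) (t10 : 0 < t1) (va : v a = 1) (vc : v c = 0).
Hypotheses (da : dies (alv a k) t1 a) (cac : coll (alv a k) t1 a c).

Let ck : (c <= k)%N.
Proof. by case: cac => _ _ /seg_bounds/andP[]. Qed.

Lemma target_time : t1 = x c - x a.
Proof. by case: cac => _ _ _; rewrite posR // pos0 //; lra. Qed.

Lemma target_dies : dies (alv a k) t1 c.
Proof. exact: (static_dies G vc (coll_sym cac)). Qed.

Let cc t : t <= t1 -> alv a k c t.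
Proof. by move=> h; case: cac => _ _ + _; exact: (seg_le h). Qed.

Let aa t : t <= t1 -> alv a k a t.
Proof. by move=> h; case: cac => _ + _ _; exact: (seg_le h). Qed.

Let off_target i t : i != c -> 0 < t < t1 -> alv a k i t -> pos i t <> x c.
Proof.
move=> ic /andP[t0 lt] ii e.
have cci : coll (alv a k) t c i.
  by split=> //; [rewrite eq_sym|exact/cc/ltW|rewrite pos0].
by have := ev_dies (E a k) t0 (static_dies G vc cci) (cc (lexx _)); lra.
Qed.

Let left_side i t : (i < c)%N -> 0 <= t <= t1 -> alv a k i t -> pos i t <= x c.
Proof.
by move=> ic /andP[t0 tt1] ii; have := seg_noX ic t0 ii (cc tt1); rewrite (pos0 x t vc).
Qed.

Let right_side i t : (c < i)%N -> 0 <= t <= t1 -> alv a k i t -> x c <= pos i t.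
Proof.
by move=> ic /andP[t0 tt1] ii; have := seg_noX ic t0 (cc tt1) ii; rewrite (pos0 x t vc).
Qed.

Let no_between i : (a < i < c)%N -> ~ alv a k i t1.
Proof.
move=> /andP[ai ic] ii.
have p1 := seg_noX ai (ltW t10) (aa (lexx _)) ii.
have p2 : pos i t1 <= x c by apply: left_side => //; rewrite lexx ltW.
have ea := posR x t1 va; have et := target_time.
have ei : pos i t1 = pos a t1 by lra.
have xi := x_lt G ic; have xa := x_lt G ai.
case: (good_vel G i) => vi; move: ei.
- by rewrite posL // ea; lra.
- by rewrite pos0 // ea; lra.
- by rewrite posR // ea; lra.
Qed.

Let gone i t : (a <= i <= c)%N -> alv a k i t -> t <= t1.
Proof.
move=> /andP[ai ic] ii.
have [e|ia] := eqVneq i a; first by subst i; exact: (ev_dies (E _ _) t10 da).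
have [e|nic] := eqVneq i c; first by subst i; exact: (ev_dies (E _ _) t10 target_dies).
rewrite leNgt; apply/negP => lt; apply: (no_between (i := i)); last exact: (seg_le (ltW lt)).
by rewrite !ltn_neqAle (eq_sym a) ia nic ai ic.
Qed.

(** Until [t1] the target is a wall, since any contact would destroy it before [a] comes. The left
    block thus evolves on its own up to [t1], when [a] is past [x b] and escapes. *)
Lemma target_right_exit : Q a b.
Proof.
have fb i t : seg a b i /\ t <= t1 -> (alv a k i t <-> alv a b i t).
  apply: (evolves_compare G (Z := fun i t => seg a b i /\ t <= t1) (fs a k) (fs a b) (E a k) (E a b)).
  - move=> {}i {}t [/andP[ai ib] _]; split=> // _; rewrite /seg; lia.
  - by move=> {}i {}t t' [? ?] lt; split=> //; lra.
  - move=> {}i {}t t' [/andP[ai ib] tt1] /andP[t'0 t't] ii _ agree.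
    apply: dies_congr => j l _ ej _ _ _.
    have t't1 : t' < t1 by lra.
    have p : pos i t' < x c.
      rewrite lt_neqAle; apply/andP; split; last first.
        by apply: left_side => //; rewrite !ltW.
      by apply/eqP; apply: off_target => //; rewrite ?t'0 // ltn_eqF.
    have [jb|bj] := leqP j b; last first.
      split=> [jj|/seg_bounds/andP[_]]; last by rewrite leqNgt bj.
      exfalso; move: bj; rewrite leq_eqVlt => /orP[/eqP e|bj].
        by move: ej; rewrite -e pos0 //; lra.
      have t'1 : 0 <= t' <= t1 by rewrite !ltW.
      by have := right_side bj t'1 jj; rewrite ej; lra.
    have [aj|ja] := leqP a j; last first.
      by split=> /seg_bounds/andP[]; rewrite leqNgt ja.
    by apply: agree => //; split; rewrite ?/seg ?aj ?jb // ltW.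
have et := target_time.
have sa : seg a b a by rewrite /seg leqnn.
have a1 : alv a b a t1 := proj1 (fb a t1 (conj sa (lexx _))) (aa (lexx _)).
have la : forall t, alv a b a t.
  apply: (escape_right (b := b) G (E _ _) _ va (ltW t10) _ a1); first by move=> i /andP[].
  by have := x_lt G (ltnSn b); lra.
split=> // i t /andP[ai ib] t0 ii; rewrite leNgt; apply/negP => lt.
have [vi li] := above_escapes G (E a b) (fun i h => proj2 (andP h)) t0 ii lt.
apply: (no_between (i := i)); first by rewrite ai ltnS.
have si : seg a b i /\ t1 <= t1 by rewrite /seg ib ltnW.
exact: (proj2 (fb i t1 si)).
Qed.

(** Before [t1] the target is a wall, and after [t1] nothing remains to its left. At [t1] itself a
    left-mover may reach the target together with [a]; since [a] dies, the spin is -1 and the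
    left-mover survives, as it does in the right block alone. *)
Lemma target_rest i t : seg b.+2 k i -> (alv a k i t <-> alv b.+2 k i t).
Proof.
move=> si; apply: (evolves_compare G (Z := fun i t => seg b.+2 k i) (fs a k) (fs b.+2 k) (E a k) (E b.+2 k)) => //.
  move=> {t si} i t si; split=> // _; move: si; rewrite /seg; lia.
move=> {t si} i t t' /andP[ci ik] /andP[t'0 t't] ii _ agree.
have [[et' ei]|ne] := pselect (t' = t1 /\ pos i t' = x c); last first.
  apply: dies_congr => j l _ ej _ _ _.
  have [cj|jc] := ltnP c j; last first.
    split=> [jj|/seg_bounds/andP[]]; last by rewrite ltnNge jc.
    exfalso; have t't1 : t' <= t1.
      by apply: (gone _ jj); rewrite jc andbT; case/andP: (seg_bounds jj).
    have p1 : x c <= pos i t' by apply: right_side => //; rewrite ltW.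
    have p2 : pos j t' <= x c.
      move: jc; rewrite leq_eqVlt => /orP[/eqP->|jc]; first by rewrite pos0.
      by apply: left_side => //; rewrite ltW.
    have ei : pos i t' = x c by lra.
    move: t't1; rewrite le_eqVlt => /orP[/eqP e|lt]; first by apply: ne.
    by apply: (@off_target i t') => //; rewrite ?t'0 // gtn_eqF.
  have [jk|kj] := leqP j k; last first.
    by split=> /seg_bounds/andP[_]; rewrite leqNgt kj.
  by apply: agree => //; rewrite /seg cj jk.
subst t'.
have ec : pos c t1 = x c by rewrite pos0.
have ea : pos a t1 = x c by rewrite posR // target_time; lra.
have ia : i != a by rewrite gtn_eqF //; lia.
have ic : i != c by rewrite gtn_eqF.
have cia : coll (alv a k) t1 i a by split; rewrite ?ei ?ea //; exact: aa.
have cic : coll (alv a k) t1 i c by split; rewrite ?ei ?ec //; exact: cc.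
have vi : v i = -1.
  case: (good_vel G i) => // vi; first by have := coll_vel G cic; rewrite vi vc.
  by have := coll_vel G cia; rewrite vi va.
have sc : s c = -1.
  case: (good_spin G c) => // sc; case: da => _ []; exists c, i.
  by split=> //; rewrite ?va //; [exact: coll_sym|rewrite eq_sym].
split.
  by case=> _ []; exists c, a; split=> //; rewrite ?vi // gtn_eqF.
case=> -[j [ij _ jj ej]] _; exfalso.
have /andP[cj jk] := seg_bounds jj.
apply: (@no_four _ _ _ _ G i a c j t1) => //; rewrite ?ei ?ea ?ec -?ej ?ei //=.
rewrite !inE !negb_or ia ic ij /=; lia.
Qed.

(** Arriving before [t1], the particle [j] would destroy the target too early; arriving exactly at
    [t1], a spin +1 would have saved [a]. *)
Lemma target_wins j : seg b.+2 k j -> v j = -1 -> (forall t, alv b.+2 k j t) ->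
  x c - x a < x j - x c \/ x c - x a = x j - x c /\ s c = -1.
Proof.
move=> sj vj lj; have et := target_time.
have /andP[cj jk] := sj; have xcj := x_lt G cj.
have jj t : alv a k j t by apply/target_rest.
set t2 := x j - x c; have ej : pos j t2 = x c by rewrite posL // /t2; lra.
have jc : j != c by rewrite gtn_eqF.
have [lt|lt|e] := ltgtP t2 t1; last 2 first.
- by left; rewrite -et.
- right; split; first by rewrite -et e.
  case: (good_spin G c) => // sc; case: da => _ []; exists c, j.
  have cacj : coll (alv a k) t1 a j.
    split=> //; first by rewrite ltn_eqF //; lia.
      exact: aa.
    by rewrite posR // posL // et; move: e; rewrite et /t2; lra.
  by split=> //; rewrite ?va // eq_sym.
by exfalso; apply: (@off_target j t2) => //; rewrite lt /t2; lra.
Qed.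

End StaticTarget.

End RightMoverFirst.

(** * Gluing two blocks around a static target *)

Section StaticArrival.
Context {R : realType} (x v s : nat -> R) (G : good x v s).

Local Notation pos := (position x v).
Local Notation coll := (collide x v).
Local Notation dies := (dying x v s).
Local Notation alv a k := (alive x v s (seg a k)).
Local Notation L := (arrival x v s).
Local Notation Q := (right_exit x v s).
Local Notation T := (static_arrival x v s).
Local Notation C := (annihilation x v s).
Local Notation encl := (enclosed x v s).

Let E a k := ev_seg G a k.
Let fs a k := @locfin_seg R x a k.

Section Gluing.
Context (a b k : nat) (Tk : T a b k).
Local Notation c := b.+1.
Local Notation t1 := (x c - x a).

Let hQ : Q a b. Proof. by case: Tk. Qed.
Let vc : v c = 0. Proof. by case: Tk. Qed.
Let hL : L b.+2 k. Proof. by case: Tk. Qed.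
Let ab : (a <= b)%N. Proof. by case: hQ. Qed.
Let va : v a = 1. Proof. by case: hQ. Qed.
Let la t : alv a b a t. Proof. by case: hQ. Qed.
Let ck : (b.+2 <= k)%N. Proof. by case: hL. Qed.
Let vk : v k = -1. Proof. by case: hL. Qed.
Let lk t : alv b.+2 k k t. Proof. by case: hL. Qed.
Let t10 : 0 < t1. Proof. by have := x_lt G (_ : (a < c)%N); rewrite ltnS ab => /(_ isT); lra. Qed.
Let win : t1 <= x k - x c.
Proof. by case: Tk => _ _ _ []; lra. Qed.
Let xbc : x b < x c. Proof. exact: (x_lt G). Qed.
Let xcd : x c < x b.+2. Proof. exact: (x_lt G). Qed.

Let left_pos i t : (a < i)%N -> 0 <= t -> alv a b i t -> pos i t <= x b /\ t < t1.
Proof.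
move=> ai t0 ii; have /andP[_ ib] := seg_bounds G ii.
have p : pos i t <= x b by case: hQ => _ _ _; apply => //; rewrite ai.
have := seg_noX G ai t0 (la t) ii; rewrite (posR x t va) => h.
by have := xbc; split=> //; lra.
Qed.

Let right_pos i t : i != k -> 0 <= t -> alv b.+2 k i t -> x c < pos i t.
Proof.
move=> ik t0 ii; have /andP[ci ki] := seg_bounds G ii.
case: hL => _ _ _ /(_ i t); rewrite ci ltn_neqAle ik ki => /(_ isT t0 ii); have := xcd; lra.
Qed.

(* The evolution on [a, k]: the two blocks on the sides of the target [b.+1] do
   not interact before [a] reaches it, and nothing is left of the first one
   afterwards. *)
Definition glued i t :=
  [\/ [/\ (i < c)%N, alv a b i t & t <= t1], i = c /\ t <= t1 | alv b.+2 k i t].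

Let gl_right i t : (c < i)%N -> (glued i t <-> alv b.+2 k i t).
Proof.
move=> ci; split=> [|]; last by move=> ?; apply: Or33.
by case=> [[ic _ _]|[e _]|//]; exfalso; lia.
Qed.

Let gl_c t : glued c t <-> t <= t1.
Proof.
split=> [|h]; last by apply: Or32.
by case=> [[]|[]|/(seg_bounds G)/andP[]]; rewrite ?ltnn.
Qed.

Let gl_left i t : (i < c)%N -> (glued i t <-> alv a b i t /\ t <= t1).
Proof.
move=> ic; split=> [|[? ?]]; last by apply: Or31.
by case=> [[]//|[e _]|/(seg_bounds G)/andP[ci _]]; exfalso; lia.
Qed.

Let gl_a t : glued a t <-> t <= t1.
Proof. by rewrite gl_left ?ltnS //; split=> [[]|]. Qed.

Let glued_dies_left i t : (a <= i <= b)%N -> 0 < t -> (i = a -> t < t1) ->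
  (dies glued t i <-> dies (alv a b) t i).
Proof.
move=> /andP[ai ib] t0 ne.
apply: dies_congr => j l _ ej _ _ ii.
have {}ii : alv a b i t.
  by case: ii => // /gl_left; rewrite ltnS => /(_ ib)[].
have [p tt1] : pos i t < x c /\ t < t1.
  move: ai; rewrite leq_eqVlt => /orP[/eqP e|ai].
    by have := ne (esym e); rewrite -e posR //; split=> //; lra.
  by have := left_pos ai (ltW t0) ii; have := xbc; lra.
have [jc|cj|e] := ltngtP j c.
- by rewrite gl_left //; split=> [[]//|jj]; split=> //; exact: ltW.
- rewrite gl_right //; split=> [jj|/(seg_bounds G)/andP[_]]; last by rewrite leqNgt ltnW.
  exfalso; have [jk|jk] := eqVneq j k.
    by subst j; move: ej; rewrite (posL x t vk); have := win; lra.
  by have := right_pos jk (ltW t0) jj; lra.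
- by subst j; move: ej; rewrite pos0 //; lra.
Qed.

Let glued_dies_right i t : (c < i)%N -> 0 < t ->
  (dies glued t i <-> dies (alv b.+2 k) t i).
Proof.
move=> ci t0.
(* Only [k] can touch the target from the right while it stands, and only in a tie at [t1]. The spin
   is then -1, so [k] survives the triple collision. *)
have tie : (i = k /\ t = t1 /\ t1 = x k - x c) \/
    (alv b.+2 k i t -> t <= t1 -> x c < pos i t).
  have [ik|ik] := eqVneq i k; last first.
    by right=> ii _; exact: right_pos (ltW t0) ii.
  have [e|ne] := pselect (t = t1 /\ t1 = x k - x c); first by left.
  right=> _; rewrite le_eqVlt => /orP[/eqP e|lt]; rewrite ik posL //; have := win.
    rewrite le_eqVlt => /orP[/eqP e'|]; last lra.
    by case: ne.
  lra.
case: tie => [[-> [-> tie]]|far].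
  split=> [[_ []]|]; last by move=> /(ev_dies (E _ _) t10)/(_ (lk (t1 + 1))); lra.
  have kk : glued k t1 by apply/gl_right.
  have ekc : pos k t1 = x c by rewrite posL // tie; lra.
  exists c, a; split.
  - split=> //; [by rewrite gtn_eqF|exact/gl_c|by rewrite (pos0 x t1 vc)].
  - split=> //; [by rewrite gtn_eqF //; move: ck ab; lia|exact/gl_a|].
    by rewrite ekc posR //; lra.
  - by rewrite gtn_eqF // ltnS.
  - by [].
  by rewrite vk; case: Tk => _ _ _ [|[]//]; lra.
apply: dies_congr => j l _ ej _ _ ii.
have {}ii : alv b.+2 k i t by case: ii => // /gl_right; apply.
have [jc|cj|e] := ltngtP j c.
- rewrite gl_left //; split=> [[jj tt1]|/(seg_bounds G)/andP[]]; last by rewrite leqNgt ltnW.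
  exfalso; have := far ii tt1; rewrite -ej.
  have /andP[] := seg_bounds G jj; rewrite leq_eqVlt => /orP[/eqP <-|aj] _.
    by rewrite posR //; lra.
  by have := left_pos aj (ltW t0) jj; have := xbc; lra.
- exact: gl_right.
- subst j; rewrite gl_c; split=> [tt1|/(seg_bounds G)/andP[]]; last by rewrite ltnn.
  by exfalso; have := far ii tt1; rewrite -ej pos0 // ltxx.
Qed.

Let glued_coll : coll glued t1 a c.
Proof.
split; [by rewrite ltn_eqF // ltnS|exact/gl_a|exact/gl_c|].
by rewrite posR // pos0 //; lra.
Qed.

Let glued_dies_a t : 0 < t -> (dies glued t a <-> t = t1).
Proof.
move=> t0; split=> [d|->].
  have : t <= t1 by case: d => -[j [_ + _ _]] _ => /gl_a.
  rewrite le_eqVlt => /orP[/eqP //|lt].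
  have {}d : dies (alv a b) t a.
    by apply/glued_dies_left => //; rewrite leqnn.
  by have := ev_dies (E _ _) t0 d (la (t + 1)); lra.
split; first by exists c; exact: glued_coll.
case=> c' [j [[ac' _ cc' ec'] [aj _ jj ej] cj vc' sc]].
have ea : pos a t1 = x c by rewrite posR //; lra.
have e : c' = c.
  by apply: (same_vel G (t := t1)); rewrite ?vc ?vc' // -ec' ea pos0.
subst c'; rewrite ea in ej; rewrite va in sc.
case: jj => [[jc jj _]|[e _]|jj]; last 2 first.
- by rewrite e eqxx in cj.
- have [jk|jk] := eqVneq j k; last by have := right_pos jk (ltW t10) jj; lra.
  move: ej; rewrite jk posL // => ej.
  by case: Tk => _ _ _ [|[]]; rewrite ?sc; lra.
have {}aj : (a < j)%N.
  by rewrite ltn_neqAle aj; have /andP[] := seg_bounds G jj.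
by have := left_pos aj (ltW t10) jj; have := xbc; lra.
Qed.

Let glued_dies_c t : 0 < t -> (dies glued t c <-> t = t1).
Proof.
move=> t0; split=> [[[j [cj cc jj ej]] _]|->]; last first.
  exact: (static_dies G vc (coll_sym glued_coll)).
move/gl_c: cc => tt1; rewrite pos0 // in ej.
case: jj => [[jc jj _]|[e _]|jj]; last 2 first.
- by rewrite e eqxx in cj.
- have [jk|jk] := eqVneq j k; last by have := right_pos jk (ltW t0) jj; lra.
  by move: ej; rewrite jk posL //; have := win; lra.
have /andP[] := seg_bounds G jj; rewrite leq_eqVlt => /orP[/eqP ja|aj] _.
  by move: ej; rewrite -ja posR //; lra.
by have := left_pos aj (ltW t0) jj; have := xbc; lra.
Qed.

Let glued_ev : evolves x v s (seg a k) glued.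
Proof.
have nv i t : i = a \/ i = c -> (glued i t <-> t <= t1) /\    (forall t, 0 < t -> (dies glued t i <-> t = t1)).
  by case=> ->; split.
have skc i : i = a \/ i = c -> seg a k i.
  by case=> ->; rewrite /seg; move: ab ck; lia.
move=> i t; have [iac|niac] := pselect (i = a \/ i = c).
  have [h1 h2] := nv i t iac; rewrite h1; split=> [tt1|[_ n]].
    split; first exact: skc.
    by move=> t' /andP[t'0 t't] /(h2 _ t'0); lra.
  by rewrite leNgt; apply/negP => lt; apply: (n t1); [rewrite t10|apply/h2].
have nia : i <> a by move=> e; apply: niac; left.
have nic : i <> c by move=> e; apply: niac; right.
have [ic|ci|//] := ltngtP i c; last first.
  rewrite gl_right // E; split=> -[si n]; split.
  - by move: si ab; rewrite /seg; lia.
  - by move=> t' ht; rewrite glued_dies_right //; [exact: n|case/andP: ht].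
  - by move: si; rewrite /seg; lia.
  - by move=> t' ht; rewrite -glued_dies_right //; [exact: n|case/andP: ht].
have dl t' : seg a b i -> 0 < t' -> (dies glued t' i <-> dies (alv a b) t' i).
  by move=> sb t'0; apply: glued_dies_left.
rewrite gl_left //; split=> [[ii tt1]|[si n]].
  have sb := seg_bounds G ii; split; first by move: sb ck; rewrite /seg; lia.
  by move=> t' ht; rewrite dl //; [case/E: ii => _; apply|case/andP: ht].
have sb : seg a b i by move: si; rewrite /seg; lia.
have ii : alv a b i t.
  by apply/E; split=> // t' ht; rewrite -dl //; [exact: n|case/andP: ht].
split=> //; have [t0|t0] := leP 0 t; last by have := t10; lra.
suff [_ /ltW //] : pos i t <= x b /\ t < t1.
by apply: left_pos => //; move: si nia; rewrite /seg; lia.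
Qed.

Let aliveE i t : alv a k i t <-> glued i t.
Proof. exact: (ev_unique G (fs a k) (E a k) glued_ev). Qed.

Lemma static_arrival_arrival : L a k.
Proof.
have ak : (a <= k)%N by move: ab ck; lia.
split=> //; first by move=> t; apply/aliveE/gl_right.
move=> i t /andP[ai ik] t0 /aliveE[[ic ii _]|[-> _]|ii].
- move: ai; rewrite leq_eqVlt => /orP[/eqP <-|ai]; first by rewrite posR //; lra.
  by have := seg_noX G ai t0 (la t) ii; rewrite posR //; lra.
- by rewrite pos0 //; have := t10; lra.
- have := t10; have := right_pos _ t0 ii; rewrite ltn_eqF // => /(_ isT); lra.
Qed.

Lemma static_arrival_dies : dies (alv a k) t1 a.
Proof.
have -> : alv a k = glued by apply/funext => i; apply/funext => t; apply/propext/aliveE.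
exact/glued_dies_a.
Qed.

Lemma static_arrival_coll : coll (alv a k) t1 a c.
Proof. by case: glued_coll => ? ? ? ?; split=> //; apply/aliveE. Qed.

End Gluing.
End StaticArrival.

(** * Decompositions according to the fate of the first particle *)

Section Decomposition.
Context {R : realType} (x v s : nat -> R) (G : good x v s).

Local Notation pos := (position x v).
Local Notation coll := (collide x v).
Local Notation dies := (dying x v s).
Local Notation alv a k := (alive x v s (seg a k)).
Local Notation L := (arrival x v s).
Local Notation Q := (right_exit x v s).
Local Notation T := (static_arrival x v s).
Local Notation C := (annihilation x v s).
Local Notation encl := (enclosed x v s).

Let E a k := ev_seg G a k.
Let fs a k := @locfin_seg R x a k.

(** The cases are sorted by the presence of a static particle: a triple collision in which [a] dies
    counts as an annihilation with the static one, so [C a j] covers double collisions only. *)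
Lemma right_mover_fate a k : (a <= k)%N -> v a = 1 -> ~ (forall t, alv a k a t) ->
  (exists b t1, [/\ (a <= b)%N, 0 < t1, v b.+1 = 0, dies (alv a k) t1 a
                  & coll (alv a k) t1 a b.+1]) \/
  (exists2 j, (j <= k)%N & C a j).
Proof.
move=> ak va /existsNP[t n].
have [|t1 /andP[t10 _] da] := ev_dead (E a k) _ n; first by rewrite /seg leqnn.
have [[c [vc cac]]|nc] := pselect (exists c, v c = 0 /\ coll (alv a k) t1 a c).
  left; have [ac _ /(seg_bounds G)/andP[ac' _] _] := cac.
  have : (a < c)%N by rewrite ltn_neqAle ac.
  by case: c vc cac ac ac' => // b vb cab _ _ ab; exists b, t1; split.
right; have [[j caj] _] := da; have [aj _ jj ej] := caj.
have /andP[aj' jk] := seg_bounds G jj; exists j => //.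
have vj : v j = -1.
  case: (good_vel G j) => // vj; first by case: nc; exists j.
  by have := coll_vel G caj; rewrite va vj.
apply: (annihilation_intro G (k := k) (t := t1)) => //; first by rewrite aj'.
by move=> c vc cac; apply: nc; exists c.
Qed.

Lemma right_mover_stopped a k : v a = 1 -> L a k -> ~ (forall t, alv a k a t).
Proof.
move=> va [ak vk lk _] la.
have {}ak : (a < k)%N.
  by rewrite ltn_neqAle ak andbT; apply/eqP => e; move: vk; rewrite -e va; lra.
have xak := x_lt G ak.
have := seg_noX G ak _ (la (x k - x a)) (lk (x k - x a)).
by rewrite posR // posL // => h; have := h ltac:(lra); lra.
Qed.

Lemma arrival_after_target a b k t1 j :
  (a <= b)%N -> 0 < t1 -> v a = 1 -> v b.+1 = 0 -> dies (alv a k) t1 a ->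
  coll (alv a k) t1 a b.+1 -> (j <= k)%N -> L b.+2 j -> (forall t, alv b.+2 k j t) -> T a b j.
Proof.
move=> ab t10 va vb da cab jk Lj lj; split=> //.
  exact: (target_right_exit G ab t10 va vb cab).
have [bj vj _ _] := Lj.
by apply: (target_wins G ab t10 va vb da cab _ vj lj); rewrite /seg bj.
Qed.

Lemma arrival1 a k : v a = 1 ->
  L a k <-> (exists b, T a b k) \/ (exists j, [/\ (j < k)%N, C a j & L j.+1 k]).
Proof.
move=> va; split=> [Lk|[[b Tk]|[j [jk Cj Lj]]]]; last 2 first.
- exact: (static_arrival_arrival G Tk).
- exact/(enclosed_arrival G jk (annihilation_enclosed G Cj)).
have [ak vk lk low] := Lk.
case: (right_mover_fate ak va (right_mover_stopped va Lk)).
  move=> [b [t1 [ab t10 vb da cab]]]; left; exists b.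
  have rest := target_rest G ab t10 va vb da cab.
  have bk : (b.+2 <= k)%N.
    have [_ _ /(seg_bounds G)/andP[_ bk] _] := cab.
    by rewrite ltn_neqAle bk andbT; apply/eqP => e; move: vk; rewrite -e vb; lra.
  have kk : seg b.+2 k k by rewrite /seg bk leqnn.
  have lk' t : alv b.+2 k k t by apply/rest.
  apply: (arrival_after_target ab t10 va vb da cab) => //.
  apply: (arrival_ofE G) => // i /andP[bi ik] vi li.
  apply: (not_forever_left (a := a) vi) => t t0; apply: low => //; first lia.
  by apply/rest => //; rewrite /seg bi ltnW.
move=> [j jk Cj]; right; exists j.
have jk' : (j < k)%N.
  rewrite ltn_neqAle jk andbT; apply/eqP => e; subst j.
  by case: Cj => _ _ _ _ /(_ ((x k - x a) / 2 + 1)) [/(_ (lk _))]; lra.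
split=> //; exact/(enclosed_arrival G jk' (annihilation_enclosed G Cj)).
Qed.

(** Without [a], the target stands until [j] destroys it, and [k] arrives next. The particles
    between [a] and the target stay to the right of the former trajectory of [a] and die without
    passing [x b]. *)
Lemma static_arrival_shift a b j k : T a b j -> (j < k)%N -> L j.+1 k -> L a.+1 k.
Proof.
move=> Tj jk Ljk; have [[ab va la qa] vb Lbj win] := Tj.
have [bj vj lj _] := Lbj.
have Lbk : L b.+1 k by apply/(arrival0 G) => //; exists j.
have [bk vk lk low] := Lbk; have xjk := x_lt G jk.
have t1p : x a < x b.+1 by exact: (x_lt G).
have lp i t : 0 <= t -> alv a.+1 b i t -> x a + t <= pos i t <= x b.
  move=> t0 ii; have /andP[ai ib] := seg_bounds G ii.
  have ii' : alv a b i t by apply/(ghost_seg G _ (la t)) => //; rewrite gtn_eqF.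
  rewrite qa ?ai // andbT -(posR x t va).
  exact: (seg_noX G ai t0 (la t) ii').
(* This includes [k], which starts beyond [j]: even [j] would not be past the target before time
   [x b.+1 - x a]. *)
have rp i t : 0 <= t -> alv b.+1 k i t -> t <= x b.+1 - x a -> x b.+1 <= pos i t.
  move=> t0 ii tt1; have /andP[bi] := seg_bounds G ii.
  rewrite leq_eqVlt => /orP[/eqP ->|ik]; first by rewrite posL //; lra.
  by apply: low => //; rewrite bi.
have xb := x_lt G (ltnSn b).
have g i t : alv a.+1 k i t <-> alv a.+1 b i t \/ alv b.+1 k i t.
  move: i t; apply: (alive_glue G (fs _ _) (E _ _) (E _ _) (E _ _)).
  - by move=> i; rewrite /seg; lia.
  - by move=> i; rewrite /seg; lia.
  - move=> i l t t0 _ _ ii ll e; have /andP[p1 p2] := lp _ _ (ltW t0) ii.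
    by have := rp _ _ (ltW t0) ll; rewrite -e => h; have := h ltac:(lra); lra.
apply: (arrival_ofE G) => //; first by lia.
  by move=> t; apply/g; right.
move=> i ik vi li; have [bi|ib] := ltnP b i.
  apply: (not_forever_left (a := b.+1) vi) => t t0; apply: low => //; first lia.
  by case/g: (li t) => // /(seg_bounds G)/andP[_]; rewrite leqNgt bi.
have xai : x a < x i by apply: (x_lt G); lia.
have t0 : 0 <= x i - x a by lra.
case/g: (li (x i - x a)) => [/(lp _ _ t0)|/(seg_bounds G)]; last lia.
by rewrite posL //; lra.
Qed.

Lemma arrival1_shift a k : v a = 1 -> (a < k)%N ->
  L a.+1 k <-> C a k \/ (exists b j, [/\ (j < k)%N, T a b j & L j.+1 k]).
Proof.
move=> va ak; split=> [Lk|[Ck|[b [j [jk Tj Lj]]]]]; last 2 first.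
- exact: (annihilation_arrival G Ck).
- exact: (static_arrival_shift Tj jk Lj).
have [_ vk lk low] := Lk.
have ka : k != a by rewrite gtn_eqF.
have xak := x_lt G ak.
have na : ~ (forall t, alv a k a t).
  move=> la; have kk t : alv a k k t by apply/(ghost_seg G ka (la t)).
  have := seg_noX G ak _ (la (x k - x a)) (kk (x k - x a)).
  by rewrite posR // posL // => h; have := h ltac:(lra); lra.
case: (right_mover_fate (ltnW ak) va na); last first.
  move=> [j jk Cj]; left.
  by have := arrival_unique G (annihilation_arrival G Cj) Lk => <-.
move=> [b [t1 [ab t10 vb da cab]]]; right; exists b.
have rest := target_rest G ab t10 va vb da cab.
have et := target_time va vb cab.
have [_ aa cc ec] := cab.
have gh i t : i != a -> t <= t1 -> (alv a k i t <-> alv a.+1 k i t).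
  by move=> ia tt1; apply: (ghost_seg G ia); exact: (seg_le G tt1).
have none i : (a < i <= b)%N -> ~ alv a k i t1.
  move=> /andP[ai ib] ii.
  have p1 := seg_noX G ai (ltW t10) aa ii.
  have ib' : (i < b.+1)%N by rewrite ltnS.
  have p2 := seg_noX G ib' (ltW t10) ii cc.
  have ei : pos a t1 = pos i t1 by apply/eqP; rewrite eq_le p1 ec p2.
  have xi := x_lt G ib'; have xa := x_lt G ai.
  move: ei; rewrite posR // et; case: (good_vel G i) => vi.
  - by rewrite posL //; lra.
  - by rewrite pos0 //; lra.
  - by rewrite posR //; lra.
have bk : (b.+1 <= k)%N by case/andP: (seg_bounds G cc).
(* Up to [t1] the evolutions with and without [a] agree on the others, and the target separates the
   two sides; at [t1] the left side is already empty. *)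
have r2 i t : seg b.+1 k i -> (alv a.+1 k i t <-> alv b.+1 k i t).
  apply: (alive_restrict G (fs _ _) (fs _ _) (E _ _) (E _ _)).
    by move=> l; rewrite /seg; lia.
  move=> {}i l {}t t0 /andP[bi ik] nl ii ll e.
  have /andP[al lk'] := seg_bounds G ll.
  have lb : (l <= b)%N by move: nl; rewrite /seg; lia.
  have alb : (a < l <= b)%N by rewrite al.
  have la : l != a by rewrite gtn_eqF.
  have ia : i != a by rewrite gtn_eqF //; lia.
  have tt1 : t < t1.
    rewrite ltNge; apply/negP => le; apply: (none l alb).
    by apply/gh; rewrite ?lexx //; exact: (seg_le G le).
  have ll' : alv a k l t by apply/gh => //; exact: ltW.
  have ii' : alv a k i t by apply/gh => //; exact: ltW.
  have cc' : alv a k b.+1 t by exact: (seg_le G (ltW tt1)).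
  have p1 : pos l t <= x b.+1.
    by rewrite -(pos0 x t vb); apply: (seg_noX (k := k) (a := a) G _ (ltW t0) ll' cc'); rewrite ltnS.
  have p2 : x b.+1 <= pos i t.
    move: bi; rewrite leq_eqVlt => /orP[/eqP <-|bi]; first by rewrite pos0.
    by rewrite -(pos0 x t vb); apply: (seg_noX G bi (ltW t0) cc' ii').
  have clc : coll (alv a k) t b.+1 l.
    by split=> //; [rewrite gtn_eqF|rewrite (pos0 x t vb); lra].
  by have := ev_dies (E a k) t0 (static_dies G vb clc) cc; lra.
have Lb : L b.+1 k.
  apply: (arrival_ofE G) => //.
    by move=> t; apply/r2; rewrite // /seg bk leqnn.
  move=> i /andP[bi ik] vi li; apply: (not_forever_left (a := a.+1) vi) => t t0.
  apply: low => //; first lia.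
  by apply/r2 => //; rewrite /seg bi ltnW.
(* With [a] removed, the static target is the first particle of the remaining block, and [j] is the
   particle that hits it. *)
have [j [jk Lbj Ljk]] := proj1 (arrival0 G k vb) Lb.
exists j; split=> //.
apply: (arrival_after_target ab t10 va vb da cab (ltnW jk) Lbj).
have [bj _ lj _] := Lbj.
have bjk : (b.+2 <= j <= k)%N by rewrite bj ltnW.
have [h _] := seg_front_glue G bjk (fun i t t0 => arrival_front G Lbj (ltW t0)).
by move=> t; apply/h => //; rewrite /seg bj leqnn.
Qed.

(** The arriving particle is unique, and the death time of [a], equal to [x b.+1 - x a], then
    determines the target. *)
Lemma static_arrival_inj a b b' k k' : T a b k -> T a b' k' -> b = b' /\ k = k'.
Proof.
move=> Tk Tk'; have ek := arrival_unique G (static_arrival_arrival G Tk)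
  (static_arrival_arrival G Tk').
subst k'; split=> //.
have t10 b1 : T a b1 k -> 0 < x b1.+1 - x a.
  by case=> -[ab _ _ _] _ _ _; have := x_lt G (ab : (a < b1.+1)%N); lra.
have := dies_uniq (E a k) (t10 _ Tk) (t10 _ Tk') (static_arrival_dies G Tk)
  (static_arrival_dies G Tk').
by case: (ltngtP b b') => // h; have := x_lt G (h : (_.+1 < _.+1)%N); move=> ? ?; exfalso; lra.
Qed.

(** Since [a] dies only once, [j] and the target would meet it together, and the spin would save [a]
    or [j]. *)
Lemma annihilation_static_disjoint a b j k : C a j -> T a b k -> (j < k)%N -> L j.+1 k -> False.
Proof.
move=> Cj Tk jk Lj; have [aj va vj da dj] := Cj.
have [_ N] := annihilation_enclosed G Cj.
have ajk : (a <= j <= k)%N by lia.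
have [h _] := seg_front_glue G ajk (fun i t t0 ai => proj2 (andP (N i t (ltW t0) ai))).
have xaj := x_lt G aj.
set t1 := (x j - x a) / 2 in da dj.
have t10 : 0 < t1 by rewrite /t1; lra.
have sa : seg a j a by rewrite /seg leqnn ltnW.
have sj : seg a j j by rewrite /seg leqnn ltnW.
have Da : dies (alv a k) t1 a by apply/(diesP (E a k)) => // t; rewrite h.
have Dj : dies (alv a k) t1 j by apply/(diesP (E a k)) => // t; rewrite h.
have [[ab _ _ _] vb _ _] := Tk.
have xab := x_lt G (ab : (a < b.+1)%N).
have et := dies_uniq (E a k) t10 _ Da (static_arrival_dies G Tk).
have {}et : t1 = x b.+1 - x a by apply: et; lra.
have := static_arrival_coll G Tk; rewrite -et => cab.
have caj : coll (alv a k) t1 a j.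
  split; [by rewrite ltn_eqF|exact: dies_al Da|exact: dies_al Dj|].
  by rewrite posR // posL // /t1; lra.
have bj : b.+1 != j by apply/eqP => e; move: vb; rewrite e vj; lra.
have cjb : coll (alv a k) t1 j b.+1 by apply: coll_trans caj cab; rewrite eq_sym.
case: (good_spin G b.+1) => sb.
  case: Dj => _; apply; exists b.+1, a; split=> //; [exact: coll_sym|by rewrite gtn_eqF|by rewrite vj].
by case: Da => _; apply; exists b.+1, j; split=> //; rewrite va.
Qed.

(** As an arrival, [j] survives in the longer block, so it would be present between [a] and [k] when
    they annihilate. *)
Lemma annihilation_shift_disjoint a b j k : C a k -> T a b j -> (j < k)%N -> False.
Proof.
move=> Ck Tj jk; have [ak va vk da dk] := Ck.
have Lj := static_arrival_arrival G Tj.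
have [aj vj lj _] := Lj.
have ajk : (a <= j <= k)%N by rewrite aj ltnW.
have [h _] := seg_front_glue G ajk (fun i t t0 => arrival_front G Lj (ltW t0)).
have aj' : (a < j)%N.
  by rewrite ltn_neqAle aj andbT; apply/eqP => e; move: vj; rewrite -e va; lra.
apply: (annihilation_between G Ck (i := j)); first by rewrite aj' jk.
by apply/h; rewrite // /seg aj leqnn.
Qed.

End Decomposition.

(** * Symmetries, half-line, and the annihilation times *)

Section Transport.
Context {R : realType}.
Implicit Types (x v s : nat -> R).

(** Covers translations, [e = 1], and reflections, [e = -1]. Spins change sign with the velocities
    because a spin is the velocity of the survivor. The transported predicate solves the evolution
    equation, and uniqueness concludes. *)
Lemma alive_transport x v s x' v' s' (f : nat -> nat) (e c : R) (I I' : pred nat) :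
  good x v s -> good x' v' s' -> e = 1 \/ e = -1 ->
  locally_finite x I -> locally_finite x' I' ->
  (forall i, I' i -> I (f i)) -> (forall j, I j -> exists2 i, I' i & f i = j) ->
  (forall i j, I' i -> I' j -> f i = f j -> i = j) ->
  (forall i, I' i -> [/\ x' i = e * x (f i) + c, v' i = e * v (f i) & s' i = e * s (f i)]) ->
  forall i t, I' i -> (alive x' v' s' I' i t <-> alive x v s I (f i) t).
Proof.
move=> G G' he lI lI' fI fsurj finj h.
pose al i t := I' i /\ alive x v s I (f i) t.
have E := alive_ev G lI.
have e0 : e != 0 by case: he => ->; apply/eqP; lra.
have hc t i j : I' i -> I' j ->
    (collide x' v' al t i j <-> collide x v (alive x v s I) t (f i) (f j)).
  move=> Ii Ij; have [xi vi _] := h _ Ii; have [xj vj _] := h _ Ij.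
  have p : position x' v' i t = position x' v' j t <->
      position x v (f i) t = position x v (f j) t.
    rewrite /position xi vi xj vj; split=> [H|H].
      by apply: (mulfI e0); lra.
    by rewrite -!mulrA -(addrAC _ _ c) -mulrDr H; lra.
  split=> -[ne ai aj q]; split; (try by apply/p).
  - by apply: contraNneq ne => /(finj _ _ Ii Ij)->.
  - by case: ai.
  - by case: aj.
  - by apply: contraNneq ne => ->.
  - by [].
  - by [].
have hd t i : I' i -> (dying x' v' s' al t i <-> dying x v s (alive x v s I) t (f i)).
  move=> Ii; have [_ vi _] := h _ Ii; split=> -[[j cj] n]; split.
  - have Ij : I' j by case: cj => _ _ [].
    by exists (f j); apply/hc.
  - case=> c0 [j0 [cc cj0 cj' vc sc]]; apply: n.
    have [c1 Ic1 ec] := fsurj c0 (ev_sub E (let: And4 _ _ h _ := cc in h)).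
    have [j1 Ij1 ej] := fsurj j0 (ev_sub E (let: And4 _ _ h _ := cj0 in h)).
    subst c0 j0; exists c1, j1; have [_ vc1 sc1] := h _ Ic1; split; try by apply/hc.
    + by apply: contraNneq cj' => ->.
    + by rewrite vc1 vc mulr0.
    + by rewrite sc1 sc vi.
  - have [j1 Ij1 ej] := fsurj j (ev_sub E (let: And4 _ _ h _ := cj in h)).
    by subst j; exists j1; apply/hc.
  - case=> c0 [j0 [cc cj0 cj' vc sc]]; apply: n.
    have Ic : I' c0 by case: cc => _ _ [].
    have Ij : I' j0 by case: cj0 => _ _ [].
    have [_ vc1 sc1] := h _ Ic; exists (f c0), (f j0); split; try by apply/hc.
    + by apply: contraNneq cj' => /(finj _ _ Ic Ij)->.
    + by apply: (mulfI e0); rewrite mulr0 -vc1.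
    + by apply: (mulfI e0); rewrite -sc1 sc vi.
have E' : evolves x' v' s' I' al.
  move=> i t; split=> [[Ii /E[_ n]]|[Ii n]].
    by split=> // t' ht /(hd _ _ Ii); exact: n.
  split=> //; apply/E; split; first exact: fI.
  by move=> t' ht /(hd _ _ Ii); exact: n.
move=> i t Ii; rewrite (ev_unique G' lI' (alive_ev G' lI') E'); split=> [[]|] //.
Qed.

Lemma arrival_translate x v s x' v' s' d a k (c : R) :
  good x v s -> good x' v' s' ->
  (forall i, (a <= i <= k)%N ->
     [/\ x' i = x (i + d)%N + c, v' i = v (i + d)%N & s' i = s (i + d)%N]) ->
  arrival x' v' s' a k <-> arrival x v s (a + d) (k + d).
Proof.
move=> G G' h.
have tr i t : seg a k i -> (alive x' v' s' (seg a k) i t <->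
    alive x v s (seg (a + d) (k + d)) (i + d) t).
  apply: (alive_transport (f := fun i => (i + d)%N) (e := 1) (c := c)) => //.
  - by left.
  - exact: locfin_seg.
  - exact: locfin_seg.
  - by move=> l; rewrite /seg !leq_add2r.
  - move=> j; rewrite /seg => hj; exists (j - d)%N; lia.
  - by move=> l j _ _ /addIn.
  - by move=> l /h[-> -> ->]; rewrite !mul1r.
have hp i t : (a <= i <= k)%N -> position x' v' i t = position x v (i + d) t + c.
  by move=> /h[xi vi _]; rewrite /position xi vi; lra.
split=> -[ak vk lk low].
- have kk : seg a k k by rewrite /seg ak leqnn.
  have aa : seg a k a by rewrite /seg ak leqnn.
  split; [by rewrite leq_add2r|by have [_ <- _] := h _ kk|by move=> t; apply/tr|].
  move=> i t hi t0 ii; have ei : i = ((i - d) + d)%N by lia.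
  have si : seg a k (i - d)%N by rewrite /seg; lia.
  have := low (i - d)%N t ltac:(lia) t0; rewrite tr // hp // -ei => /(_ ii).
  by have [-> _ _] := h _ aa; lra.
- have {}ak : (a <= k)%N by rewrite leq_add2r in ak.
  have kk : seg a k k by rewrite /seg ak leqnn.
  have aa : seg a k a by rewrite /seg ak leqnn.
  split=> //; [by have [_ -> _] := h _ kk|by move=> t; apply/tr|].
  move=> i t hi t0; have si : seg a k i by rewrite /seg; lia.
  rewrite tr // hp // => /(low (i + d)%N t ltac:(lia) t0).
  by have [-> _ _] := h _ aa; lra.
Qed.

Lemma arrival_mirror x v s x' v' s' N a k (c : R) :
  good x v s -> good x' v' s' -> (a <= k <= N)%N ->
  (forall i, (a <= i <= k)%N ->
     [/\ x' i = c - x (N - i)%N, v' i = - v (N - i)%N & s' i = - s (N - i)%N]) ->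
  arrival x' v' s' a k <-> right_exit x v s (N - k) (N - a).
Proof.
move=> G G' akN h; have /andP[ak kN] := akN.
have tr i t : seg a k i -> (alive x' v' s' (seg a k) i t <->
    alive x v s (seg (N - k) (N - a)) (N - i) t).
  apply: (alive_transport (f := fun i => (N - i)%N) (e := -1) (c := c)) => //.
  - by right.
  - exact: locfin_seg.
  - exact: locfin_seg.
  - by move=> l; rewrite /seg; lia.
  - move=> j; rewrite /seg => hj; exists (N - j)%N; lia.
  - by move=> l j; rewrite /seg; lia.
  - by move=> l /h[-> -> ->]; rewrite !mulN1r; split=> //; lra.
have hp i t : (a <= i <= k)%N -> position x' v' i t = c - position x v (N - i) t.
  by move=> /h[xi vi _]; rewrite /position xi vi; lra.
have kk : seg a k k by rewrite /seg ak leqnn.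
have aa : seg a k a by rewrite /seg ak leqnn.
have [xa _ _] := h _ aa; have [_ vk _] := h _ kk.
split=> -[_ vk' lk low].
- split; [lia|by move: vk; rewrite vk'; lra|by move=> t; apply/tr|].
  move=> i t hi t0 ii; have ei : i = (N - (N - i))%N by lia.
  have si : seg a k (N - i)%N by rewrite /seg; lia.
  have := low (N - i)%N t ltac:(lia) t0; rewrite tr // hp // -ei => /(_ ii).
  by rewrite xa; lra.
- split=> //; [by rewrite vk vk'|by move=> t; apply/tr|].
  move=> i t hi t0; have si : seg a k i by rewrite /seg; lia.
  rewrite tr // hp // => /(low (N - i)%N t ltac:(lia) t0).
  by rewrite xa; lra.
Qed.

End Transport.

(** * Arrivals in a block and on the half-line *)

Section HalfLine.
Context {R : realType} (x v s : nat -> R) (G : good x v s).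
Hypothesis fT : locally_finite x predT.

Let half_locfin k : locally_finite x (fun i => (k < i)%N).
Proof. by move=> X; have [N HN] := fT X; exists N => i _; exact: HN. Qed.

Let half_split k i : predT i = seg 0 k i || (k < i)%N.
Proof. by rewrite /seg /=; lia. Qed.

Lemma arrival_half_line k : arrival x v s 0 k -> forall t, alive x v s predT k t.
Proof.
move=> Lk t; have [_ _ lk _] := Lk.
have [h _] := front_glue G fT (half_locfin k) (half_split k) (fun i h => h)
  (fun i t t0 => arrival_front G Lk (ltW t0)).
by apply/h; rewrite // /seg leqnn.
Qed.

(** A left-mover past 0 is past all starting points and escapes, so crossing 0 and crossing [x 0]
    select the same particle. This is why [arrival] may refer to [x a], which makes it invariant
    under translations. *)
Lemma half_line_arrival k t0 : 0 < x 0%N -> v k = -1 -> x k < t0 ->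
  alive x v s predT k t0 ->
  (forall j, (j < k)%N -> v j = -1 -> ~ (forall t, alive x v s predT j t)) ->
  arrival x v s 0 k.
Proof.
move=> x0 vk kt0 kk n; have E := alive_ev G fT.
have xk := x_le G (leq0n k).
have lk : forall t, alive x v s predT k t.
  by apply: (escape_left (a := 0) G E _ vk _ _ kk) => //; lra.
have front i t : 0 < t -> seg 0 k i -> alive x v s predT i t -> position x v i t <= x k - t.
  move=> tp /andP[_]; rewrite leq_eqVlt => /orP[/eqP->|ik] ii; first by rewrite posL.
  by rewrite -(posL x t vk); exact: (no_crossing G E ik (ltW tp) ii (lk t)).
have [h _] := front_restrict G fT (half_locfin k) (half_split k) (fun i h => h) front.
have sk i : (i <= k)%N -> seg 0 k i by [].
apply: (arrival_ofE G) => //; first by move=> t; apply/h => //; exact: sk.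
move=> i ik vi li; apply: (n i) => // t; apply/h => //.
by apply: sk; exact: ltnW.
Qed.

End HalfLine.

(** * Evolutions and annihilation times *)

Section Frozen.
Context {R : realType} (x v s : nat -> R).

Lemma well_posed_good : well_posed x v s -> good x v s.
Proof.
case=> -[_ xS] _ vv ss; split=> // i j.
elim: j => // j IH; rewrite ltnS leq_eqVlt => /orP[/eqP->//|/IH h].
exact: lt_trans (xS j).
Qed.

Lemma well_posed_locfin : well_posed x v s -> locally_finite x predT.
Proof.
move=> w; have G := well_posed_good w; case: w => _ xoo _ _ X.
have /cvgryPgt/(_ X)[N _ hN] := xoo.
exists N => i _; rewrite ltnNge => xi; apply/negP => Ni.
by have := hN i Ni; rewrite /=; lra.
Qed.

(** With two partners, the three velocities are distinct, which fixes the roles of right-mover,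
    target and left-mover. Conversely, the static particle at a given place is unique, so its spin
    alone decides. *)
Lemma dies_atE (D : nat -> \bar R) t i : good x v s ->
  dies_at x v s D t i <-> dying x v s (fun i t => (t%:E <= D i)%E) t i.
Proof.
move=> G; set al := fun i t => _; split.
- case=> [[j [cj n]]|[r [c [l [[vr vc vl crc ccl] h]]]]].
    split; first by exists j.
    case=> c [k [cc ck ck' _ _]].
    have [e|ne] := eqVneq c j; last exact: (n c).
    by apply: (n k); rewrite // -e eq_sym.
  have crc' : collide x v al t r c := crc.
  have ccl' : collide x v al t c l := ccl.
  have ex i' c' j : collide x v al t i' c -> v i' <> 0 -> collide x v al t i' c' -> v c' = 0 ->
      collide x v al t i' j -> s c' = v i' -> s c = v i'.
    move=> [_ _ _ e] _ [_ _ _ e'] vc' _ <-; congr s.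
    by apply: (same_vel G (t := t)); rewrite ?vc ?vc' // -e -e'.
  case: h => [->|[-> sc]|[-> sc]].
  + exact: (static_dies G vc ccl').
  + split; first by exists c.
    case=> c' [j [cc cj _ vc' sc']].
    by have := ex _ _ _ crc' _ cc vc' cj sc'; rewrite vr sc => h; have := h ltac:(lra); lra.
  + split; first by exists c; exact: coll_sym.
    case=> c' [j [cc cj _ vc' sc']].
    by have := ex _ _ _ (coll_sym ccl') _ cc vc' cj sc'; rewrite vl sc => h; have := h ltac:(lra); lra.
- case=> -[j cj] n.
  have [[k [kj ck]]|none] := pselect (exists k, k != j /\ collide x v al t i k); last first.
    by left; exists j; split=> // k kj ck; apply: none; exists k.
  right.
  have tri j' k' : collide x v al t i j' -> collide x v al t i k' -> k' != j' ->
      collide x v al t j' k'.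
    by move=> h1 h2 ne; apply: (coll_trans _ h1 h2); rewrite eq_sym.
  have cjk := tri _ _ cj ck kj.
  have cj' := coll_sym cj; have ck' := coll_sym ck; have cjk' := coll_sym cjk.
  have := coll_vel G cj; have := coll_vel G ck; have := coll_vel G cjk.
  case: (good_vel G i) => vi; case: (good_vel G j) => vj; case: (good_vel G k) => vk;
    rewrite ?vi ?vj ?vk => h1 h2 h3; try by exfalso; lra.
  + exists k, j, i; split; first by split.
    apply: Or33; split=> //; case: (good_spin G j) => // sj.
    by case: n; exists j, k; split; rewrite ?sj // eq_sym.
  + exists j, k, i; split; first by split.
    apply: Or33; split=> //; case: (good_spin G k) => // sk.
    by case: n; exists k, j; split; rewrite ?sk.
  + exists k, i, j; split; last by apply: Or31.
    by split.
  + exists j, i, k; split; last by apply: Or31.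
    by split.
  + exists i, k, j; split; first by split.
    apply: Or32; split=> //; case: (good_spin G k) => // sk.
    by case: n; exists k, j; split; rewrite ?sk.
  + exists i, j, k; split; first by split.
    apply: Or32; split=> //; case: (good_spin G j) => // sj.
    by case: n; exists j, k; split; rewrite ?sj // eq_sym.
Qed.

Lemma evolution_evolves (D : nat -> \bar R) : good x v s -> evolution x v s D ->
  evolves x v s predT (fun i t => (t%:E <= D i)%E).
Proof.
move=> G ev i t; split=> [tD|[_ n]].
  split=> // t' /andP[t'0 t't] /(dies_atE _ _ _ G)/(proj2 (ev i) _ t'0) e.
  by move: tD; rewrite e lee_fin; lra.
have [D0 h] := ev i; rewrite leNgt; apply/negP => lt.
case e : (D i) D0 lt h => [u| |] //; rewrite !lte_fin => u0 ut h.
by apply: (n u); [rewrite u0|apply/(dies_atE _ _ _ G)/h].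
Qed.

Lemma evolution_exists : good x v s -> locally_finite x predT ->
  exists D, evolution x v s D.
Proof.
move=> G fT; have E := alive_ev G fT; pose al := alive x v s predT.
pose D i : \bar R := if pselect (exists t, 0 < t /\ dying x v s al t i) is left ex
  then (projT1 (cid ex))%:E else +oo%E.
have D0 i : (0 < D i)%E.
  by rewrite /D; case: pselect => // ex; case: cid => /= u [u0 _]; rewrite lte_fin.
have DE i t : 0 < t -> (D i = t%:E <-> dying x v s al t i).
  move=> t0; rewrite /D; case: pselect => [ex|nex]; last first.
    by split=> // d; case: nex; exists t.
  case: cid => /= u [u0 du]; split=> [[<-]//|d].
  by rewrite (dies_uniq E u0 t0 du d).
have alE : al = (fun i t => (t%:E <= D i)%E).
  apply/funext => i; apply/funext => t; apply/propext; split=> [ii|tD].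
    rewrite leNgt; apply/negP => lt.
    case e : (D i) lt => [u| |] //; last by have := D0 i; rewrite e.
    have u0 : 0 < u by rewrite -lte_fin -e.
    rewrite lte_fin => ut; have := ev_dies E u0 (proj1 (DE i u u0) e) ii; lra.
  apply: contrapT => n; have [t' /andP[t'0 t't] /(DE _ _ t'0) e] := ev_dead E (isT : predT i) n.
  by move: tD; rewrite e lee_fin; lra.
exists D => i; split=> // t t0; rewrite (dies_atE _ _ _ G) -alE; exact: DE.
Qed.

(** Presence includes the time of annihilation, so the strict inequality between [x k] and [D k]
    becomes presence at some time later than [x k]. *)
Lemma reaches0E k : well_posed x v s ->
  reaches0 x v s k <-> v k = -1 /\ exists2 t, x k < t & alive x v s predT k t.
Proof.
move=> w; have G := well_posed_good w; have fT := well_posed_locfin w.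
have alE D : evolution x v s D -> forall i t, alive x v s predT i t <-> (t%:E <= D i)%E.
  move=> ev; exact: (ev_unique G fT (alive_ev G fT) (evolution_evolves G ev)).
split=> [[_ [D [ev vk lt]]]|[vk [t xt kt]]].
  split=> //; case e : (D k) lt => [u| |] //; rewrite ?lte_fin.
    by move=> xu; exists u => //; apply/(alE _ ev); rewrite e.
  by move=> _; exists (x k + 1); [lra|apply/(alE _ ev); rewrite e leey].
split=> //; have [D ev] := evolution_exists G fT; exists D; split=> //.
by apply: lt_le_trans (proj1 (alE _ ev k t) kt); rewrite lte_fin.
Qed.

Lemma first_arrivalE k : well_posed x v s ->
  first_arrival x v s = Some k.+1 <-> arrival x v s 0 k.
Proof.
move=> w; have G := well_posed_good w; have fT := well_posed_locfin w.
have rL j : arrival x v s 0 j -> reaches0 x v s j.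
  move=> Lj; have [_ vj _ _] := Lj; apply/(reaches0E _ w); split=> //.
  by exists (x j + 1); [lra|exact: (arrival_half_line G fT Lj)].
have minL j : reaches0 x v s j -> (forall i, reaches0 x v s i -> (j <= i)%N) ->
    arrival x v s 0 j.
  move=> /(reaches0E _ w)[vj [t xt jt]] hmin.
  apply: (half_line_arrival G fT _ vj xt jt); first by case: w => -[].
  move=> i ij vi li; have : (j <= i)%N; last by rewrite leqNgt ij.
  by apply: hmin; apply/(reaches0E _ w); split=> //; exists (x i + 1); [lra|].
rewrite /first_arrival; case: pselect => [ex|nex]; last first.
  by split=> // /rL r; case: nex; exists k; apply/asboolP.
case: ex_minnP => j /asboolP rj hmin.
have Lj : arrival x v s 0 j by apply: minL => // i /asboolP/hmin.
by split=> [[<-]//|Lk]; rewrite (arrival_unique G Lj Lk).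
Qed.

Lemma first_arrival_None : ~ well_posed x v s -> first_arrival x v s = None.
Proof.
move=> n; rewrite /first_arrival; case: pselect => // -[k /asboolP[]] //.
Qed.

Lemma first_arrival_n0 : first_arrival x v s <> Some 0%N.
Proof. by rewrite /first_arrival; case: pselect. Qed.

End Frozen.

(** * Independent families of real random variables *)

Section ProductLaw.
Context {R : realType} {K : choiceType}.

Definition rectangle (J : seq K) (B : K -> set R) : set (K -> measurableTypeR R) :=
  [set y | forall i, i \in J -> B i (y i)].

(** Finite-dimensional cylinders: a pi-system that generates the product sigma-algebra. *)
Definition rectangles : set (set (K -> measurableTypeR R)) :=
  [set A | exists J B, [/\ uniq J, forall i, measurable (B i) & A = rectangle J B]].

Local Notation samples := (g_sigma_algebraType rectangles).

Lemma rectangle_measurable J B : uniq J -> (forall i, measurable (B i)) ->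
  measurable (rectangle J B : set samples).
Proof. by move=> uJ mB; apply: sub_sigma_algebra; exists J, B; split. Qed.

Lemma setI_closed_rectangles : setI_closed rectangles.
Proof.
move=> _ _ [J1 [B1 [u1 m1 ->]]] [J2 [B2 [u2 m2 ->]]].
pose B i := (if i \in J1 then B1 i else setT) `&` (if i \in J2 then B2 i else setT).
exists (undup (J1 ++ J2)), B; split; first exact: undup_uniq.
  by move=> i; apply: measurableI; case: ifP.
apply/seteqP; split=> y.
- move=> [h1 h2] i _; rewrite /B; split; case: ifP => //; [exact: h1|exact: h2].
- move=> h; split=> i iJ; have := h i; rewrite mem_undup mem_cat iJ ?orbT => /(_ isT);
    rewrite /B iJ => -[]//.
Qed.

Lemma coordinate_measurable k (B : set R) : measurable B ->
  measurable ([set y | B (y k)] : set samples).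
Proof.
move=> mB; have -> : [set y | B (y k)] = rectangle [:: k] (fun _ => B).
  apply/seteqP; split=> y /=; first by move=> By i; rewrite inE => /eqP->.
  by apply; rewrite inE.
by apply: rectangle_measurable.
Qed.

Lemma measurable_fun_coordinate k : measurable_fun setT (fun y : samples => y k : R).
Proof. by move=> _ B mB; rewrite setTI; exact: coordinate_measurable. Qed.

Lemma measurable_samples d (T : measurableType d) (Y : T -> samples) :
  (forall k, measurable_fun setT (fun w => Y w k : R)) -> measurable_fun setT Y.
Proof.
move=> mY; have h := @measurability _ _ T samples setT Y rectangles erefl. apply: h.
move=> _ [_ [J [B [uJ mB ->]]] <-]; rewrite setTI.
have -> : Y @^-1` rectangle J B = \big[setI/setT]_(i <- J) ((fun w => Y w i : R) @^-1` B i).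
  apply/seteqP; split=> w; rewrite -bigcap_seq /=; by [].
apply: bigsetI_measurable => i _.
by rewrite -[_ @^-1` _]setTI; exact: mY.
Qed.

Section LawEq.
Context d d' (T : measurableType d) (T' : measurableType d').
Context (mu : {measure set T -> \bar R}) (mu' : {measure set T' -> \bar R}).
Context (Y : K -> T -> R) (Y' : K -> T' -> R).

(** Uniqueness of finite measures on a pi-system. The two measures may live on different spaces,
    which allows a comparison of [P] with [P \x P]. *)
Lemma law_eq : (forall k, measurable_fun setT (Y k)) ->
  (forall k, measurable_fun setT (Y' k)) -> (mu setT < +oo)%E ->
  (forall J B, uniq J -> (forall i, measurable (B i)) ->
     mu (\bigcap_(i in [set` J]) (Y i @^-1` B i)) =
     mu' (\bigcap_(i in [set` J]) (Y' i @^-1` B i))) ->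
  forall A : set samples, measurable A ->
  mu ((fun w k => Y k w) @^-1` A) = mu' ((fun w k => Y' k w) @^-1` A).
Proof.
move=> mY mY' fin h A mA.
pose F := (fun w k => Y k w) : T -> samples.
pose F' := (fun w k => Y' k w) : T' -> samples.
have mF : measurable_fun setT F by exact: measurable_samples.
have mF' : measurable_fun setT F' by exact: measurable_samples.
pose nu0 : {measure set samples -> \bar R} := pushforward mu F.
pose nu0' : {measure set samples -> \bar R} := pushforward mu' F'.
pose nu := nu0 mF; pose nu' := nu0' mF'.
rewrite -[LHS]/(nu A) -[RHS]/(nu' A).
apply: (@measure_unique _ R samples rectangles (fun=> setT) erefl setI_closed_rectangles _ _ nu nu') => //.
- by move=> _; exists [::], (fun=> setT); split=> //; apply/seteqP; split.
- by apply/seteqP; split=> // y _; exists 0%N.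
- by move=> _ [J [B [uJ mB ->]]]; exact: h.
Qed.

End LawEq.

Section Independence.
Context d (T : measurableType d) (P : probability T R) (Y : K -> T -> R).
Hypotheses (mY : forall k, measurable_fun setT (Y k)) (iY : mutually_independent P Y).

(** The map [f] is merely injective, so that shifts are covered as well as reflections. *)
Lemma law_transform (f g : K -> K) (h : K -> R -> R) : cancel f g ->
  (forall k, measurable_fun setT (h k)) ->
  (forall k B, measurable B -> P (Y (f k) @^-1` (h k @^-1` B)) = P (Y k @^-1` B)) ->
  forall A : set samples, measurable A ->
  P ((fun w k => Y k w) @^-1` A) = P ((fun w k => h k (Y (f k) w)) @^-1` A).
Proof.
move=> fK mh hP A mA.
have mhB k (B : set R) : measurable B -> measurable (h k @^-1` B).
  by move=> mB; rewrite -[_ @^-1` _]setTI; exact: mh.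
have mhY k : measurable_fun setT (fun w => h k (Y (f k) w)).
  exact: measurableT_comp.
have PT : (P setT < +oo)%E by rewrite probability_setT ltry.
apply: (law_eq (Y' := fun k w => h k (Y (f k) w)) mY mhY PT _ mA).
move=> J B uJ mB; transitivity (\prod_(i <- J) P (Y i @^-1` B i))%E; first exact: iY.
pose C j := h (g j) @^-1` B (g j).
have -> : \bigcap_(i in [set` J]) ((fun w => h i (Y (f i) w)) @^-1` B i) =
    \bigcap_(i in [set` map f J]) (Y i @^-1` C i).
  apply/seteqP; split=> w /= hw i.
    by move=> /= /mapP[j jJ ->]; rewrite /C fK; exact: hw.
  move=> /= iJ; have := hw (f i); rewrite /C /= fK; apply.
  by apply/mapP; exists i.
transitivity (\prod_(i <- map f J) P (Y i @^-1` C i))%E.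
  rewrite big_map; apply: eq_bigr => i _.
  by rewrite /C fK hP.
by symmetry; apply: iY; [rewrite map_inj_uniq //; exact: can_inj fK|move=> j; exact: mhB].
Qed.

(* The two blocks of coordinates can be sampled separately: under [P \x P], take
   those of [K1] from the first point and the others from the second. *)
Lemma indep_blocks (K1 : pred K) (A1 A2 : set samples) :
  measurable A1 -> measurable A2 ->
  (forall y y' : K -> R, (forall k, K1 k -> y k = y' k) -> A1 y -> A1 y') ->
  (forall y y' : K -> R, (forall k, ~~ K1 k -> y k = y' k) -> A2 y -> A2 y') ->
  P ((fun w k => Y k w) @^-1` (A1 `&` A2)) =
  (P ((fun w k => Y k w) @^-1` A1) * P ((fun w k => Y k w) @^-1` A2))%E.
Proof.
move=> mA1 mA2 d1 d2.
pose Y' k (w : T * T) := if K1 k then Y k w.1 else Y k w.2.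
pose Q : {measure set (T * T) -> \bar R} := (P \x P)%E.
have mY' k : measurable_fun setT (Y' k).
  by rewrite /Y'; case: (K1 k); apply: measurableT_comp.
have mF : measurable_fun setT ((fun w k => Y k w) : T -> samples).
  exact: measurable_samples.
have mFA (A : set samples) : measurable A -> measurable ((fun w k => Y k w : R) @^-1` A : set T).
  by move=> mA; rewrite -[_ @^-1` _]setTI; exact: mF.
have -> : P ((fun w k => Y k w) @^-1` (A1 `&` A2)) =
    Q ((fun w k => Y' k w) @^-1` (A1 `&` A2)).
  have PT : (P setT < +oo)%E by rewrite probability_setT ltry.
  apply: (law_eq mY mY' PT); last exact: measurableI.
  move=> J B uJ mB; transitivity (\prod_(i <- J) P (Y i @^-1` B i))%E; first exact: iY.
  have mcap (J' : seq K) : measurable (\bigcap_(i in [set` J']) (Y i @^-1` B i)).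
    rewrite bigcap_seq; apply: bigsetI_measurable => i _.
    by rewrite -[_ @^-1` _]setTI; exact: mY.
  have -> : \bigcap_(i in [set` J]) (Y' i @^-1` B i) =
     (\bigcap_(i in [set` seq.filter K1 J]) (Y i @^-1` B i)) `*`
     (\bigcap_(i in [set` seq.filter (predC K1) J]) (Y i @^-1` B i)).
    apply/seteqP; split=> -[w1 w2] /=.
      move=> hw; split=> i /=; rewrite mem_filter => /andP[ki iJ];
        have := hw i iJ; rewrite /Y' /=; first by rewrite ki.
      by rewrite (negbTE ki).
    move=> [h1 h2] i /= iJ; rewrite /Y'; case: ifPn => ki.
      by apply: h1; rewrite /= mem_filter ki.
    by apply: h2; rewrite /= mem_filter /= ki.
  rewrite /Q /= product_measure1E //=.
  transitivity ((\prod_(i <- seq.filter K1 J) P (Y i @^-1` B i)) *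
                \prod_(i <- seq.filter (predC K1) J) P (Y i @^-1` B i))%E.
    by rewrite (bigID K1) !big_filter.
  by congr (_ * _)%E; symmetry; apply: iY; rewrite ?filter_uniq.
have -> : (fun w k => Y' k w) @^-1` (A1 `&` A2) =
    ((fun w k => Y k w) @^-1` A1) `*` ((fun w k => Y k w) @^-1` A2).
  apply/seteqP; split=> -[w1 w2] /= [h1 h2]; split.
  - by apply: d1 h1 => k k1; rewrite /Y' k1.
  - by apply: d2 h2 => k k1; rewrite /Y' (negbTE k1).
  - by apply: d1 h1 => k k1; rewrite /Y' k1.
  - by apply: d2 h2 => k k1; rewrite /Y' (negbTE k1).
by rewrite /Q /= product_measure1E //; exact: mFA.
Qed.

End Independence.

End ProductLaw.

Notation coord := (nat + (nat + nat))%type.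

(** * Events on the sample space *)

Section Configuration.
Context {R : realType}.
Implicit Types (y : coord -> R).

(* Normalising the null samples makes every sample a good configuration, so that
   the decompositions are identities between sets depending on a block only. *)
Definition norm_gap (r : R) : R := if 0 < r then r else 1.
Definition norm_vel (r : R) : R := if (r == 1) || (r == -1) then r else 0.
Definition norm_spin (r : R) : R := if r == 1 then 1 else -1.

Definition config_x y n := \sum_(0 <= i < n.+1) norm_gap (y (inl i)).
Definition config_v y n := norm_vel (y (inr (inl n))).
Definition config_s y n := norm_spin (y (inr (inr n))).

Lemma config_xS y n : config_x y n.+1 = config_x y n + norm_gap (y (inl n.+1)).
Proof. by rewrite /config_x big_nat_recr. Qed.

Lemma norm_gap_gt0 r : 0 < norm_gap r.
Proof. by rewrite /norm_gap; case: ifPn. Qed.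

Lemma good_configuration y : good (config_x y) (config_v y) (config_s y).
Proof.
split=> [i j|i|i].
- elim: j => // j IH; have := norm_gap_gt0 (y (inl j.+1)).
  by rewrite config_xS ltnS leq_eqVlt => ? /orP[/eqP->|/IH]; lra.
- rewrite /config_v /norm_vel; case: ifPn => [/orP[]/eqP->|_].
  + exact: Or33.
  + exact: Or31.
  + exact: Or32.
- by rewrite /config_s /norm_spin; case: ifPn; [right|left].
Qed.

Lemma measurable_norm_gap : measurable_fun setT norm_gap.
Proof. by apply: measurable_fun_ifT => //; exact: measurable_fun_ltr. Qed.

Lemma measurable_norm_vel : measurable_fun setT norm_vel.
Proof.
apply: measurable_fun_ifT => //.
by apply: measurable_or => //; exact: measurable_fun_eqr.
Qed.

Lemma measurable_norm_spin : measurable_fun setT norm_spin.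
Proof. by apply: measurable_fun_ifT => //; exact: measurable_fun_eqr. Qed.

Local Notation Smp := (g_sigma_algebraType (@rectangles R coord)).

Lemma measurable_config_x n : measurable_fun setT (config_x ^~ n : Smp -> R).
Proof.
apply: measurable_sum => i; apply: measurableT_comp; first exact: measurable_norm_gap.
exact: measurable_fun_coordinate.
Qed.

Lemma measurable_config_v n : measurable_fun setT (config_v ^~ n : Smp -> R).
Proof.
apply: measurableT_comp; first exact: measurable_norm_vel.
exact: measurable_fun_coordinate.
Qed.

Lemma measurable_config_s n : measurable_fun setT (config_s ^~ n : Smp -> R).
Proof.
apply: measurableT_comp; first exact: measurable_norm_spin.
exact: measurable_fun_coordinate.
Qed.

Lemma measurable_fiber (f : Smp -> R) (r : R) : measurable_fun setT f ->
  measurable [set y | f y = r].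
Proof.
move=> mf; have -> : [set y | f y = r] = setT `&` f @^-1` [set r].
  by rewrite setTI.
exact: mf.
Qed.

Lemma measurable_ltset (f g : Smp -> R) : measurable_fun setT f -> measurable_fun setT g ->
  measurable [set y | f y < g y].
Proof.
move=> mf mg; have -> : [set y | f y < g y] = setT `&` (fun y => f y < g y) @^-1` [set true].
  by rewrite setTI; apply/seteqP; split.
by apply: measurable_fun_ltr.
Qed.

Definition arrival_set a k : set Smp := [set y | arrival (config_x y) (config_v y) (config_s y) a k].
Definition exit_set a b : set Smp := [set y | right_exit (config_x y) (config_v y) (config_s y) a b].
Definition velocity_set n (r : R) : set Smp := [set y | config_v y n = r].
Definition winning_set a b k : set Smp := [set y | config_x y b.+1 - config_x y a < config_x y k - config_x y b.+1 \/
   config_x y b.+1 - config_x y a = config_x y k - config_x y b.+1 /\ config_s y b.+1 = -1].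
Definition static_set a b k : set Smp := [set y | static_arrival (config_x y) (config_v y) (config_s y) a b k].
Definition annihilation_set a k : set Smp := [set y | annihilation (config_x y) (config_v y) (config_s y) a k].

Lemma static_setE a b k : static_set a b k = exit_set a b `&` velocity_set b.+1 0 `&` arrival_set b.+2 k `&` winning_set a b k.
Proof.
apply/seteqP; split=> y; first by case=> ? ? ? ?; split=> //; split=> //; split.
by case=> -[[]].
Qed.

Definition coord_index (k : coord) : nat :=
  match k with inl n => n | inr (inl n) => n | inr (inr n) => n end.

Definition coord_map (f g h : nat -> nat) (k : coord) : coord :=
  match k with
  | inl n => inl (f n) | inr (inl n) => inr (inl (g n)) | inr (inr n) => inr (inr (h n))
  end.

Lemma config_x_translate y y' d a k :
  (forall i, (a < i <= k)%N -> norm_gap (y' (inl i)) = norm_gap (y (inl (i + d)%N))) ->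
  forall i, (a <= i <= k)%N -> config_x y' i = config_x y (i + d)%N + (config_x y' a - config_x y (a + d)%N).
Proof.
move=> h i /andP[]; elim: i => [|i IH]; first by rewrite leqn0 => /eqP->; lra.
rewrite leq_eqVlt => /orP[/eqP<- _|ai ik]; first lra.
by rewrite config_xS addSn config_xS IH ?(ltnW ik) // h ?ai ?ik //; lra.
Qed.

(** The gap in front of [a] merely translates the block, hence the strict inequality for gaps. *)
Lemma arrival_local y y' d a k :
  (forall i, (a < i <= k)%N -> y' (inl i) = y (inl (i + d)%N)) ->
  (forall i, (a <= i <= k)%N -> y' (inr (inl i)) = y (inr (inl (i + d)%N))) ->
  (forall i, (a <= i <= k)%N -> y' (inr (inr i)) = y (inr (inr (i + d)%N))) ->
  arrival_set a k y' <-> arrival_set (a + d) (k + d) y.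
Proof.
move=> hx hv hs.
apply: arrival_translate (good_configuration y) (good_configuration y') _.
move=> i ik; split.
- by apply: config_x_translate ik => l lk; rewrite hx.
- by rewrite /config_v hv.
- by rewrite /config_s hs.
Qed.

(** Gap [n] separates the particles [n - 1] and [n], which are sent to [a + k + 1 - n] and
    [a + k - n]; the larger index names the new gap. *)
Definition reflect_gap a k n := (if a < n <= k then a + k.+1 - n else n)%N.
Definition reflect_index a k n := (if a <= n <= k then a + k - n else n)%N.
(* Not [-%R]: [norm_spin] maps every [r != 1] to [-1], so this is the map that
   reverses the normalised spin of every sample. *)
Definition flip_spin (r : R) : R := if r == 1 then -1 else 1.

Definition mirror_map a k := coord_map (reflect_gap a k) (reflect_index a k) (reflect_index a k).
Definition mirror_fun (k : coord) : R -> R :=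
  match k with inl _ => id | inr (inl _) => -%R | inr (inr _) => flip_spin end.
Definition mirror a k y : coord -> R := fun c => mirror_fun c (y (mirror_map a k c)).

Lemma norm_velN r : norm_vel (- r) = - norm_vel r.
Proof.
by rewrite /norm_vel !eqr_oppLR opprK orbC; case: ifP => // _; rewrite oppr0.
Qed.

Lemma norm_spin_flip r : norm_spin (flip_spin r) = - norm_spin r.
Proof.
rewrite /norm_spin /flip_spin; case: (r =P 1) => _; last by rewrite eqxx opprK.
by case: eqP => // ?; lra.
Qed.

Lemma config_x_mirror y a k i : (a <= i <= k)%N ->
  config_x (mirror a k y) i = (config_x (mirror a k y) a + config_x y k) - config_x y (a + k - i)%N.
Proof.
move=> /andP[]; elim: i => [|i IH].
  by rewrite leqn0 => /eqP-> _; rewrite add0n subn0; lra.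
rewrite leq_eqVlt => /orP[/eqP<- _|ai ik]; first by rewrite addKn; lra.
rewrite config_xS IH ?(ltnW ik) //.
rewrite /mirror /= /reflect_gap ai ik /=.
have -> : (a + k.+1 - i.+1 = (a + k - i.+1).+1)%N by lia.
have -> : (a + k - i = (a + k - i.+1).+1)%N by lia.
by rewrite config_xS; lra.
Qed.

Lemma mirror_config y a k i : (a <= i <= k)%N ->
  [/\ config_x (mirror a k y) i = (config_x (mirror a k y) a + config_x y k) - config_x y (a + k - i)%N,
      config_v (mirror a k y) i = - config_v y (a + k - i)%N
    & config_s (mirror a k y) i = - config_s y (a + k - i)%N].
Proof.
move=> ik; split; first exact: config_x_mirror.
- by rewrite /config_v /mirror /= /reflect_index ik norm_velN.
- by rewrite /config_s /mirror /= /reflect_index ik norm_spin_flip.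
Qed.

Lemma arrival_set_mirror y a k i j : (a <= i)%N -> (i <= j <= k)%N ->
  arrival_set i j (mirror a k y) <-> exit_set (a + k - j) (a + k - i) y.
Proof.
move=> ai /andP[ij jk].
apply: arrival_mirror (good_configuration y) (good_configuration _) _ _ => //.
  by rewrite ij (leq_trans jk) // leq_addl.
move=> l /andP[il lj]; apply: mirror_config; lia.
Qed.

(** Stated on configurations, because [flip_spin] is an involution only after normalisation. *)
Lemma mirrorK y a k i : (a <= i <= k)%N ->
  [/\ config_x (mirror a k (mirror a k y)) i = (config_x (mirror a k (mirror a k y)) a - config_x y a) + config_x y i,
      config_v (mirror a k (mirror a k y)) i = config_v y i
    & config_s (mirror a k (mirror a k y)) i = config_s y i].
Proof.
move=> ik; have ik' : (a <= a + k - i <= k)%N by lia.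
have [xi vi si] := mirror_config (mirror a k y) ik.
have [xi' vi' si'] := mirror_config y ik'.
have e : (a + k - (a + k - i) = i)%N by lia.
split; [|by rewrite vi vi' e opprK|by rewrite si si' e opprK].
have [xk _ _] := @mirror_config y a k k ltac:(lia).
have e' : (a + k - k = a)%N by lia.
rewrite e' in xk; rewrite xi xi' e xk; lra.
Qed.

Lemma exit_set_mirror y a k i j : (a <= i)%N -> (i <= j <= k)%N ->
  exit_set i j (mirror a k y) <-> arrival_set (a + k - j) (a + k - i) y.
Proof.
move=> ai /andP[ij jk].
have h : arrival_set (a + k - j) (a + k - i) (mirror a k (mirror a k y)) <-> exit_set i j (mirror a k y).
  have e1 : (a + k - (a + k - i) = i)%N by lia.
  have e2 : (a + k - (a + k - j) = j)%N by lia.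
  by rewrite -[X in exit_set X]e1 -[X in exit_set _ X]e2; apply: arrival_set_mirror; lia.
rewrite -h.
rewrite -[X in arrival_set X _ y]addn0 -[X in arrival_set _ X y]addn0.
apply: (arrival_translate (good_configuration y) (good_configuration _)
  (c := config_x (mirror a k (mirror a k y)) a - config_x y a)).
move=> l hl; rewrite addn0; have [xl vl sl] := @mirrorK y a k l ltac:(lia).
by split=> //; rewrite xl addrC.
Qed.

End Configuration.

(** * Identities between events, measurability and locality *)

Section Events.
Context {R : realType}.
Local Notation Smp := (g_sigma_algebraType (@rectangles R coord)).
Implicit Types (y : Smp) (A B : set Smp).

Lemma arrival_set0 a k : (k < a)%N -> arrival_set a k = set0 :> set Smp.
Proof. by move=> ka; apply/seteqP; split=> y // -[]; rewrite leqNgt ka. Qed.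

Lemma exit_set0 a b : (b < a)%N -> exit_set a b = set0 :> set Smp.
Proof. by move=> ka; apply/seteqP; split=> y // -[]; rewrite leqNgt ka. Qed.

Lemma exit_setE a b : (a <= b)%N -> exit_set a b = [set y | arrival_set a b (mirror a b y)] :> set Smp.
Proof.
move=> ab; apply/seteqP; split=> y /=; rewrite arrival_set_mirror ?leqnn ?ab //;
  by rewrite addnK addKn.
Qed.

Definition any_static_set a k : set Smp := \bigcup_(b < k) static_set a b k.

Lemma any_static_setP a k y : any_static_set a k y <-> exists b, static_set a b k y.
Proof.
split=> [[b _ h]|[b h]]; first by exists b.
exists b => //=; have [_ _ [bk _ _ _] _] := h; exact: ltnW.
Qed.

Lemma arrival_set_left a k : arrival_set a k `&` velocity_set a (-1) = (if k == a then velocity_set a (-1) else set0) :> set Smp.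
Proof.
apply/seteqP; split=> y.
  move=> [Lk va]; have -> : k = a by apply/(arrival_minus (good_configuration y) k va).
  by rewrite eqxx.
case: eqP => // e va; split=> //.
by apply/(arrival_minus (good_configuration y) k va).
Qed.

Lemma arrival_set_static a k :
  arrival_set a k `&` velocity_set a 0 = \bigcup_(j < k) (velocity_set a 0 `&` arrival_set a.+1 j `&` arrival_set j.+1 k) :> set Smp.
Proof.
apply/seteqP; split=> y.
  move=> [Lk va]; have [j [jk L1 L2]] := proj1 (arrival0 (good_configuration y) k va) Lk.
  by exists j.
move=> [j jk [[va L1] L2]]; split=> //.
by apply/(arrival0 (good_configuration y) k va); exists j.
Qed.

Lemma arrival_set_right a k :
  arrival_set a k `&` velocity_set a 1 = any_static_set a k `|` \bigcup_(j < k) (annihilation_set a j `&` arrival_set j.+1 k) :> set Smp.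
Proof.
apply/seteqP; split=> y.
  move=> [Lk va]; case: (proj1 (arrival1 (good_configuration y) k va) Lk).
    by move=> h; left; apply/any_static_setP.
  by move=> [j [jk ? ?]]; right; exists j.
move=> h; have va : config_v y a = 1.
  by case: h => [/any_static_setP[b [[]]]|[j _ [[]]]].
split=> //; apply/(arrival1 (good_configuration y) k va).
case: h => [/any_static_setP|[j jk [? ?]]]; first by left.
by right; exists j.
Qed.

Lemma arrival_set_shift_right a k : (a < k)%N ->
  velocity_set a 1 `&` arrival_set a.+1 k = annihilation_set a k `|` \bigcup_(j < k) (any_static_set a j `&` arrival_set j.+1 k) :> set Smp.
Proof.
move=> ak; apply/seteqP; split=> y.
  move=> [va Lk]; case: (proj1 (arrival1_shift (good_configuration y) va ak) Lk).
    by left.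
  by move=> [b [j [jk ? ?]]]; right; exists j => //; split=> //; apply/any_static_setP; exists b.
move=> h; have va : config_v y a = 1.
  by case: h => [[]|[j _ [/any_static_setP[b [[]]]]]].
split=> //; apply/(arrival1_shift (good_configuration y) va ak).
case: h => [?|[j jk [/any_static_setP[b ?] ?]]]; first by left.
by right; exists b, j.
Qed.

Lemma annihilation_set_disjoint a k : annihilation_set a k `&` \bigcup_(j < k) (any_static_set a j `&` arrival_set j.+1 k) = set0 :> set Smp.
Proof.
apply/seteqP; split=> y // -[Ck [j jk [/any_static_setP[b Tj] _]]].
exact: (annihilation_shift_disjoint (good_configuration y) Ck Tj jk).
Qed.

Lemma any_static_set_disjoint a k : any_static_set a k `&` \bigcup_(j < k) (annihilation_set a j `&` arrival_set j.+1 k) = set0 :> set Smp.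
Proof.
apply/seteqP; split=> y // -[/any_static_setP[b Tk] [j jk [Cj Lj]]].
exact: (annihilation_static_disjoint (good_configuration y) Cj Tk jk Lj).
Qed.

(** Expresses annihilations by arrivals, from which they inherit measurability and locality. *)
Lemma annihilation_setE a k : (a < k)%N -> annihilation_set a k =
  velocity_set a 1 `&` arrival_set a.+1 k `&` ~` (\bigcup_(j < k) (any_static_set a j `&` arrival_set j.+1 k)) :> set Smp.
Proof.
move=> ak; rewrite arrival_set_shift_right //; apply/seteqP; split=> y.
  move=> Ck; split; first by left.
  by move=> h; rewrite -[False]/((set0 : set Smp) y) -(annihilation_set_disjoint a k).
by case=> -[].
Qed.

Lemma annihilation_set0 a k : (k <= a)%N -> annihilation_set a k = set0 :> set Smp.
Proof. by move=> ka; apply/seteqP; split=> y // -[]; rewrite ltnNge ka. Qed.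

Lemma arrival_set_cover a k : arrival_set a k = (arrival_set a k `&` velocity_set a (-1)) `|` (arrival_set a k `&` velocity_set a 0) `|`
  (arrival_set a k `&` velocity_set a 1) :> set Smp.
Proof.
rewrite -!setIUr; apply/seteqP; split=> y; last by case.
move=> Lk; split=> //.
by case: (good_vel (good_configuration y) a) => va; [left; left|left; right|right].
Qed.

Lemma measurable_velocity_set n r : measurable (velocity_set n r : set Smp).
Proof. exact: measurable_fiber (measurable_config_v n). Qed.

Lemma measurable_winning_set a b k : measurable (winning_set a b k : set Smp).
Proof.
have mB i j : measurable_fun setT (fun y : Smp => config_x y i - config_x y j).
  by apply: measurable_funB; exact: measurable_config_x.
have -> : winning_set a b k = [set y : Smp | config_x y b.+1 - config_x y a < config_x y k - config_x y b.+1] `|`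
   ([set y : Smp | (config_x y b.+1 - config_x y a) - (config_x y k - config_x y b.+1) = 0] `&`
    [set y | config_s y b.+1 = -1]).
  apply/seteqP; split=> y.
    by move=> [h|[e h]]; [left|right; split=> //=; rewrite e subrr].
  by move=> [h|[/subr0_eq e h]]; [left|right].
apply: measurableU; first exact: measurable_ltset.
apply: measurableI; apply: measurable_fiber; last exact: measurable_config_s.
exact: measurable_funB.
Qed.

Lemma measurable_flip_spin : measurable_fun setT (@flip_spin R).
Proof. by apply: measurable_fun_ifT => //; exact: measurable_fun_eqr. Qed.

Lemma measurable_mirror_fun c : measurable_fun setT (@mirror_fun R c).
Proof. by case: c => [n|[n|n]] //=; exact: measurable_flip_spin. Qed.

Lemma measurable_mirror a k : measurable_fun setT (mirror a k : Smp -> Smp).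
Proof.
apply: measurable_samples => c; apply: measurableT_comp.
  exact: measurable_mirror_fun.
exact: measurable_fun_coordinate.
Qed.

Lemma measurable_preim_mirror a k A : measurable A ->
  measurable [set y : Smp | A (mirror a k y)].
Proof.
by move=> mA; rewrite -[X in measurable X]setTI; exact: measurable_mirror.
Qed.

(** Induction on the length of the block: the decompositions only involve arrivals in shorter
    blocks, their mirror images, velocities and comparisons of distances. *)
Lemma measurable_arrival_exit_sets n : (forall a k, (k < a + n)%N -> measurable (arrival_set a k : set Smp)) /\
  (forall a k, (k < a + n)%N -> measurable (exit_set a k : set Smp)).
Proof.
suff h : forall a k, (k < a + n)%N -> measurable (arrival_set a k : set Smp).
  split=> // a k kn; have [ak|ka] := leqP a k; last by rewrite exit_set0.
  by rewrite exit_setE //; apply: measurable_preim_mirror; exact: h.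
elim: n => [|n IH] a k kn; first by rewrite arrival_set0 //; lia.
have mQ b i : (i < b + n)%N -> measurable (exit_set b i : set Smp).
  move=> iN; have [bi|ib] := leqP b i; last by rewrite exit_set0.
  by rewrite exit_setE //; apply: measurable_preim_mirror; exact: IH.
have [ak|ka] := leqP a k; last by rewrite arrival_set0.
have mT b i : (i <= k)%N -> measurable (static_set a b i : set Smp).
  move=> ik; have [ab|ba] := leqP a b; last first.
    by rewrite static_setE exit_set0 // !set0I.
  have [bi|ib] := leqP b.+2 i; last first.
    by rewrite static_setE arrival_set0 // setI0 set0I.
  rewrite static_setE; apply: measurableI; last exact: measurable_winning_set.
  apply: measurableI; last by apply: IH; lia.
  by apply: measurableI; [apply: mQ; lia|exact: measurable_velocity_set].
have msT i : (i <= k)%N -> measurable (any_static_set a i).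
  by move=> ik; apply: bigcup_measurable => b _; exact: mT.
have mC j : (j < k)%N -> measurable (annihilation_set a j : set Smp).
  move=> jk; have [aj|ja] := ltnP a j; last by rewrite annihilation_set0.
  rewrite annihilation_setE //; apply: measurableI.
    by apply: measurableI; [exact: measurable_velocity_set|apply: IH; lia].
  apply: measurableC; apply: bigcup_measurable => i /= ij.
  have [ai|ia] := leqP a i; last first.
    have -> : any_static_set a i = set0; last by rewrite set0I.
    apply/seteqP; split=> y // /any_static_setP[b [[ab _ _ _] _ [bi _ _ _] _]]; lia.
  by apply: measurableI; [apply: msT; lia|apply: IH; lia].
rewrite arrival_set_cover; apply: measurableU; first apply: measurableU.
- by rewrite arrival_set_left; case: ifP => // _; exact: measurable_velocity_set.
- rewrite arrival_set_static; apply: bigcup_measurable => j /= jk.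
  have [aj|ja] := ltnP a j; last by rewrite (arrival_set0 (ja : (j < a.+1)%N)) setI0 set0I.
  apply: measurableI; last by apply: IH; lia.
  by apply: measurableI; [exact: measurable_velocity_set|apply: IH; lia].
- rewrite arrival_set_right; apply: measurableU; first exact: msT.
  apply: bigcup_measurable => j /= jk.
  have [aj|ja] := ltnP a j; last by rewrite (annihilation_set0 ja) set0I.
  by apply: measurableI; [exact: mC|apply: IH; lia].
Qed.

Lemma measurable_arrival_set a k : measurable (arrival_set a k : set Smp).
Proof. by apply: (measurable_arrival_exit_sets k.+1).1; lia. Qed.

Lemma measurable_exit_set a k : measurable (exit_set a k : set Smp).
Proof. by apply: (measurable_arrival_exit_sets k.+1).2; lia. Qed.

Lemma measurable_static_set a b k : measurable (static_set a b k : set Smp).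
Proof.
rewrite static_setE; apply: measurableI; last exact: measurable_winning_set.
apply: measurableI; last exact: measurable_arrival_set.
by apply: measurableI; [exact: measurable_exit_set|exact: measurable_velocity_set].
Qed.

Lemma measurable_any_static_set a k : measurable (any_static_set a k).
Proof. by apply: bigcup_measurable => b _; exact: measurable_static_set. Qed.

Lemma measurable_annihilation_set a k : measurable (annihilation_set a k : set Smp).
Proof.
have [ak|ka] := ltnP a k; last by rewrite annihilation_set0.
rewrite annihilation_setE //; apply: measurableI.
  by apply: measurableI; [exact: measurable_velocity_set|exact: measurable_arrival_set].
apply: measurableC; apply: bigcup_measurable => j _.
by apply: measurableI; [exact: measurable_any_static_set|exact: measurable_arrival_set].
Qed.

Definition depends_on (a k : nat) (A : set Smp) := forall y y',
  (forall c, (a <= coord_index c <= k)%N -> y c = y' c) -> A y -> A y'.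

Lemma depends_on_sub a k a' k' A : (a' <= a)%N -> (k <= k')%N -> depends_on a k A -> depends_on a' k' A.
Proof. by move=> aa kk lA y y' h; apply: lA => c hc; apply: h; lia. Qed.

Lemma depends_onI a k A B : depends_on a k A -> depends_on a k B -> depends_on a k (A `&` B).
Proof. by move=> lA lB y y' h [Ay By]; split; [exact: lA Ay|exact: lB By]. Qed.

Lemma depends_onC a k A : depends_on a k A -> depends_on a k (~` A).
Proof. by move=> lA y y' h nA Ay'; apply: nA; apply: lA Ay' => c hc; rewrite h. Qed.

Lemma depends_on_bigcup a k (D : set nat) (F : nat -> set Smp) :
  (forall i, D i -> depends_on a k (F i)) -> depends_on a k (\bigcup_(i in D) F i).
Proof. by move=> lF y y' h [i Di Fi]; exists i => //; exact: lF Fi. Qed.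

Lemma depends_on0 a k : depends_on a k set0.
Proof. by []. Qed.

Lemma depends_on_arrival_set a k : depends_on a k (arrival_set a k).
Proof.
move=> y y' h; have := @arrival_local R y y' 0 a k; rewrite !addn0 => -> //.
- by move=> i hi; rewrite addn0 h //= ; lia.
- by move=> i hi; rewrite addn0 h.
- by move=> i hi; rewrite addn0 h.
Qed.

Lemma depends_on_velocity_set n r : depends_on n n (velocity_set n r).
Proof. by move=> y y' h; rewrite /velocity_set /= /config_v h //= leqnn. Qed.

Lemma depends_on_exit_set a k : depends_on a k (exit_set a k).
Proof.
have [ak|ka] := leqP a k; last by rewrite exit_set0 //; exact: depends_on0.
move=> y y' h; rewrite exit_setE //=; apply: depends_on_arrival_set => c hc.
rewrite /mirror; congr (mirror_fun _ _); apply: h.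
by move: hc; case: c => [n|[n|n]] /=; rewrite /reflect_gap /reflect_index; case: ifP; lia.
Qed.

Lemma depends_on_winning_set a b k : (a <= b)%N -> (b.+1 <= k)%N -> depends_on a k (winning_set a b k).
Proof.
move=> ab bk y y' h.
have d i : (a <= i <= k)%N -> config_x y' i = config_x y i + (config_x y' a - config_x y a).
  have := @config_x_translate R y y' 0 a k; rewrite addn0 => hx hi.
  rewrite -[i in RHS]addn0; apply: hx hi => j hj.
  by rewrite addn0 h //=; lia.
have db := d b.+1 ltac:(lia); have dk := d k ltac:(lia).
have es : config_s y' b.+1 = config_s y b.+1 by rewrite /config_s h //=; lia.
by rewrite /winning_set /= es => -[?|[? ?]]; [left|right]; rewrite ?db ?dk; [lra|split=> //; lra].
Qed.

Lemma depends_on_static_set a b k : depends_on a k (static_set a b k).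
Proof.
have [ab|ba] := leqP a b; last by rewrite static_setE exit_set0 // !set0I; exact: depends_on0.
have [bk|kb] := leqP b.+2 k; last by rewrite static_setE arrival_set0 // setI0 set0I; exact: depends_on0.
rewrite static_setE; apply: depends_onI; last by apply: depends_on_winning_set => //; exact: ltnW.
apply: depends_onI; last by apply: depends_on_sub (@depends_on_arrival_set _ _); lia.
by apply: depends_onI; [apply: depends_on_sub (@depends_on_exit_set _ _)|apply: depends_on_sub (@depends_on_velocity_set _ _)]; lia.
Qed.

Lemma depends_on_any_static_set a k : depends_on a k (any_static_set a k).
Proof. by apply: depends_on_bigcup => b _; exact: depends_on_static_set. Qed.

Lemma depends_on_annihilation_set a k : depends_on a k (annihilation_set a k).
Proof.
have [ak|ka] := ltnP a k; last by rewrite annihilation_set0 //; exact: depends_on0.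
rewrite annihilation_setE //; apply: depends_onI.
  by apply: depends_onI; [apply: depends_on_sub (@depends_on_velocity_set _ _)|apply: depends_on_sub (@depends_on_arrival_set _ _)]; lia.
apply: depends_onC; apply: depends_on_bigcup => j /= jk.
have [aj|ja] := leqP a j; last first.
  have -> : any_static_set a j = set0; last by rewrite set0I; exact: depends_on0.
  apply/seteqP; split=> y // /any_static_setP[b [[ab _ _ _] _ [bi _ _ _] _]]; lia.
by apply: depends_onI; [apply: depends_on_sub (@depends_on_any_static_set _ _)|apply: depends_on_sub (@depends_on_arrival_set _ _)]; lia.
Qed.

End Events.

(** * Recurrence for the law of the first arrival *)

Definition conv {R : realType} (u w : nat -> R) n := \sum_(i < n.+1) u i * w (n - i)%N.

Section Recurrence.
Context {R : realType} (p : R).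
Local Notation Smp := (g_sigma_algebraType (@rectangles R coord)).
Implicit Types (A : set Smp).

(** Of the law of the gaps only its being common to all gaps is retained: this is where the
    independence of [m] comes from. The fields [bf_velN] and [bf_flip] give the invariance under
    reflection. *)
Record ballistic_family d (T : measurableType d) (P : probability T R)
    (Y : coord -> T -> R) : Prop := BallisticFamily {
  bf_meas : forall c, measurable_fun setT (Y c);
  bf_indep : mutually_independent P Y;
  bf_gap : forall n m (B : set R), measurable B -> P (Y (inl n) @^-1` B) = P (Y (inl m) @^-1` B);
  bf_vel : forall n m (B : set R), measurable B ->
    P (Y (inr (inl n)) @^-1` B) = P (Y (inr (inl m)) @^-1` B);
  bf_velN : forall n (B : set R), measurable B ->
    P (Y (inr (inl n)) @^-1` (-%R @^-1` B)) = P (Y (inr (inl n)) @^-1` B);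
  bf_spin : forall n m (B : set R), measurable B ->
    P (Y (inr (inr n)) @^-1` B) = P (Y (inr (inr m)) @^-1` B);
  bf_flip : forall n (B : set R), measurable B ->
    P (Y (inr (inr n)) @^-1` (@flip_spin R @^-1` B)) = P (Y (inr (inr n)) @^-1` B);
  bf_vel1 : forall n, P (Y (inr (inl n)) @^-1` [set 1]) = ((1 - p) / 2)%:E;
  bf_velN1 : forall n, P (Y (inr (inl n)) @^-1` [set -1]) = ((1 - p) / 2)%:E }.

Context d (T : measurableType d) (P : probability T R) (Y : coord -> T -> R).
Hypothesis bY : ballistic_family P Y.

Let mY := bf_meas bY.
Let iY := bf_indep bY.
Let F := (fun w c => Y c w) : T -> Smp.

Definition pr (A : set Smp) : R := fine (P ((fun w c => Y c w) @^-1` A)).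

Let mF : measurable_fun setT F. Proof. exact: measurable_samples. Qed.

Let mFA (A : set Smp) : measurable A -> measurable ((fun w c => Y c w : R) @^-1` A : set T).
Proof. by move=> mA; rewrite -[_ @^-1` _]setTI; exact: mF. Qed.

Lemma prE A : measurable A -> P ((fun w c => Y c w) @^-1` A) = (pr A)%:E.
Proof. by move=> mA; rewrite fineK // fin_num_measure //; exact: mFA. Qed.

Lemma pr_ge0 A : 0 <= pr A.
Proof. by rewrite fine_ge0. Qed.

Lemma pr_set0 : pr set0 = 0.
Proof. by rewrite /pr preimage_set0 measure0. Qed.

Lemma pr_eqE A (B : set Smp) : measurable A -> measurable B ->
  P ((fun w c => Y c w) @^-1` A) = P ((fun w c => Y c w) @^-1` B) -> pr A = pr B.
Proof. by move=> mA mB h; rewrite /pr h. Qed.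

Lemma prU A (B : set Smp) : measurable A -> measurable B -> A `&` B = set0 ->
  pr (A `|` B) = pr A + pr B.
Proof.
move=> mA mB AB; apply: EFin_inj; rewrite EFinD -!prE //; last exact: measurableU.
rewrite preimage_setU measureU //; try exact: mFA.
by rewrite -preimage_setI AB preimage_set0.
Qed.

Lemma pr_bigcup n (D : nat -> set Smp) : (forall i, measurable (D i)) ->
  (forall i j y, D i y -> D j y -> i = j) ->
  pr (\bigcup_(i < n) D i) = \sum_(i < n) pr (D i).
Proof.
move=> mD dD; elim: n => [|n IH].
  rewrite big_ord0 -pr_set0; congr pr; apply/seteqP; split=> y // -[i /=].
  by rewrite ltn0.
rewrite big_ord_recr /= -IH -prU //.
- congr pr; rewrite !bigcup_mkord big_ord_recr /=; by [].
- by apply: bigcup_measurable.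
- apply/seteqP; split=> y // -[[i /= ni Di] Dn].
  by move: ni; rewrite (dD _ _ _ Di Dn) ltnn.
Qed.

Lemma pr_indep a m k (A B : set Smp) : measurable A -> measurable B ->
  depends_on a m A -> depends_on m.+1 k B -> pr (A `&` B) = pr A * pr B.
Proof.
move=> mA mB lA lB; apply: EFin_inj; rewrite EFinM -!prE //; last exact: measurableI.
apply: (indep_blocks mY iY (K1 := fun c => (coord_index c <= m)%N)) => //.
- by move=> y y' h; apply: lA => c /andP[_ hc]; exact: h.
- by move=> y y' h; apply: lB => c /andP[hc _]; apply: h; rewrite -ltnNge.
Qed.

Lemma pr_arrival_set_shift a k e : pr (arrival_set (a + e) (k + e)) = pr (arrival_set a k).
Proof.
apply/esym/pr_eqE; try exact: measurable_arrival_set.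
pose f := coord_map (addn^~ e) (addn^~ e) (addn^~ e).
pose g := coord_map (subn^~ e) (subn^~ e) (subn^~ e).
have fK : cancel f g by case=> [n|[n|n]] /=; rewrite addnK.
rewrite (law_transform mY iY (h := fun _ => id) fK) //; last exact: measurable_arrival_set.
- congr (P _); apply/seteqP; split=> w /=.
  + by move/(arrival_local (y := fun c => Y c w) (d := e)); apply.
  + by move=> h; apply/(arrival_local (y := fun c => Y c w) (d := e)).
- move=> [n|[n|n]] B mB; [exact: bf_gap|exact: bf_vel|exact: bf_spin].
Qed.

Lemma pr_mirror N A : measurable A -> pr [set y | A (mirror 0 N y)] = pr A.
Proof.
move=> mA; apply/esym/pr_eqE => //; first exact: measurable_preim_mirror.
have fK : cancel (mirror_map 0 N) (mirror_map 0 N).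
  move=> [n|[n|n]]; rewrite /mirror_map /=.
  - congr (inl _); rewrite /reflect_gap; case: (boolP (0 < n <= N)%N) => h.
      by case: ifP; lia.
    by rewrite (negbTE h).
  - congr (inr (inl _)); rewrite /reflect_index; case: (boolP (0 <= n <= N)%N) => h.
      by case: ifP; lia.
    by rewrite (negbTE h).
  - congr (inr (inr _)); rewrite /reflect_index; case: (boolP (0 <= n <= N)%N) => h.
      by case: ifP; lia.
    by rewrite (negbTE h).
rewrite (law_transform mY iY (h := @mirror_fun R) fK) //.
  by move=> k; exact: measurable_mirror_fun.
move=> [n|[n|n]] B mB /=.
- exact: bf_gap.
- by rewrite (bf_velN bY) //; exact: bf_vel.
- by rewrite (bf_flip bY) //; exact: bf_spin.
Qed.

(* Indexed by the number [l] of particles of the block: [P(A = l)], and the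
   probability that the particles 1 and [l] annihilate each other. *)
Definition arrival_prob l := if l is n.+1 then pr (arrival_set 0 n) else 0.
Definition annihilation_prob l := if l is n.+1 then pr (annihilation_set 0 n) else 0.

Lemma pr_arrival_set a k : pr (arrival_set a k) = arrival_prob (k.+1 - a).
Proof.
have [ak|ka] := leqP a k; last by rewrite arrival_set0 // pr_set0 (_ : k.+1 - a = 0)%N //; lia.
by rewrite subSn //= -(pr_arrival_set_shift 0 (k - a) a) add0n subnK.
Qed.

Lemma pr_velocity_set1 n : pr (velocity_set n 1) = (1 - p) / 2.
Proof.
rewrite /pr; have -> : (fun w c => Y c w) @^-1` velocity_set n 1 = Y (inr (inl n)) @^-1` [set 1].
  apply/seteqP; split=> w /=; rewrite /velocity_set /= /config_v /norm_vel.
    by case: ifPn => [/orP[/eqP->|/eqP->]//|_ e]; exfalso; move: e; lra.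
  by move=> ->; rewrite eqxx.
by rewrite (bf_vel1 bY).
Qed.

Lemma pr_velocity_setN1 n : pr (velocity_set n (-1)) = (1 - p) / 2.
Proof.
rewrite /pr; have -> : (fun w c => Y c w) @^-1` velocity_set n (-1) = Y (inr (inl n)) @^-1` [set -1].
  apply/seteqP; split=> w /=; rewrite /velocity_set /= /config_v /norm_vel.
    by case: ifPn => [/orP[/eqP->|/eqP->]//|_ e]; exfalso; move: e; lra.
  by move=> ->; rewrite eqxx orbT.
by rewrite (bf_velN1 bY).
Qed.

Lemma pr_setT : pr setT = 1.
Proof. by rewrite /pr preimage_setT probability_setT. Qed.

Lemma pr_velocity_set0 n : pr (velocity_set n 0) = p.
Proof.
have m r := measurable_velocity_set n r : measurable (velocity_set n r : set Smp).
have e : (setT : set Smp) = (velocity_set n (-1) `|` velocity_set n 0) `|` velocity_set n 1.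
  apply/seteqP; split=> y // _.
  by case: (good_vel (good_configuration y) n) => va; [left; left|left; right|right].
have dis (r r' : R) : r <> r' -> velocity_set n r `&` velocity_set n r' = set0 :> set Smp.
  by move=> ne; apply/seteqP; split=> y // -[h h']; apply: ne; rewrite -h -h'.
have := pr_setT; rewrite e prU //; last 2 first.
- exact: measurableU.
- by rewrite setIUl !dis ?setU0 //; lra.
rewrite prU //; last by apply: dis; lra.
by rewrite pr_velocity_set1 pr_velocity_setN1; lra.
Qed.

Lemma pr_arrival_set_static n : pr (arrival_set 0 n `&` velocity_set 0 0) = p * conv arrival_prob arrival_prob n.
Proof.
rewrite arrival_set_static pr_bigcup; last first.
- by move=> i j y [[_ h] _] [[_ h'] _]; exact: (arrival_unique (good_configuration y) h h').
- move=> i; apply: measurableI; last exact: measurable_arrival_set.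
  by apply: measurableI; [exact: measurable_velocity_set|exact: measurable_arrival_set].
(* The last term of the convolution vanishes with [arrival_prob 0]. *)
rewrite /conv big_ord_recr /= subnn mulr0 addr0 mulr_sumr; apply: eq_bigr => j _.
rewrite (@pr_indep 0 j n) //; last 1 first.
- exact: depends_on_arrival_set.
- rewrite (@pr_indep 0 0 j); last 1 first.
  + exact: depends_on_arrival_set.
  + by rewrite pr_velocity_set0 !pr_arrival_set !subSS subn0 mulrA.
  + exact: measurable_velocity_set.
  + exact: measurable_arrival_set.
  + exact: depends_on_velocity_set.
- by apply: measurableI; [exact: measurable_velocity_set|exact: measurable_arrival_set].
- exact: measurable_arrival_set.
- by apply: depends_onI; [apply: depends_on_sub (@depends_on_velocity_set _ _ _)|apply: depends_on_sub (@depends_on_arrival_set _ _ _)].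
Qed.

(** The target can be reached from both sides, but [n] would come before [0], or in a tie with spin
    +1. *)
Definition static_lost b n : set Smp := exit_set 0 b `&` velocity_set b.+1 0 `&` arrival_set b.+2 n `&` ~` winning_set 0 b n.

(** The reflection exchanges the two distances to the target and reverses its spin, so losing
    becomes winning even in a tie. *)
Lemma static_lost_mirror m b y : (b <= m)%N ->
  static_lost b m.+2 (mirror 0 m.+2 y) <-> static_set 0 (m - b) m.+2 y.
Proof.
move=> bm; rewrite /static_lost static_setE.
have e0 : (0 + m.+2 - 0 = m.+2)%N by lia.
have eb : (0 + m.+2 - b = (m - b).+2)%N by lia.
have eb1 : (0 + m.+2 - b.+1 = (m - b).+1)%N by lia.
have eb2 : (0 + m.+2 - b.+2 = m - b)%N by lia.
have em : (0 + m.+2 - m.+2 = 0)%N by lia.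
have hQ : exit_set 0 b (mirror 0 m.+2 y) <-> arrival_set (m - b).+2 m.+2 y.
  by rewrite exit_set_mirror ?e0 ?eb //; lia.
have hL : arrival_set b.+2 m.+2 (mirror 0 m.+2 y) <-> exit_set 0 (m - b) y.
  by rewrite arrival_set_mirror ?eb2 ?em //; lia.
have [x0 _ _] := @mirror_config _ y 0 m.+2 0 ltac:(lia).
have [xn _ _] := @mirror_config _ y 0 m.+2 m.+2 ltac:(lia).
have [xb vb sb] := @mirror_config _ y 0 m.+2 b.+1 ltac:(lia).
rewrite e0 em eb1 in x0 xn xb vb sb.
have hV : velocity_set b.+1 0 (mirror 0 m.+2 y) <-> velocity_set (m - b).+1 0 y.
  by rewrite /velocity_set /= vb; split=> [|->]; lra.
have hW : (~` winning_set 0 b m.+2) (mirror 0 m.+2 y) <-> winning_set 0 (m - b) m.+2 y.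
  rewrite /winning_set /setC /= xb xn sb; set X := config_x (mirror 0 m.+2 y) 0 in x0 *.
  have := good_spin (good_configuration y) (m - b).+1.
  move: (config_s y _) => sg hs; split.
    move=> n; have [lt|gt|eq] := ltgtP (config_x y (m - b).+1 - config_x y 0) (config_x y m.+2 - config_x y (m - b).+1).
    - by left.
    - by case: n; left; lra.
    - right; split=> //; case: hs => // s1; case: n; right; split; [lra|by rewrite s1].
  by clear e0 eb eb1 eb2 em; move=> [h|[h h1]] [h'|[h' h1']]; lra.
split=> [[[[/hQ ? /hV ?] /hL ?] /hW ?]|[[[? ?] ?] ?]].
  by split=> //; split.
by split; [split; [split|]|]; [apply/hQ|apply/hV|apply/hL|apply/hW].
Qed.

Lemma measurable_static_lost b n : measurable (static_lost b n).
Proof.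
have mw : measurable (winning_set 0 b n : set Smp) by exact: measurable_winning_set.
apply: measurableI; last exact: measurableC.
apply: measurableI; last exact: measurable_arrival_set.
by apply: measurableI; [exact: measurable_exit_set|exact: measurable_velocity_set].
Qed.

Lemma pr_exit_set b : pr (exit_set 0 b) = arrival_prob b.+1.
Proof.
rewrite /= -[RHS](pr_mirror b); last exact: measurable_arrival_set.
by rewrite exit_setE.
Qed.

(** Summing the two cases removes the comparison of distances, the only condition that links the
    blocks; the rest factorises. *)
Lemma pr_static b n : pr (static_set 0 b n) + pr (static_lost b n) =
  p * (arrival_prob b.+1 * arrival_prob (n - b.+1)).
Proof.
rewrite -prU; last 3 first.
- exact: measurable_static_set.
- exact: measurable_static_lost.
- rewrite static_setE /static_lost; apply/seteqP; split=> y //.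
  by move=> [[_ w] [_ w']].
rewrite static_setE /static_lost -setIUr setUv setIT.
rewrite (@pr_indep 0 b.+1 n).
- rewrite (@pr_indep 0 b b.+1).
  + by rewrite pr_exit_set pr_velocity_set0 pr_arrival_set subSS; ring.
  + exact: measurable_exit_set.
  + exact: measurable_velocity_set.
  + exact: depends_on_exit_set.
  + exact: depends_on_velocity_set.
- by apply: measurableI; [exact: measurable_exit_set|exact: measurable_velocity_set].
- exact: measurable_arrival_set.
- apply: depends_onI; first by apply: depends_on_sub (@depends_on_exit_set _ _ _).
  by apply: depends_on_sub (@depends_on_velocity_set _ _ _).
- exact: depends_on_arrival_set.
Qed.

Lemma pr_static0 b n : (n < b.+2)%N -> pr (static_set 0 b n) = 0 /\ pr (static_lost b n) = 0.
Proof.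
move=> nb; have := pr_static b n; rewrite (_ : n - b.+1 = 0)%N; last lia.
by rewrite !mulr0; have := pr_ge0 (static_set 0 b n); have := pr_ge0 (static_lost b n); lra.
Qed.

(* If a static particle is reached from both sides, the mirror symmetry, which
   also reverses the spins, exchanges the two sides, so each is the one that
   passes with probability 1/2. *)
Lemma pr_any_static_set n : pr (any_static_set 0 n) = p / 2 * conv arrival_prob arrival_prob n.
Proof.
rewrite /any_static_set pr_bigcup; last first.
- by move=> i j y h h'; case: (static_arrival_inj (good_configuration y) h h').
- by move=> b; exact: measurable_static_set.
have e : \sum_(b < n) pr (static_set 0 b n) = \sum_(b < n) pr (static_lost b n).
  case: n => [|[|m]]; first by rewrite !big_ord0.
    by rewrite !big_ord1; have [-> ->] := @pr_static0 0 1 isT.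
  (* For the last index no particle remains behind the target, so it contributes 0; the others are
     exchanged by [b -> m - b]. *)
  rewrite big_ord_recr [RHS]big_ord_recr /=.
  have [-> ->] := @pr_static0 m.+1 m.+2 ltac:(lia); congr (_ + _).
  rewrite [LHS](reindex_inj rev_ord_inj) /=; apply: eq_bigr => b _.
  have bm : (b <= m)%N by have := ltn_ord b; lia.
  rewrite subSS -(pr_mirror m.+2 (measurable_static_lost b m.+2)).
  congr pr; apply/seteqP; split=> y /=; first by move/(static_lost_mirror _ bm).
  by move=> h; apply/(static_lost_mirror _ bm).
have s : \sum_(b < n) pr (static_set 0 b n) + \sum_(b < n) pr (static_lost b n) =
    p * conv arrival_prob arrival_prob n.
  rewrite -big_split /= /conv big_ord_recl /= mul0r add0r mulr_sumr.
  by apply: eq_bigr => b _; rewrite pr_static.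
by rewrite -e in s; lra.
Qed.

(** The factor [3 * p / 2] adds the [p] of a static first particle to the [p / 2] of a right-mover
    stopped by a static one. *)
Lemma arrival_prob_rec n : arrival_prob n.+1 = (if n == 0%N then (1 - p) / 2 else 0) +
  3 * p / 2 * conv arrival_prob arrival_prob n + conv annihilation_prob arrival_prob n.+1.
Proof.
have mL := @measurable_arrival_set R 0 n.
have mI r : measurable (arrival_set 0 n `&` velocity_set 0 r : set Smp).
  by apply: measurableI => //; exact: measurable_velocity_set.
have dI (r r' : R) : r <> r' -> arrival_set 0 n `&` velocity_set 0 r `&` (arrival_set 0 n `&` velocity_set 0 r') = set0 :> set Smp.
  by move=> ne; apply/seteqP; split=> y // -[[_ h] [_ h']]; apply: ne; rewrite -h -h'.
rewrite [LHS]/= arrival_set_cover prU //; last 2 first.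
- exact: measurableU.
- by rewrite setIUl !dI ?setU0 //; lra.
rewrite prU //; last by apply: dI; lra.
have mG i : measurable (annihilation_set 0 i `&` arrival_set i.+1 n : set Smp).
  by apply: measurableI; [exact: measurable_annihilation_set|exact: measurable_arrival_set].
rewrite arrival_set_left pr_arrival_set_static arrival_set_right prU; last 3 first.
- exact: measurable_any_static_set.
- by apply: bigcup_measurable.
- exact: any_static_set_disjoint.
rewrite pr_any_static_set pr_bigcup //; last first.
  (* The partner of particle 0 is the first arrival of the block that starts at 1, hence unique. *)
  move=> i j y [h _] [h' _]; have Gy := good_configuration y.
  exact: (arrival_unique Gy (annihilation_arrival Gy h) (annihilation_arrival Gy h')).
have -> : conv annihilation_prob arrival_prob n.+1 = \sum_(i < n) pr (annihilation_set 0 i `&` arrival_set i.+1 n).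
  rewrite /conv big_ord_recl /= mul0r add0r big_ord_recr /=.
  have -> : (n.+1 - bump 0 n = 0)%N by rewrite /bump; lia.
  rewrite mulr0 addr0; apply: eq_bigr => i _.
  rewrite (@pr_indep 0 i n); last 1 first.
  - exact: depends_on_arrival_set.
  - by rewrite pr_arrival_set /bump /= add1n !subSS.
  - exact: measurable_annihilation_set.
  - exact: measurable_arrival_set.
  - exact: depends_on_annihilation_set.
have -> : pr (if n == 0%N then velocity_set 0 (-1) else set0) = if n == 0%N then (1 - p) / 2 else 0.
  by case: ifP => _; [rewrite pr_velocity_setN1|rewrite pr_set0].
lra.
Qed.

Lemma annihilation_prob_rec n : annihilation_prob n.+1 = (1 - p) / 2 * arrival_prob n -
  p / 2 * conv (conv arrival_prob arrival_prob) arrival_prob n.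
Proof.
case: n => [|n].
  by rewrite /= annihilation_set0 // pr_set0 /conv !big_ord1 /= !mulr0 subr0.
have mS i : measurable (any_static_set 0 i `&` arrival_set i.+1 n.+1 : set Smp).
  by apply: measurableI; [exact: measurable_any_static_set|exact: measurable_arrival_set].
have := congr1 pr (@arrival_set_shift_right R 0 n.+1 isT).
rewrite (@pr_indep 0 0 n.+1); last 1 first.
- exact: depends_on_arrival_set.
- rewrite pr_velocity_set1 pr_arrival_set subn1 prU; last 3 first.
  + exact: measurable_annihilation_set.
  + by apply: bigcup_measurable.
  + exact: annihilation_set_disjoint.
  rewrite pr_bigcup //; last first.
    move=> i j y [/any_static_setP[b h] _] [/any_static_setP[b' h'] _].
    by have [] := static_arrival_inj (good_configuration y) h h'.
  suff -> : \sum_(i < n.+1) pr (any_static_set 0 i `&` arrival_set i.+1 n.+1) =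
    p / 2 * conv (conv arrival_prob arrival_prob) arrival_prob n.+1 by move=> /= ->; lra.
  have -> (u : nat -> R) : conv u arrival_prob n.+1 = \sum_(i < n.+1) u i * arrival_prob (n.+1 - i)%N.
    by rewrite /conv big_ord_recr /= subnn mulr0 addr0.
  rewrite mulr_sumr; apply: eq_bigr => i _; rewrite (@pr_indep 0 i n.+1); last 1 first.
  + exact: depends_on_arrival_set.
  + by rewrite pr_any_static_set pr_arrival_set subSS mulrA.
  + exact: measurable_any_static_set.
  + exact: measurable_arrival_set.
  + exact: depends_on_any_static_set.
- exact: measurable_velocity_set.
- exact: measurable_arrival_set.
- exact: depends_on_velocity_set.
Qed.

End Recurrence.

(** * Generating series *)

Section CauchyProduct.
Context {R : realType}.
Implicit Types (u w : nat -> R).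

Definition psum u n := \sum_(i < n) u i.

Lemma psumS u n : psum u n.+1 = psum u n + u n.
Proof. by rewrite /psum big_ord_recr. Qed.

Lemma psum0 u : psum u 0 = 0.
Proof. by rewrite /psum big_ord0. Qed.

Lemma psum_conv u w n : psum (conv u w) n = \sum_(i < n) u i * psum w (n - i)%N.
Proof.
elim: n => [|n IH]; first by rewrite psum0 big_ord0.
rewrite psumS IH /conv [in RHS]big_ord_recr /= subSnn psumS psum0 add0r.
rewrite big_ord_recr /= subnn addrA -big_split /=; congr (_ + _).
by apply: eq_bigr => i _; rewrite -mulrDr subSn ?psumS // ltnW.
Qed.

Lemma psum_nneg_le u : (forall n, 0 <= u n) -> {homo psum u : m n / (m <= n)%N >-> m <= n}.
Proof.
move=> u0 m n /subnK <-; elim: (n - m)%N => // k IH.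
by rewrite addSn psumS (le_trans IH) // lerDl.
Qed.

Lemma psum_norm_sub w m n : (m <= n)%N ->
  `|psum w n - psum w m| <= psum (Num.norm \o w) n - psum (Num.norm \o w) m.
Proof.
move=> /subnK <-; elim: (n - m)%N => [|k IH]; first by rewrite !subrr normr0.
rewrite addSn !psumS /= addrAC [X in _ <= X]addrAC.
by rewrite (le_trans (ler_normD _ _)) // lerD2r.
Qed.

(** The missing products [u i * w j], with [i, j < n <= i + j], are bounded by their absolute
    values. *)
Lemma conv_defect u w n :
  `|psum u n * psum w n - psum (conv u w) n| <=
  psum (Num.norm \o u) n * psum (Num.norm \o w) n - psum (conv (Num.norm \o u) (Num.norm \o w)) n.
Proof.
rewrite !psum_conv {1 3}/psum !mulr_suml -!sumrB.
apply: le_trans (ler_norm_sum _ _ _) _; apply: ler_sum => i _.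
rewrite -!mulrBr normrM; apply: ler_wpM2l => //.
by apply: psum_norm_sub; rewrite leq_subr.
Qed.

(** The square [i, j < n./2] lies inside the triangle [i + j < n]. *)
Lemma conv_half u w n : (forall k, 0 <= u k) -> (forall k, 0 <= w k) ->
  psum u n./2 * psum w n./2 <= psum (conv u w) n.
Proof.
move=> u0 w0; rewrite psum_conv {1}/psum mulr_suml.
have le : (n./2 <= n)%N by lia.
rewrite (big_ord_widen _ (fun i => u i * psum w n./2) le) big_mkcond /=.
apply: ler_sum => i _; case: ifP => [ih|_].
  by apply: ler_wpM2l => //; apply: psum_nneg_le => //; lia.
by apply: mulr_ge0 => //; rewrite /psum sumr_ge0.
Qed.

Definition abs_sums u (U : R) :=
  psum u n @[n --> \oo] --> U /\ exists M, forall n, psum (Num.norm \o u) n <= M.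

Lemma half_cvg : n./2 @[n --> \oo] --> \oo.
Proof.
apply/cvgnyPge => A; exists (A.*2)%N => // n /=; lia.
Qed.

Lemma psum_abs_cvg u (M : R) : (forall n, psum (Num.norm \o u) n <= M) ->
  exists l : R, psum (Num.norm \o u) n @[n --> \oo] --> l.
Proof.
move=> uM; suff : cvgn (psum (Num.norm \o u)) by move=> c; exists (limn (psum (Num.norm \o u))).
apply: nondecreasing_is_cvgn.
  by move=> m n mn; apply: psum_nneg_le => // k; exact: normr_ge0.
by exists M => _ [n _ <-].
Qed.

Lemma abs_sums_conv u w U W : abs_sums u U -> abs_sums w W ->
  abs_sums (conv u w) (U * W).
Proof.
move=> [cu [Mu hu]] [cw [Mw hw]].
have u0 k : 0 <= (Num.norm \o u) k by exact: normr_ge0.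
have w0 k : 0 <= (Num.norm \o w) k by exact: normr_ge0.
have [lu clu] := psum_abs_cvg hu; have [lw clw] := psum_abs_cvg hw.
split; last first.
  exists (Mu * Mw) => n.
  have le : psum (Num.norm \o conv u w) n <= psum (conv (Num.norm \o u) (Num.norm \o w)) n.
    apply: ler_sum => i _; apply: le_trans (ler_norm_sum _ _ _) _.
    by apply: ler_sum => j _; rewrite normrM.
  apply: (le_trans le); rewrite psum_conv.
  apply: (@le_trans _ _ (psum (Num.norm \o u) n * psum (Num.norm \o w) n)).
    rewrite [X in _ <= X * _]/psum mulr_suml; apply: ler_sum => i _; apply: ler_wpM2l => //.
    by apply: psum_nneg_le => //; rewrite leq_subr.
  by apply: ler_pM => //; rewrite /psum sumr_ge0.
(* The defect is at most the difference of these products at [n] and [n./2], which have the same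
   limit. *)
have cd : psum (Num.norm \o u) n * psum (Num.norm \o w) n -
    psum (Num.norm \o u) n./2 * psum (Num.norm \o w) n./2 @[n --> \oo] --> 0.
  rewrite -(subrr (lu * lw)); apply: cvgB; first exact: cvgM.
  by apply: cvgM; [exact: (cvg_comp _ _ half_cvg clu)|exact: (cvg_comp _ _ half_cvg clw)].
have c0 : psum u n * psum w n - psum (conv u w) n @[n --> \oo] --> 0.
  apply/cvgr0Pnorm_le => e e0.
  move/cvgr0Pnorm_le : cd => /(_ e e0) [N _ hN].
  exists N => // n /= Nn; have := hN n Nn => /= h.
  apply: le_trans (conv_defect u w n) _; apply: le_trans _ h.
  by apply: le_trans _ (ler_norm _); rewrite lerD2l lerN2 conv_half.
have -> : psum (conv u w) = fun n => psum u n * psum w n - (psum u n * psum w n - psum (conv u w) n).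
  by apply/funext => n; rewrite subKr.
rewrite -[U * W]subr0; apply: cvgB => //; exact: cvgM.
Qed.

Lemma abs_sums_lin u w U W (a b : R) : abs_sums u U -> abs_sums w W ->
  abs_sums (fun n => a * u n + b * w n) (a * U + b * W).
Proof.
move=> [cu [Mu hu]] [cw [Mw hw]].
have e (u' w' : nat -> R) (a' b' : R) n :
    psum (fun n => a' * u' n + b' * w' n) n = a' * psum u' n + b' * psum w' n.
  by rewrite /psum big_split /= !mulr_sumr.
split.
  rewrite (_ : psum _ = fun n => a * psum u n + b * psum w n); last by apply/funext => n; rewrite e.
  by apply: cvgD; apply: cvgM => //; exact: cvg_cst.
exists (`|a| * Mu + `|b| * Mw) => n.
apply: (@le_trans _ _ (psum (fun n => `|a| * (Num.norm \o u) n + `|b| * (Num.norm \o w) n) n)).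
  by apply: ler_sum => i _; rewrite (le_trans (ler_normD _ _)) // !normrM.
by rewrite e lerD // ler_wpM2l.
Qed.

Lemma abs_sums_shift u U : u 0%N = 0 -> abs_sums (fun n => u n.+1) U -> abs_sums u U.
Proof.
move=> u0 [cu [M hu]].
have e (u' : nat -> R) n : u' 0%N = 0 -> psum u' n.+1 = psum (fun n => u' n.+1) n.
  by move=> h; rewrite /psum big_ord_recl h add0r.
split.
  rewrite -(cvg_shiftS (psum u)) /=.
  by rewrite (_ : (fun n => psum u n.+1) = psum (fun n => u n.+1)) //; apply/funext => n; rewrite e.
exists M => -[|n]; last by rewrite e //= u0 normr0.
by rewrite psum0; have := hu 0%N; rewrite psum0.
Qed.

Lemma conv_geometric u w z n :
  conv (fun n => u n * z ^+ n) (fun n => w n * z ^+ n) n = conv u w n * z ^+ n.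
Proof.
rewrite /conv mulr_suml; apply: eq_bigr => i _.
have i_n : (i <= n)%N by rewrite -ltnS.
have -> : z ^+ n = z ^+ i * z ^+ (n - i) by rewrite -exprD subnKC.
ring.
Qed.

Lemma generating_equation (p z f : R) (a g : nat -> R) :
  a 0%N = 0 -> g 0%N = 0 ->
  (forall n, a n.+1 = (if n == 0%N then (1 - p) / 2 else 0) +
     3 * p / 2 * conv a a n + conv g a n.+1) ->
  (forall n, g n.+1 = (1 - p) / 2 * a n - p / 2 * conv (conv a a) a n) ->
  abs_sums (fun n => a n * z ^+ n) f ->
  p * z * f ^+ 4 - (1 + 2 * p) * z * f ^+ 2 + 2 * f - (1 - p) * z = 0.
Proof.
move=> a0 g0 ha hg sa.
pose A n := a n * z ^+ n; pose B n := g n * z ^+ n.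
have sC := abs_sums_conv sa sa; have sCC := abs_sums_conv sC sa.
have sB : abs_sums B ((1 - p) / 2 * z * f + - (p / 2 * z) * (f * f * f)).
  apply: abs_sums_shift; first by rewrite /B g0 mul0r.
  have := abs_sums_lin ((1 - p) / 2 * z) (- (p / 2 * z)) sa sCC.
  rewrite (_ : (fun n => B n.+1) = fun n => (1 - p) / 2 * z * (a n * z ^+ n) +
    - (p / 2 * z) * conv (conv A A) A n) //.
  apply/funext => n; rewrite /B hg exprS.
  have -> : conv (conv A A) A n = conv (conv a a) a n * z ^+ n.
    rewrite -conv_geometric; congr (conv _ _ n); apply/funext => k.
    exact: conv_geometric.
  ring.
have sD := abs_sums_conv sB sa.
(* The recurrence summed over the indices 1 to [n.+1]; [A] and [conv B A] vanish at index 0. *)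
have e n : psum A n.+2 = (1 - p) / 2 * z + 3 * p / 2 * z * psum (conv A A) n.+1 +
    psum (conv B A) n.+2.
  have step k : A k.+1 = (if k == 0%N then (1 - p) / 2 * z else 0) +
      3 * p / 2 * z * conv A A k + conv B A k.+1.
    rewrite /A ha !conv_geometric exprS; case: eqP => [->|_]; rewrite ?expr0; ring.
  have A0 : A 0%N = 0 by rewrite /A a0 mul0r.
  have D0 : conv B A 0%N = 0 by rewrite /conv big_ord1 /= A0 mulr0.
  elim: n => [|n IH].
    by rewrite !psumS !psum0 A0 D0 (step 0%N) /=; ring.
  rewrite psumS IH step /= [psum (conv A A) n.+2]psumS [psum (conv B A) n.+3]psumS; ring.
have : f = (1 - p) / 2 * z + 3 * p / 2 * z * (f * f) +
    ((1 - p) / 2 * z * f + - (p / 2 * z) * (f * f * f)) * f.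
  apply: (@cvg_unique _ _ (psum A n.+2 @[n --> \oo])) => //.
    case: sa => + _; rewrite -(cvg_shiftS (psum A)) -(cvg_shiftS (fun n => psum A n.+1)).
    exact.
  rewrite (_ : (fun n => psum A n.+2) = fun n => (1 - p) / 2 * z +
     3 * p / 2 * z * psum (conv A A) n.+1 + psum (conv B A) n.+2); last exact/funext.
  apply: cvgD; first apply: cvgD; first exact: cvg_cst.
    by apply: cvgM; [exact: cvg_cst|case: sC => + _; rewrite -(cvg_shiftS (psum (conv A A)))].
  case: sD => + _; rewrite -(cvg_shiftS (psum (conv B A))).
  rewrite -(cvg_shiftS (fun n => psum (conv B A) n.+1)); exact.
move=> h; have h2 : 2 * f - 2 * ((1 - p) / 2 * z + 3 * p / 2 * z * (f * f) +
    ((1 - p) / 2 * z * f + - (p / 2 * z) * (f * f * f)) * f) = 0 by rewrite -h subrr.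
by rewrite -h2; field.
Qed.

(** The system is triangular: in [conv g a n.+1] the two extreme terms contain [a 0] or [g 0], which
    vanish, so only smaller indices occur. *)
Lemma recurrence_unique (p : R) (a g a' g' : nat -> R) :
  a 0%N = 0 -> g 0%N = 0 -> a' 0%N = 0 -> g' 0%N = 0 ->
  (forall n, a n.+1 = (if n == 0%N then (1 - p) / 2 else 0) +
     3 * p / 2 * conv a a n + conv g a n.+1) ->
  (forall n, g n.+1 = (1 - p) / 2 * a n - p / 2 * conv (conv a a) a n) ->
  (forall n, a' n.+1 = (if n == 0%N then (1 - p) / 2 else 0) +
     3 * p / 2 * conv a' a' n + conv g' a' n.+1) ->
  (forall n, g' n.+1 = (1 - p) / 2 * a' n - p / 2 * conv (conv a' a') a' n) ->
  a =1 a'.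
Proof.
move=> a0 g0 a0' g0' ha hg ha' hg'.
suff h n : forall k, (k <= n)%N -> a k = a' k /\ g k = g' k.
  by move=> n; have [] := h n n (leqnn n).
elim: n => [|n IH] k; first by rewrite leqn0 => /eqP->; rewrite a0 a0' g0 g0'.
rewrite leq_eqVlt => /orP[/eqP->|]; last by rewrite ltnS; exact: IH.
have cE (u w u' w' : nat -> R) m : (m <= n)%N -> (forall k, (k <= n)%N -> u k = u' k) ->
    (forall k, (k <= n)%N -> w k = w' k) -> conv u w m = conv u' w' m.
  move=> mn hu hw; apply: eq_bigr => i _; have := ltn_ord i; rewrite ltnS => im.
  by rewrite hu ?hw //; lia.
have aE k' (h : (k' <= n)%N) := proj1 (IH k' h).
have gE : g n.+1 = g' n.+1.
  rewrite hg hg' aE // (cE _ _ (conv a' a') a') // => k' hk.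
  exact: cE.
split=> //; rewrite ha ha' (cE a a a' a') //; congr (_ + _).
apply: eq_bigr => -[[|i] /= i_n] _; first by rewrite g0 g0' !mul0r.
rewrite subSS; have [->|ni] := eqVneq i n; first by rewrite subnn a0 a0' !mulr0.
by rewrite aE ?(proj2 (IH _ _)) //; lia.
Qed.

End CauchyProduct.

(** * The ballistic model *)

Section Probability.
Context d (T : measurableType d) (R : realType) (P : probability T R).

Lemma full_setC0 (A : set T) : measurable A -> P A = 1%E -> P (~` A) = 0%E.
Proof. by move=> mA h; rewrite probability_setC // h subee. Qed.

Lemma full_ae (A : set T) : measurable A -> P A = 1%E -> \forall w \ae P, A w.
Proof.
by move=> mA h; apply/(negligibleP _ (measurableC mA)); exact: full_setC0.
Qed.

Lemma ae_full (A : set T) : measurable A -> (\forall w \ae P, A w) -> P A = 1%E.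
Proof.
move=> mA h; have : P (~` A) = 0%E by apply/negligibleP => //; exact: measurableC.
rewrite probability_setC // => e.
have fA : P A \is a fin_num by rewrite fin_num_measure.
move: e; rewrite -(fineK fA) -EFinB => -[e]; congr EFin; lra.
Qed.

Lemma full_setI (A B : set T) : measurable A -> measurable B -> P A = 1%E ->
  P (A `&` B) = P B.
Proof.
move=> mA mB h; rewrite [RHS](measureDI P mB mA) setIC.
rewrite [X in (X + _)%E](_ : _ = 0%E) ?add0e //.
apply: (@subset_measure0 _ _ _ _ _ (~` A)); last exact: full_setC0.
- exact: measurableD.
- exact: measurableC.
- by move=> w [].
Qed.

(** The three atoms carry the full mass, so the law is a combination of Dirac masses. Spins are
    treated likewise, with mass 0 at 0. *)
Lemma atoms_law (V : T -> R) (a b c : R) : measurable_fun setT V ->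
  P (V @^-1` [set -1]) = a%:E -> P (V @^-1` [set 0]) = b%:E ->
  P (V @^-1` [set 1]) = c%:E -> a + b + c = 1 ->
  forall B, measurable B ->
  P (V @^-1` B) = (a * \1_B (-1) + b * \1_B 0 + c * \1_B 1)%:E.
Proof.
move=> mV ha hb hc abc B mB.
have mV' (C : set R) : measurable C -> measurable (V @^-1` C).
  by move=> mC; rewrite -[_ @^-1` _]setTI; exact: mV.
have dis (u u' : R) (C C' : set R) : u <> u' ->
    V @^-1` ([set u] `&` C) `&` V @^-1` ([set u'] `&` C') = set0.
  by move=> ne; apply/seteqP; split=> w // -[[/= h _] [/= h' _]]; apply: ne; rewrite -h -h'.
have q (u : R) (e : R) : P (V @^-1` [set u]) = e%:E ->
    P (V @^-1` ([set u] `&` B)) = (e * \1_B u)%:E.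
  move=> he; rewrite indicE; case: (boolP (u \in B)) => uB.
    rewrite mulr1 -he; congr (P _); apply/seteqP; split=> w /=; first by case.
    by move=> e'; split=> //; rewrite e'; apply: set_mem.
  rewrite mulr0; transitivity (P set0); last exact: measure0. congr (P _); apply/seteqP; split=> w //= -[e' Bw].
  by move: uB; rewrite notin_setE; apply; rewrite -e'.
pose D C := V @^-1` ([set -1] `&` C) `|` V @^-1` ([set 0] `&` C) `|` V @^-1` ([set 1] `&` C).
have m1 u C : measurable C -> measurable (V @^-1` ([set u] `&` C)).
  by move=> mC; apply: mV'; apply: measurableI.
have mD C : measurable C -> measurable (D C).
  by move=> mC; apply: measurableU; [apply: measurableU|]; exact: m1.
have PD C : measurable C -> P (D C) = (P (V @^-1` ([set (-1)%R] `&` C)) +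
    P (V @^-1` ([set 0%R] `&` C)) + P (V @^-1` ([set 1%R] `&` C)))%E.
  move=> mC; rewrite measureU; last 3 first.
  - by apply: measurableU; exact: m1.
  - exact: m1.
  - by rewrite setIUl !dis ?setU0 //; lra.
  rewrite measureU //; try exact: m1.
  by apply: dis; lra.
have D1 : P (D setT) = 1%E.
  by rewrite PD // !setIT ha hb hc -!EFinD abc.
have -> : V @^-1` B = (D B) `|` (V @^-1` B `\` D setT).
  apply/seteqP; split=> w /=.
    move=> Bw; have [h|h] := pselect (D setT w); last by right.
    by left; case: h => [[[e _]|[e _]]|[e _]]; [left; left|left; right|right].
  by move=> [[[[]|[]]|[]]|[]].
have n0 : P (V @^-1` B `\` D setT) = 0%E.
  apply: (@subset_measure0 _ _ _ _ _ (~` D setT)).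
  - by apply: measurableD; [exact: mV'|exact: mD].
  - by apply: measurableC; exact: mD.
  - by move=> w [].
  - by apply: full_setC0 => //; exact: mD.
have mR : measurable (V @^-1` B `\` D setT) by apply: measurableD; [exact: mV'|exact: mD].
transitivity (P (D B)); first exact: (measureU0 (mD _ mB) mR n0).
by rewrite PD // (q _ _ ha) (q _ _ hb) (q _ _ hc) !EFinD.
Qed.

End Probability.

Lemma indic_preim {R : realType} (f : R -> R) (B : set R) u :
  \1_(f @^-1` B) u = \1_B (f u) :> R.
Proof. by rewrite !indicE; congr (_%:R); apply/idP/idP; rewrite !inE. Qed.

(** * From the model to a ballistic family *)

Section Model.
Context {R : realType} (p : R) d (T : measurableType d) (P : probability T R).
Context (m : probability (measurableTypeR R) R) (x v s : nat -> {RV P >-> R}).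
Hypothesis bm : ballistic_model p m x v s.

Definition model_family (i : coord) : T -> R :=
  match i with
  | inl n => interdistance x n | inr (inl n) => v n | inr (inr n) => s n
  end.

Let RVm (X : {RV P >-> R}) : measurable_fun setT (X : T -> R).
Proof. exact: measurable_funPT. Qed.

Let RVset (X : {RV P >-> R}) (B : set R) : measurable B -> measurable (X @^-1` B : set T).
Proof. by move=> mB; rewrite -[_ @^-1` _]setTI; exact: RVm. Qed.

Lemma measurable_interdistance n : measurable_fun setT (interdistance x n).
Proof.
case: n => [|n]; first exact: RVm.
by apply: measurable_funB; exact: RVm.
Qed.

Lemma interdistance_set n (B : set R) : measurable B ->
  measurable (interdistance x n @^-1` B : set T).
Proof. by move=> mB; rewrite -[_ @^-1` _]setTI; exact: measurable_interdistance. Qed.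

Lemma spin0_null n : P (s n @^-1` [set 0]) = 0%:E.
Proof.
case: bm => _ _ _ hs _; have [h1 h2] := hs n.
pose A := s n @^-1` [set -1] `|` s n @^-1` [set 1].
have mA : measurable A by apply: measurableU; exact: RVset.
have PA : P A = 1%E.
  transitivity (P (s n @^-1` [set (-1)%R]) + P (s n @^-1` [set 1%R]))%E.
    apply: measureU; [exact: RVset|exact: RVset|].
    by apply/seteqP; split=> w // -[/= e e']; move: e'; rewrite e; lra.
  by rewrite h1 h2 -EFinD; congr EFin; lra.
apply: (@subset_measure0 _ _ _ _ _ (~` A)).
- exact: RVset.
- exact: measurableC.
- by move=> w /= e [] /=; rewrite e; lra.
- exact: full_setC0.
Qed.

Lemma vel_law n (B : set R) : measurable B ->
  P (v n @^-1` B) = ((1 - p) / 2 * \1_B (-1) + p * \1_B 0 + (1 - p) / 2 * \1_B 1)%:E.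
Proof.
case: bm => _ _ hv _ _; have [h0 hN h1] := hv n.
by apply: (atoms_law _ hN h0 h1); [exact: RVm|lra].
Qed.

Lemma spin_law n (B : set R) : measurable B ->
  P (s n @^-1` B) = (1 / 2 * \1_B (-1) + 0 * \1_B 0 + 1 / 2 * \1_B 1)%:E.
Proof.
case: bm => _ _ _ hs _; have [hN h1] := hs n.
by apply: (atoms_law _ hN (spin0_null n) h1); [exact: RVm|lra].
Qed.

Lemma model_ballistic_family : ballistic_family p P model_family.
Proof.
have [_ hg hv hs hi] := bm.
split=> //.
- by case=> [n|[n|n]]; [exact: measurable_interdistance|exact: RVm|exact: RVm].
- by move=> n k B mB /=; rewrite !hg.
- by move=> n k B mB /=; rewrite !vel_law.
- move=> n B mB /=.
  have mB' : measurable (-%R @^-1` B : set R).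
    by rewrite -[_ @^-1` _]setTI; apply: (measurable_mirror_fun (inr (inl 0%N))).
  rewrite -[P _]/(P (v n @^-1` (-%R @^-1` B))) !vel_law //; congr EFin.
  rewrite (indic_preim -%R B (-1)) (indic_preim -%R B 0) (indic_preim -%R B 1).
  by rewrite opprK oppr0; lra.
- by move=> n k B mB /=; rewrite !spin_law.
- move=> n B mB /=.
  have mB' : measurable (@flip_spin R @^-1` B : set R).
    by rewrite -[_ @^-1` _]setTI; apply: measurable_flip_spin.
  rewrite -[P _]/(P (s n @^-1` (@flip_spin R @^-1` B))) !spin_law //; congr EFin.
  rewrite (indic_preim (@flip_spin R) B (-1)) (indic_preim (@flip_spin R) B 1).
  rewrite /flip_spin eqxx.
  by case: eqP => [|_]; lra.
- by move=> n; case: (hv n).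
- by move=> n; case: (hv n).
Qed.

End Model.

(** * Almost every configuration is well-posed *)

Section WellPosed.
Context {R : realType} (p : R) d (T : measurableType d) (P : probability T R).
Context (m : probability (measurableTypeR R) R) (x v s : nat -> {RV P >-> R}).
Hypothesis bm : ballistic_model p m x v s.

Let RVm (X : {RV P >-> R}) : measurable_fun setT (X : T -> R).
Proof. exact: measurable_funPT. Qed.

Let RVset (X : {RV P >-> R}) (B : set R) : measurable B -> measurable (X @^-1` B : set T).
Proof. by move=> mB; rewrite -[_ @^-1` _]setTI; exact: RVm. Qed.

Let gap n := interdistance x n.

Lemma position_sum n w : x n w = \sum_(0 <= i < n.+1) gap i w.
Proof.
elim: n => [|n IH]; first by rewrite big_nat1.
by rewrite big_nat_recr //= -IH /gap /=; lra.
Qed.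

Definition wp_set : set T := [set w | well_posed (x ^~ w) (v ^~ w) (s ^~ w)].

Let gpos n := gap n @^-1` [set r | 0 < r].
Let unbounded k := \bigcup_n (x n @^-1` [set r | k%:R < r]).
Let vok n := v n @^-1` [set -1] `|` v n @^-1` [set 0] `|` v n @^-1` [set 1].
Let sok n := s n @^-1` [set -1] `|` s n @^-1` [set 1].

Let pos_itv : [set r : R | 0 < r] = `]0, +oo[%classic.
Proof. by apply/seteqP; split=> r /=; rewrite in_itv /= andbT. Qed.

Let gt_itv (k : R) : [set r : R | k < r] = `]k, +oo[%classic.
Proof. by apply/seteqP; split=> r /=; rewrite in_itv /= andbT. Qed.

Let m_gpos n : measurable (gpos n).
Proof. by apply: interdistance_set; rewrite pos_itv; exact: measurable_itv. Qed.

Let m_unbounded k : measurable (unbounded k).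
Proof.
by apply: bigcup_measurable => n _; apply: RVset; rewrite gt_itv; exact: measurable_itv.
Qed.

Let m_vok n : measurable (vok n).
Proof. by apply: measurableU; [apply: measurableU|]; exact: RVset. Qed.

Let m_sok n : measurable (sok n).
Proof. by apply: measurableU; exact: RVset. Qed.

(** For increasing positions, divergence amounts to unboundedness, a countable and hence measurable
    condition. *)
Lemma wp_setE : wp_set = \bigcap_n gpos n `&` \bigcap_k unbounded k `&`
  \bigcap_n vok n `&` \bigcap_n sok n.
Proof.
apply/seteqP; split=> w.
  move=> -[[x0 xS] xoo vv ss]; split; first split; first split.
  - by case=> [|n] _ //=; rewrite /gpos /gap /= subr_gt0.
  - move=> k _; have /cvgryPgt/(_ k%:R)[N _ hN] := xoo.
    by exists N => //; exact: (hN N (leqnn N)).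
  - by move=> n _; case: (vv n) => h; [left; left|left; right|right].
  - by move=> n _; case: (ss n) => h; [left|right].
move=> [[[hg hu] hv] hs].
have xS n : x n w < x n.+1 w by have := hg n.+1 I; rewrite /gpos /gap /= subr_gt0.
have xmono i j : (i <= j)%N -> x i w <= x j w.
  move=> /subnK <-; elim: (j - i)%N => // k IH.
  by rewrite addSn (le_trans IH) // ltW.
split.
- by split=> //; exact: (hg 0%N I).
- apply/cvgryPgt => A; have A0 : 0 <= `|A| by exact: normr_ge0.
  have hA := archi_boundP A0.
  have [N _ hN] := hu (Num.Def.archi_bound `|A|) I.
  exists N => // n /= Nn; apply: lt_le_trans (xmono _ _ Nn).
  by apply: le_lt_trans hN; apply: le_trans (ltW hA); exact: ler_norm.
- by move=> n; case: (hv n I) => [[h|h]|h]; [exact: Or31|exact: Or32|exact: Or33].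
- by move=> n; case: (hs n I) => h; [left|right].
Qed.

Lemma measurable_wp_set : measurable wp_set.
Proof.
rewrite wp_setE; apply: measurableI; last exact: bigcapT_measurable.
apply: measurableI; last exact: bigcapT_measurable.
by apply: measurableI; exact: bigcapT_measurable.
Qed.

Let gap_law n (B : set R) : measurable B -> P (gap n @^-1` B) = m B.
Proof. by case: bm => _ h _ _ _; exact: h. Qed.

Let half_line (e : R) : measurable [set r : R | r < e].
Proof.
rewrite (_ : [set r | r < e] = `]-oo, e[%classic); first exact: measurable_itv.
by apply/seteqP; split=> r /=; rewrite in_itv.
Qed.

(** Otherwise all half-lines starting at [1 / (k + 1)] would be null for [m], and so would their
    union, the positive half-line. *)
Lemma gap_threshold : exists e : R, 0 < e /\ (m [set r : R | (r < e)%R] < 1)%E.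
Proof.
apply: contrapT => n.
have h k : m [set r : R | k.+1%:R^-1 <= r] = 0%E.
  have -> : [set r : R | k.+1%:R^-1 <= r] = ~` [set r : R | r < k.+1%:R^-1].
    by apply/seteqP; split=> r /=; rewrite leNgt => /negP.
  apply: full_setC0; first exact: half_line.
  apply/eqP; rewrite eq_le probability_le1 /=; last exact: half_line.
  rewrite leNgt; apply/negP => lt; apply: n; exists k.+1%:R^-1.
  by split=> //; rewrite invr_gt0.
have mge (e : R) : measurable [set r : R | e <= r].
  have -> : [set r : R | e <= r] = ~` [set r : R | r < e].
    by apply/seteqP; split=> r /=; rewrite leNgt => /negP.
  by apply: measurableC; exact: half_line.
have [m1 _ _ _ _] := bm.
have nb : m.-negligible (\bigcup_k [set r : R | k.+1%:R^-1 <= r]).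
  by apply: negligible_bigcup => k; apply/negligibleP; [exact: mge|exact: h].
have : m.-negligible [set r : R | 0 < r].
  apply: negligibleS nb => r /= r0; exists (Num.Def.archi_bound r^-1) => //=.
  rewrite -[leRHS]invrK lef_pV2 ?posrE ?invr_gt0 //.
  have := archi_boundP (_ : 0 <= r^-1); rewrite invr_ge0 => /(_ (ltW r0)) h'.
  by apply: le_trans (ltW h') _; rewrite ler_nat.
have mpos : measurable ([set r : R | 0 < r] : set (measurableTypeR R)).
  by rewrite pos_itv; exact: measurable_itv.
move=> /(measure_negligible mpos) e0.
have : 1%E = 0%E :> \bar R by rewrite -m1; exact: e0.
by move/eqP; rewrite onee_eq0.
Qed.

(** Infinitely many gaps of size at least [e] make the positions diverge. By independence, all gaps
    from [n] on are below [e] with probability at most [q ^+ N] for every [N], where [q < 1]. *)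
Lemma gap_recurrent : exists2 e : R, 0 < e &
  \forall w \ae P, forall n, exists2 i, (n <= i)%N & e <= gap i w.
Proof.
have [e [e0 he]] := gap_threshold; exists e => //.
apply: ae_foralln => n.
pose B := [set r : R | r < e]; have mB : measurable B by exact: half_line.
pose A := \bigcap_i (gap (n + i) @^-1` B).
have mA : measurable A by apply: bigcapT_measurable => i; exact: interdistance_set.
pose q := fine (m B).
have qE : m B = q%:E by rewrite fineK // fin_num_measure.
have q0 : 0 <= q by exact: fine_ge0.
have q1 : q < 1 by rewrite -lte_fin -qE.
have bound N : (P A <= (q ^+ N)%:E)%E.
  pose J : seq coord := [seq inl i | i <- iota n N].
  pose C (i : coord) : set R := if i is inl _ then B else setT.
  have [_ _ _ _ hi] := bm.
  have uJ : uniq J by rewrite map_inj_uniq ?iota_uniq // => i j [].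
  have mC i : measurable (C i) by rewrite /C; case: i => // k; exact: measurableT.
  have := hi J C uJ mC.
  rewrite big_map (eq_bigr (fun=> q%:E)); last by move=> i _; rewrite -qE -(gap_law i).
  rewrite big_const_seq count_predT size_iota.
  have -> : iter N (mule q%:E) 1%E = (q ^+ N)%:E.
    by elim: N {J uJ} => [|N IH] //=; rewrite IH exprS EFinM.
  move=> <-; apply: le_measure; rewrite ?inE //.
    have -> : \bigcap_(i in [set` J]) ((fun i : coord => match i with
        | inl n => interdistance x n | inr (inl n) => v n | inr (inr n) => s n
        end) i @^-1` C i) = \bigcap_(i in [set` iota n N]) (gap i @^-1` B).
      apply/seteqP; split=> w /= hw i /=.
        by move=> iN; apply: (hw (inl i)); rewrite /= mem_map // => ? ? [].
      by move=> /mapP[j jN ->]; exact: hw.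
    rewrite bigcap_seq; apply: bigsetI_measurable => i _; exact: interdistance_set.
  move=> w hw i /= /mapP[j]; rewrite mem_iota => /andP[nj _] ->.
  by have := hw (j - n)%N I; rewrite subnKC.
have PA : P A = 0%E.
  have fA : P A \is a fin_num by rewrite fin_num_measure.
  have c0 : 0 <= fine (P A) by exact: fine_ge0.
  apply/eqP; rewrite -(fineK fA) eqe eq_le c0 andbT leNgt; apply/negP => cp.
  have q1' : `|q| < 1 by rewrite ger0_norm.
  have /cvgr0Pnorm_lt/(_ _ cp)[N _ hN] := cvg_expr q1'.
  have := hN N (leqnn N); have := bound N; rewrite -(fineK fA) lee_fin /=.
  rewrite ger0_norm ?exprn_ge0 //; lra.
have PC : P (~` A) = 1%E by rewrite probability_setC // PA sube0.
have := full_ae (measurableC mA) PC; apply: filterS => w nA; apply: contrapT => h; apply: nA => i _.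
rewrite /B /= ltNge; apply/negP => le; apply: h; exists (n + i)%N => //.
by rewrite leq_addr.
Qed.

Lemma wp_set_full : P wp_set = 1%E.
Proof.
apply: ae_full; first exact: measurable_wp_set.
have [m1 _ _ _ _] := bm.
have [e e0 h2] := gap_recurrent.
have h1 : \forall w \ae P, forall n, gpos n w.
  apply: ae_foralln => n; apply: full_ae => //.
  by rewrite /gpos gap_law // pos_itv; exact: measurable_itv.
have ind (D : set R) u : D u -> \1_D u = 1 :> R by move=> Du; rewrite indicE mem_set.
have h3 : \forall w \ae P, forall n, vok n w.
  apply: ae_foralln => n; apply: full_ae => //.
  rewrite /vok -!preimage_setU (vel_law bm); last first.
    by apply: measurableU; first apply: measurableU; exact: measurable_set1.
  rewrite !ind; [congr EFin; lra|by right|by left; right|by left; left].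
have h4 : \forall w \ae P, forall n, sok n w.
  apply: ae_foralln => n; apply: full_ae => //.
  rewrite /sok -!preimage_setU (spin_law bm); last first.
    by apply: measurableU; exact: measurable_set1.
  rewrite (ind _ (-1)); last by left.
  rewrite (ind _ 1); last by right.
  congr EFin; lra.
apply: filterS (filterI (filterI h1 h2) (filterI h3 h4)).
move=> w [[g1 g2] [g3 g4]]; rewrite wp_setE; split; last by move=> n _; exact: g4.
split; last by move=> n _; exact: g3.
split; first by move=> n _; exact: g1.
  move=> k _; have xmono i j : (i <= j)%N -> x i w <= x j w.
    move=> /subnK <-; elim: (j - i)%N => // l IH.
    rewrite addSn (le_trans IH) // -subr_ge0; apply: ltW; exact: (g1 (l + i).+1).
  have far K : exists n, K%:R * e <= x n w.
    elim: K => [|K [n hn]]; first by exists 0%N; rewrite mul0r; apply: ltW; exact: (g1 0%N).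
    have [[//|i] ni gi] := g2 n.+1; exists i.+1.
    have := xmono n i ni; move: gi; rewrite /gap /=; rewrite -[K.+1]addn1 natrD mulrDl mul1r; lra.
  have ke0 : 0 <= k%:R / e by rewrite divr_ge0 // ltW.
  have [n hn] := far (Num.Def.archi_bound (k%:R / e)); exists n => //=.
  apply: lt_le_trans hn; rewrite -ltr_pdivrMr //; exact: archi_boundP.
Qed.

End WellPosed.

(** * The law of the first arrival and its generating series *)

Section ArrivalLaw.
Context {R : realType} (p : R) d (T : measurableType d) (P : probability T R).
Context (m : probability (measurableTypeR R) R) (x v s : nat -> {RV P >-> R}).
Hypothesis bm : ballistic_model p m x v s.

Local Notation Y := (model_family x v s).
Local Notation wp := (wp_set x v s).
Local Notation A := (arrival_index x v s).
Local Notation a := (arrival_prob P Y).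

Let bY := model_ballistic_family bm.

Lemma well_posed_config w : wp w ->
  [/\ config_x (fun c => Y c w) = x ^~ w, config_v (fun c => Y c w) = v ^~ w
    & config_s (fun c => Y c w) = s ^~ w].
Proof.
move=> [[x0 xS] _ vv ss]; split; apply/funext => n.
- rewrite position_sum /config_x; apply: eq_bigr => i _; rewrite /norm_gap /=.
  suff -> : 0 < interdistance x i w by [].
  by case: i => [|i] //=; rewrite subr_gt0.
- by rewrite /config_v /norm_vel /=; case: (vv n) => ->; case: ifP => //; rewrite eqxx ?orbT.
- rewrite /config_s /norm_spin /=; case: (ss n) => ->; last by rewrite eqxx.
  by case: eqP => // h; exfalso; move: h; lra.
Qed.

Lemma arrival_index_Some k :
  A @^-1` [set Some k.+1] = wp `&` (fun w c => Y c w) @^-1` arrival_set 0 k.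
Proof.
apply/seteqP; split=> w /=.
  move=> h; have wpw : wp w.
    by apply: contrapT => n; move: h; rewrite /arrival_index first_arrival_None.
  split=> //; have [ex ev es] := well_posed_config wpw.
  by rewrite /arrival_set /= ex ev es; apply/(first_arrivalE _ wpw).
move=> [wpw]; have [ex ev es] := well_posed_config wpw.
by rewrite /arrival_set /= ex ev es => /(first_arrivalE _ wpw).
Qed.

Lemma arrival_index_0 : A @^-1` [set Some 0%N] = set0.
Proof. by apply/seteqP; split=> w //=; apply: first_arrival_n0. Qed.

Let mcyl (C : set (g_sigma_algebraType (@rectangles R coord))) :
  measurable C -> measurable ((fun w c => Y c w : R) @^-1` C : set T).
Proof.
move=> mC; rewrite -[_ @^-1` _]setTI.
by apply: measurable_samples => //; exact: (bf_meas bY).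
Qed.

Lemma measurable_arrival_Some l : measurable (A @^-1` [set Some l]).
Proof.
case: l => [|k]; first by rewrite arrival_index_0.
rewrite arrival_index_Some; apply: measurableI; first exact: measurable_wp_set.
by apply: mcyl; exact: measurable_arrival_set.
Qed.

Lemma arrival_probability l : P (A @^-1` [set Some l]) = (a l)%:E.
Proof.
case: l => [|k]; first by rewrite arrival_index_0 measure0.
rewrite arrival_index_Some full_setI.
- by rewrite (prE bY); last exact: measurable_arrival_set.
- exact: measurable_wp_set.
- by apply: mcyl; exact: measurable_arrival_set.
- exact: wp_set_full bm.
Qed.

Definition arrival_in (D : set nat) : set T := \bigcup_(l in D) A @^-1` [set Some l].

Lemma measurable_arrival_in D : measurable (arrival_in D).
Proof. by apply: bigcup_measurable => l _; exact: measurable_arrival_Some. Qed.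

Lemma arrival_in_probability D : P (arrival_in D) = (\sum_(l <oo | l \in D) (a l)%:E)%E.
Proof.
rewrite /arrival_in measure_bigcup.
- by apply: eq_eseriesr => l _; exact: arrival_probability.
- by move=> l _; exact: measurable_arrival_Some.
- by move=> i j _ _ [w [/= -> []]].
Qed.

(** As [option nat] is countable, every preimage is a countable union of measurable fibres, the
    fibre of [None] being a complement. *)
Lemma arrival_preimage (B : set (option nat)) : A @^-1` B =
  arrival_in [set l | B (Some l)] `|` (if `[< B None >] then ~` arrival_in setT else set0).
Proof.
apply/seteqP; split=> w /=.
- move=> Bw; case e : (A w) Bw => [l|] Bw; first by left; exists l.
  right; move/asboolP : Bw => ->; move=> [l _ /=]; by rewrite e.
- case=> [[l /= Bl ->] //|]; case: ifPn => // /asboolP BN h.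
  case e : (A w) => [l|] //; exfalso; apply: h; by exists l.
Qed.

Lemma measurable_arrival (B : set (option nat)) : measurable (A @^-1` B).
Proof.
rewrite arrival_preimage; apply: measurableU; first exact: measurable_arrival_in.
by case: ifP => // _; apply: measurableC; exact: measurable_arrival_in.
Qed.

Lemma arrival_law (B : set (option nat)) : P (A @^-1` B) =
  (\sum_(l <oo | l \in [set l | B (Some l)]) (a l)%:E +
   (if `[< B None >] then 1 - \sum_(l <oo | l \in setT) (a l)%:E else 0))%E.
Proof.
pose N := if `[< B None >] then ~` arrival_in setT else set0.
have mN : measurable N.
  by rewrite /N; case: ifP => // _; apply: measurableC; exact: measurable_arrival_in.
transitivity (P (arrival_in [set l | B (Some l)]) + P N)%E.
  rewrite arrival_preimage; apply: measureU => //; first exact: measurable_arrival_in.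
  rewrite /N; case: ifP => _; last by rewrite setI0.
  by apply/seteqP; split=> w // -[[l _ h] n]; apply: n; exists l.
rewrite arrival_in_probability; congr (_ + _)%E; rewrite /N; case: ifP => _; last exact: measure0.
by rewrite probability_setC; [rewrite arrival_in_probability|exact: measurable_arrival_in].
Qed.

Lemma arrival_prob_ge0 l : 0 <= a l.
Proof. by case: l => // k; exact: pr_ge0. Qed.

Lemma psum_arrival_prob_le1 n : psum a n <= 1.
Proof.
case: n => [|n]; first by rewrite psum0.
rewrite /psum big_ord_recl add0r.
have mU : measurable (\bigcup_(i < n) arrival_set 0 i : set (g_sigma_algebraType (@rectangles R coord))).
  by apply: bigcup_measurable => i _; exact: measurable_arrival_set.
rewrite -[leLHS]/(\sum_(i < n) pr P Y (arrival_set 0 i)) -(pr_bigcup bY).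
- rewrite -lee_fin -(prE bY) //; apply: probability_le1; exact: mcyl.
- by move=> i; exact: measurable_arrival_set.
- by move=> i j y; exact: (arrival_unique (good_configuration y)).
Qed.

Lemma generating_series_sums z : -1 <= z <= 1 ->
  abs_sums (fun n => a n * z ^+ n) (generating_series P A z).
Proof.
move=> z1; have nz : `|z| <= 1 by rewrite ler_norml.
have nzk k : `|z ^+ k| <= 1 by rewrite normrX exprn_ile1.
split; last first.
  exists 1 => n; apply: le_trans (psum_arrival_prob_le1 n); apply: ler_sum => i _ /=.
  by rewrite normrM ger0_norm ?arrival_prob_ge0 // ler_piMr // arrival_prob_ge0.
(* The truncations [f n] of the integrand are bounded by 1 since [|z| <= 1], so dominated
   convergence identifies its integral with the sum of the series. *)
pose D k := A @^-1` [set Some k].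
have mD k : measurable (D k) by exact: measurable_arrival_Some.
pose g w : R := if A w is Some k then z ^+ k else 0.
pose f n w : \bar R := (\sum_(k < n) (z ^+ k)%:E * (\1_(D k) w)%:E)%E.
have fE n w : f n w = (if A w is Some k then if (k < n)%N then z ^+ k else 0 else 0)%:E.
  rewrite /f; under eq_bigr do rewrite -EFinM.
  rewrite sumEFin; congr EFin.
  case e : (A w) => [k|]; last first.
    apply: big1 => i _; rewrite indicE; case: (boolP (w \in D i)); rewrite ?mulr0 // inE.
    by rewrite /D /= e.
  case: ifPn => kn; last first.
    apply: big1 => i _; rewrite indicE; case: (boolP (w \in D i)); rewrite ?mulr0 // inE.
    by rewrite /D /= e => -[ki]; move: kn; rewrite ki ltn_ord.
  rewrite (bigD1 (Ordinal kn)) //= big1 ?addr0.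
    by rewrite indicE mem_set ?mulr1.
  move=> i ik; rewrite indicE; case: (boolP (w \in D i)); rewrite ?mulr0 // inE.
  rewrite /D /= e => -[ki]; case/eqP: ik; exact/val_inj.
have if_ n : P.-integrable setT (f n).
  apply: integrable_sum => // k _; apply: integrableZl => //.
  exact: integrable_indic.
have mg : measurable_fun setT (EFin \o g).
  apply/measurable_EFinP => _ B mB; rewrite setTI.
  have -> : g @^-1` B = A @^-1` [set o | B (if o is Some k then z ^+ k else 0)] by [].
  exact: measurable_arrival.
have fg w : f n w @[n --> \oo] --> (g w)%:E.
  apply: cvg_near_cst; rewrite /g; case e : (A w) => [k|]; last first.
    by apply: nearW => n; rewrite fE e.
  by exists k.+1 => // n /= kn; rewrite fE e kn.
have fle n w : (`|f n w| <= 1%:E)%E.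
  rewrite fE abse_EFin lee_fin; case: (A w) => [k|]; last by rewrite normr0.
  by case: ifP => _ //; rewrite normr0.
have i1 : P.-integrable setT (EFin \o cst (1 : R)) by exact: finite_measure_integrable_cst.
have [ig _ cvg_f] := dominated_convergence measurableT (fun n => measurable_int _ (if_ n)) mg
  (aeW P (fun w _ => fg w)) i1 (aeW P (fun w n _ => fle n w)).
have If n : (\int[P]_w f n w)%E = (psum (fun k => a k * z ^+ k) n)%:E.
  rewrite integral_sum //; last first.
    by move=> k; apply: integrableZl => //; exact: integrable_indic.
  rewrite /psum -sumEFin; apply: eq_bigr => k _.
  rewrite integralZl //; last exact: integrable_indic.
  transitivity ((z ^+ k)%:E * P (D k))%E.
    by congr (_ * _)%E; rewrite integral_indic // setIT.
  by rewrite arrival_probability -EFinM mulrC.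
rewrite /generating_series unlock -/g.
have fin_g : (\int[P]_w (g w)%:E)%E \is a fin_num by exact: integrable_fin_num.
rewrite -(fineK fin_g) in cvg_f.
have eqs : (fun n => fine (\int[P]_w f n w)%E) = psum (fun k => a k * z ^+ k).
  by apply/funext => n; rewrite If.
by rewrite -eqs; exact: (fine_cvg cvg_f).
Qed.

End ArrivalLaw.

Theorem theorem2 (R : realType) (p : R) (hp : 0 <= p <= 1) :
  (forall (d d' : measure_display)
      (T : measurableType d) (T' : measurableType d')
      (P : probability T R) (P' : probability T' R)
      (m m' : probability (measurableTypeR R) R)
      (x v s : nat -> {RV P >-> R}) (x' v' s' : nat -> {RV P' >-> R}),
      ballistic_model p m x v s -> ballistic_model p m' x' v' s' ->
      forall B : set (option nat),
        P (arrival_index x v s @^-1` B) = P' (arrival_index x' v' s' @^-1` B))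
  /\
  (forall (d : measure_display) (T : measurableType d) (P : probability T R)
      (m : probability (measurableTypeR R) R) (x v s : nat -> {RV P >-> R}),
      ballistic_model p m x v s ->
      let f := generating_series P (arrival_index x v s) in
      forall z : R, -1 <= z <= 1 ->
        p * z * f z ^+ 4 - (1 + 2 * p) * z * f z ^+ 2 + 2 * f z
          - (1 - p) * z = 0).
Proof.
split.
  move=> d d' T T' P P' m m' x v s x' v' s' bm bm' B.
  have bY := model_ballistic_family bm; have bY' := model_ballistic_family bm'.
  (* Both models satisfy the same recurrence, and the law on [option nat] is a function of its
     solution. *)
  have e := recurrence_unique (erefl _) (erefl _) (erefl _) (erefl _)
    (arrival_prob_rec bY) (annihilation_prob_rec bY) (arrival_prob_rec bY') (annihilation_prob_rec bY').
  by rewrite (arrival_law bm) (arrival_law bm') (funext e).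
move=> d T P m x v s bm f z hz.
have bY := model_ballistic_family bm.
exact: (generating_equation (erefl _) (erefl _) (arrival_prob_rec bY) (annihilation_prob_rec bY)
  (generating_series_sums bm hz)).
Qed.
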